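(* Let $\mathfrak g$ be a finite-dimensional semisimple Lie algebra over an algebraically closed field $\mathbb K$ of characteristic $0$, let $e\in\mathfrak g$ be nilpotent with $\mathfrak{sl}_2$-triple $(e,h,f)$ and grading $\mathfrak g=\bigoplus_{i\in\mathbb Z}\mathfrak g(i)$, $\mathfrak g(i)=\{x:[h,x]=ix\}$. Suppose $e$ is even and that a regular (principal) nilpotent element of the reductive Lie algebra $\mathfrak g_e(0)=\mathfrak g_e\cap\mathfrak g(0)$ is also a regular nilpotent element of $\mathfrak g(0)$. Then $\mathbb K[\mathfrak g_e]^{\mathfrak g_e}$ is a polynomial algebra, and the degrees of its basic (free homogeneous) generators are the same as those of $\mathbb K[\mathfrak g(0)]^{\mathfrak g(0)}$.
   Context: $e$ is even if all eigenvalues of $\mathrm{ad}\,h$ on $\mathfrak g$ are even. $\mathbb K[\mathfrak q]^{\mathfrak q}$ denotes the algebra of polynomial functions on the Lie algebra $\mathfrak q$ invariant under the adjoint representation. *)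

(* Defs.v *)
(* finite-dimensional Lie algebras over a field K modelled
   as K^n = 'rV[K]_n with an explicit bracket; subalgebras as row spaces
   (mxalgebra); polynomial functions on a subspace as multivariate
   polynomials (multinomials) in the coordinates w.r.t. row_base. *)
From HB Require Import structures.
From mathcomp Require Import all_boot all_order all_algebra.
From mathcomp Require Import mpoly.
Set Implicit Arguments. Unset Strict Implicit. Unset Printing Implicit Defensive.
Import Order.TTheory GRing.Theory Num.Theory.
Local Open Scope ring_scope.

Section Lie.
Variables (K : fieldType) (n : nat).
Notation V := 'rV[K]_n.
Variable br : V -> V -> V.

(* Lie algebra axioms: bilinear (left linearity + alternating), Jacobi *)
Definition is_lie_bracket : Prop :=
  [/\ (forall (a : K) (x y z : V), br (a *: x + y) z = a *: br x z + br y z),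
      (forall x : V, br x x = 0) &
      (forall x y z : V, br x (br y z) + br y (br z x) + br z (br x y) = 0)].

(* matrix of ad x acting on row vectors: v *m ad_mx x = [x, v] *)
Definition ad_mx (x : V) : 'M[K]_n := \matrix_(i < n) br x (delta_mx 0 i).

Definition ad_nilpotent (x : V) : Prop :=
  exists k : nat, forall v : V, iter k (br x) v = 0.

Definition bracket_span (A : 'M[K]_n) : 'M[K]_n :=
  (\sum_(i < n) \sum_(j < n) <<br (row i A) (row j A)>>)%MS.

Definition derived (A : 'M[K]_n) (k : nat) : 'M[K]_n := iter k bracket_span A.

Definition is_ideal (A : 'M[K]_n) : Prop :=
  forall x u : V, (u <= A)%MS -> (br x u <= A)%MS.

Definition semisimple : Prop :=
  forall A : 'M[K]_n, is_ideal A ->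
    (exists k, \rank (derived A k) = 0%N) -> \rank A = 0%N.

Definition sl2_triple (e h f : V) : Prop :=
  [/\ br h e = 2%:R *: e, br h f = - (2%:R *: f) & br e f = h].

Definition even_triple (h : V) : Prop :=
  forall (a : K) (x : V), x != 0 -> br h x = a *: x ->
    exists k : int, a = (2 * k)%:~R.

Definition centralizer (x : V) : 'M[K]_n := kermx (ad_mx x).
Definition grade (h : V) (i : int) : 'M[K]_n := kermx (ad_mx h - i%:~R%:M).

Definition centralizer_in (Q : 'M[K]_n) (x : V) : 'M[K]_n :=
  (Q :&: centralizer x)%MS.

Definition regular_in (Q : 'M[K]_n) (x : V) : Prop :=
  (x <= Q)%MS /\
  forall y : V, (y <= Q)%MS -> (\rank (centralizer_in Q x) <= \rank (centralizer_in Q y))%N.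

Definition regular_nilpotent_in (Q : 'M[K]_n) (x : V) : Prop :=
  regular_in Q x /\ ad_nilpotent x.

(* Polynomial functions on the subalgebra Q: polynomials in the coordinates
   with respect to the basis row_base Q. *)
Definition coord_of (Q : 'M[K]_n) (v : V) : 'rV[K]_(\rank Q) :=
  v *m pinvmx (row_base Q).
Definition point_of (Q : 'M[K]_n) (c : 'rV[K]_(\rank Q)) : V :=
  c *m row_base Q.

(* p is invariant under the adjoint representation of Q:
   for all x, y in Q, (x . p)(y) = d/dt p(y + t [x,y]) |_{t=0} = 0. *)
Definition ad_invariant (Q : 'M[K]_n) (p : {mpoly K[\rank Q]}) : Prop :=
  forall cx cy : 'rV[K]_(\rank Q),
    let z := coord_of Q (br (point_of (Q:=Q) cx) (point_of (Q:=Q) cy)) in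
    \sum_(i < \rank Q) z 0 i * (mderiv i p).@[fun j => cy 0 j] = 0.

Definition invariants_free_with_degrees (Q : 'M[K]_n) (ds : seq nat) : Prop :=
  exists fs : (size ds).-tuple {mpoly K[\rank Q]},
    [/\ (forall i : 'I_(size ds), tnth fs i \is (nth 0%N ds i).-homog),
        (forall i : 'I_(size ds), ad_invariant (tnth fs i)),
        (forall P : {mpoly K[size ds]}, P \mPo fs = 0 -> P = 0) &
        (forall p : {mpoly K[\rank Q]}, ad_invariant p ->
           exists P : {mpoly K[size ds]}, p = P \mPo fs)].

End Lie.

(* Main.v *)
(* Let [q] be a Lie algebra with a regular ad-nilpotent [x] and [h = [x, y]], [[h, x] = 2 x].  The
   linear forms vanishing on [[q, x]] have a basis of [h]-weight vectors [xi_i], of weights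
   [- 2 (d_i - 1)].  Each [xi_i] extends, one Taylor degree at [x] at a time, to an invariant
   [F_i] of degree [d_i] whose leading coefficient along [x] is [xi_i]: the obstructions vanish
   because [x] is regular and by Poincare's lemma, and [h]-weights make the series terminate.
   The leading coefficient along [x] of any homogeneous invariant is a polynomial in the [xi_i],
   so the [F_i] generate all invariants; their linear terms at [x] are the [xi_i], so they are
   free.
   This applies to both [g(0)] and [g_e]: the Killing form is nondegenerate on
   [k = g_e(0)], which yields [y] in [k], and as [e] is even the maps [(ad f)^j : g_e(2j) -> g(0)]
   assemble into an isomorphism [g_e -> g(0)] commuting with [k], so that the two sequences [d_i]
   agree.  Finally [x] is regular in [g_e] because [g_e] is the limit, as [t] tends to [0], of
   the centralizers of [e + t h], which are conjugate to [g(0)]. *)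
Require Import Defs.
From HB Require Import structures.
From mathcomp Require Import all_boot all_order all_algebra.
From mathcomp Require Import mpoly.
From mathcomp Require Import ring zify.
Import Order.TTheory GRing.Theory Num.Theory.
Local Open Scope ring_scope.

Set Implicit Arguments. Unset Strict Implicit. Unset Printing Implicit Defensive.

(** * Bilinearity of a semisimple bracket *)

(** Only the relations [[x, y] = h] and [[h, x] = 2 x] link [y] to [x]; no relation for [[h, y]] is
    imposed. They already give [X^n Y^n v = n! H (H - 1) ... (H - n + 1) v] on the kernel of [X], so
    that, once [X] is nilpotent, [H] is semisimple there with weights in the natural numbers. This
    identity replaces complete reducibility: it makes the Taylor coefficients exact weight vectors,
    it stops the series (the coefficient after degree [d] would have weight [-2]), and it grades
    [g_e]. Regularity enters through pencils. As [ad x] has maximal rank, each element centralizing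
    [x] is the constant term of series in [t] centralizing [x + t v] to any order; following such a
    series moves the obstruction down to the constant Taylor coefficient. Since [[h, x] = 2 x],
    prescribing [h]-weights amounts to Euler's identity at [x], so the invariant is its own top
    Taylor coefficient and nothing has to be summed. That the weights on the annihilator of [[q, x]]
    are even is forced by a dimension count. Degrees depend only on the operators [ad x] and [ad h],
    hence a linear isomorphism [g_e -> g(0)] that respects no bracket can still compare them. *)

Definition lie_axioms (K : fieldType) n (br : 'rV[K]_n -> 'rV[K]_n -> 'rV[K]_n) : Prop :=
  [/\ (forall a x y z, br (a *: x + y) z = a *: br x z + br y z),
      (forall x y, br x y = - br y x) &
      (forall x y z, br x (br y z) + br y (br z x) + br z (br x y) = 0)].

(* [is_lie_bracket] postulates linearity in the left argument only, and [br x x = 0] does not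
   yield the other half.  Writing [T a b c = br a (br b c)], the Jacobi identity shows that the
   additivity defect [D] of [T] in [b] is linear in [a] and [c] and vanishes when an increment
   of [b] equals [c]; symmetry then kills it, so [T] is trilinear and alternating in [b, c].
   Semisimplicity cancels the outer [br a]. *)
Section Bilinearity.
Variables (K : fieldType) (n : nat) (br : 'rV[K]_n -> 'rV[K]_n -> 'rV[K]_n).
Hypotheses (char0 : [pchar K] =i pred0) (lie : is_lie_bracket br).

Let brP a x y z : br (a *: x + y) z = a *: br x z + br y z.
Proof. by case: lie. Qed.
Let br_self x : br x x = 0.
Proof. by case: lie. Qed.
Let jacobi x y z : br x (br y z) + br y (br z x) + br z (br x y) = 0.
Proof. by case: lie. Qed.
Let brD x y z : br (x + y) z = br x z + br y z.
Proof. by rewrite -[x]scale1r brP !scale1r. Qed.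
Let br0l z : br 0 z = 0.
Proof. by apply: (addrI (br 0 z)); rewrite -brD !addr0. Qed.
Let brZ a x z : br (a *: x) z = a *: br x z.
Proof. by rewrite -[a *: x]addr0 brP br0l addr0. Qed.
Let brN x z : br (- x) z = - br x z.
Proof. by rewrite -scaleN1r brZ scaleN1r. Qed.
Let natK0 k : k.+1%:R != 0 :> K.
Proof. by move/pcharf0P: char0 => ->. Qed.

(** Jacobi at [x, x, x] reads [3 br x 0 = 0]; linearity on the right is not yet available. *)
Let br0r x : br x 0 = 0.
Proof.
have := jacobi x x x; rewrite br_self => /eqP.
rewrite -mulr2n -mulrSr -scaler_nat scaler_eq0 (negPf (natK0 _)) /= => /eqP //.
Qed.

Let T a b c := br a (br b c).
Let TDa a a' b c : T (a + a') b c = T a b c + T a' b c. Proof. exact: brD. Qed.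
Let TZa t a b c : T (t *: a) b c = t *: T a b c. Proof. exact: brZ. Qed.
Let Tself a b : T a b b = 0. Proof. by rewrite /T br_self br0r. Qed.
Let Tjac a b c : T a b c = - T b c a - T c a b.
Proof. by apply/eqP; rewrite -subr_eq0 !opprD !opprK addrA; apply/eqP/jacobi. Qed.

Let half_eq0 (u : 'rV[K]_n) : u = - u -> u = 0.
Proof.
move/eqP; rewrite -addr_eq0 -mulr2n -scaler_nat scaler_eq0 (negPf (natK0 1)) /=.
by move/eqP.
Qed.

Let D a c b b' := T a (b + b') c - T a b c - T a b' c.

Let DC a c b b' : D a c b b' = D a c b' b.
Proof. by rewrite /D [b + _]addrC addrAC. Qed.

Let D_jac a c b b' : D a c b b' = - (T c a (b + b') - T c a b - T c a b').
Proof.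
rewrite /D !(Tjac a _ c) TDa; apply/rowP => i; rewrite !mxE; ring.
Qed.

Let D_addc a c c' b b' : D a (c + c') b b' = D a c b b' + D a c' b b'.
Proof. rewrite !D_jac !TDa; apply/rowP => i; rewrite !mxE; ring. Qed.

Let D_cocycle a c b b' b'' :
  D a c (b + b') b'' + D a c b b' = D a c b (b' + b'') + D a c b' b''.
Proof. rewrite /D [b + (b' + b'')]addrA; apply/rowP => i; rewrite !mxE; ring. Qed.

Let D_self a c b : D a c b c = 0.
Proof. by rewrite /D /T brD br_self br0r addr0 subr0 subrr. Qed.

(** Polarization of [D_self] at [c + c']. Additivity in the last slot is still unknown, so the
    cocycle identity is what removes the increments equal to [c] or [c']. *)
Let D_anti a c c' b : D a c b c' = - D a c' b c.
Proof.
have e1 : D a c b (c + c') = D a c b c'.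
  have := D_cocycle a c b c' c; rewrite D_self [c' + c]addrC D_self addr0 add0r.
  by move=> ->.
have e2 : D a c' b (c + c') = D a c' b c.
  by have := D_cocycle a c' b c c'; rewrite !D_self add0r addr0.
have := D_addc a c c' b (c + c'); rewrite D_self e1 e2 => /eqP.
by rewrite eq_sym addr_eq0 => /eqP.
Qed.

(** Symmetric in [b, b'] and antisymmetric in [c, b']: six alternating swaps return to the start
    with sign [-1]. *)
Let D_eq0 a c b b' : D a c b b' = 0.
Proof. by apply: half_eq0; rewrite {1}(D_anti a c b' b) (DC a b' b c) (D_anti a b' b c)
  (DC a b c b') (D_anti a b c b') (DC a c b' b) opprK. Qed.

Let TDb a b b' c : T a (b + b') c = T a b c + T a b' c.
Proof. by apply/eqP; rewrite -subr_eq0 opprD addrA; apply/eqP/D_eq0. Qed.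

Let TDc a b c c' : T a b (c + c') = T a b c + T a b c'.
Proof. rewrite !(Tjac a) TDa TDb; apply/rowP => i; rewrite !mxE; ring. Qed.

Let Talt a b c : T a b c = - T a c b.
Proof.
have := Tself a (b + c); rewrite TDb !TDc !Tself add0r addr0 => /eqP.
by rewrite addr_eq0 => /eqP.
Qed.

(** The homogeneity defect of [T] in [b]. It is antisymmetric in [b, c] and symmetric in [a, c], so
    it vanishes by the same play of swaps as [D]. *)
Let h t a b c := T a (t *: b) c - t *: T a b c.

Let hDb t a b b' c : h t a (b + b') c = h t a b c + h t a b' c.
Proof. rewrite /h scalerDr !TDb; apply/rowP => i; rewrite !mxE; ring. Qed.
Let hDc t a b c c' : h t a b (c + c') = h t a b c + h t a b c'.
Proof. rewrite /h !TDc; apply/rowP => i; rewrite !mxE; ring. Qed.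
Let h_self t a b : h t a b b = 0.
Proof. by rewrite /h /T brZ br_self scaler0 br0r scaler0 subr0. Qed.
Let h_anti t a b c : h t a b c = - h t a c b.
Proof.
have := h_self t a (b + c); rewrite hDb !hDc !h_self add0r addr0 => /eqP.
by rewrite addr_eq0 => /eqP.
Qed.
Let h_sym t a b c : h t a b c = h t c b a.
Proof.
rewrite /h (Tjac a _ c) (Tjac a b c) (Talt c a) (Talt c a) TZa.
by apply/rowP => i; rewrite !mxE; ring.
Qed.

Let TZb t a b c : T a (t *: b) c = t *: T a b c.
Proof.
apply/eqP; rewrite -subr_eq0; apply/eqP; rewrite -/(h t a b c); apply: half_eq0.
by rewrite {1}(h_sym t a b c) (h_anti t c b a) (h_sym t c a b) (h_anti t b a c)
  (h_sym t b c a) (h_anti t a c b) !opprK.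
Qed.

Hypothesis ss : semisimple br.

(** Such a [w] spans an abelian ideal. All multiples of [w] appear because homogeneity in the second
    argument is not yet established. *)
Let line_eq0 w : (forall x t, br x (t *: w) = 0) -> w = 0.
Proof.
move=> w0; have := @ss <<w>>%MS; rewrite mxrank_gen => h0.
apply/eqP; rewrite -mxrank_eq0; apply/eqP/h0 => [x u|].
  by rewrite genmxE => /sub_rVP [t ->]; rewrite w0 sub0mx.
exists 1%N; apply/eqP; rewrite mxrank_eq0 /derived /= /bracket_span.
rewrite big1 // => i _; rewrite big1 // => j _.
have : (row j <<w>>%MS <= w)%MS by rewrite (submx_trans (row_sub j _)) // genmxE.
by case/sub_rVP => t ->; rewrite w0 genmx0.
Qed.

Let T_nondeg b : (forall a c, T a b c = 0) -> b = 0.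
Proof.
move=> b0; apply: line_eq0 => x t; apply: line_eq0 => y s.
have -> : br y (s *: br x (t *: b)) = T y (s *: x) (t *: b) by rewrite /T brZ.
by rewrite Talt TZb b0 scaler0 oppr0.
Qed.

Let br_inj u v : (forall a, br a u = br a v) -> u = v.
Proof.
move=> uv; apply/eqP; rewrite -subr_eq0; apply/eqP/T_nondeg => a c.
rewrite -[- v]scaleN1r TDb TZb scaleN1r !(Talt a _ c) /T uv; exact: subrr.
Qed.

Lemma semisimple_lie_axioms : lie_axioms br.
Proof.
split=> // b c; apply: br_inj => a.
by rewrite -brN -/(T a b c) Talt -/(T a (- c) b) -[in RHS]scaleN1r TZb scaleN1r.
Qed.

End Bilinearity.

(** * Derivations of polynomials *)

Section PolynomialDerivations.
Variables (K : fieldType) (N : nat).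
Local Notation R := {mpoly K[N]}.
Implicit Types (p q : R) (v w : 'rV[K]_N) (A B : 'M[K]_N).

Lemma mpoly_alg_ind (P : R -> Prop) :
  (forall c : K, P c%:MP) -> (forall i, P 'X_i) ->
  (forall p q, P p -> P q -> P (p + q)) ->
  (forall p q, P p -> P q -> P (p * q)) -> forall p, P p.
Proof.
move=> PC PX PD PM p; rewrite (mpolyE p).
elim/big_ind: _ => [||m _]; [by rewrite -[0]mpolyC0|exact: PD|].
rewrite -mul_mpolyC; apply: (PM) => //; rewrite mpolyXE_id.
elim/big_ind: _ => [||i _]; [by rewrite -mpolyC1|exact: PM|].
by elim: (m i) => [|k IH]; rewrite ?expr0 -?mpolyC1 // exprS; apply: (PM).
Qed.

Lemma homog_mdeg k p m : p \is k.-homog -> m \in msupp p -> mdeg m = k.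
Proof. by move=> hp; apply: (dhomog_mf hp). Qed.

Lemma homog0_const p : p \is 0.-homog -> p = (p@_0)%:MP.
Proof.
move=> hp; apply/mpolyP => m; rewrite mcoeffC.
have [->|m0] := eqVneq; first by rewrite mulr1.
rewrite mulr0; apply: contraNeq m0; rewrite -mcoeff_msupp => /(homog_mdeg hp)/eqP.
by rewrite mdeg_eq0 eq_sym.
Qed.

Definition der (c : 'I_N -> R) p : R := \sum_i c i * p^`M(i).

Lemma der_is_linear c : linear (der c).
Proof.
move=> a p q; rewrite /der scaler_sumr -big_split /=; apply: eq_bigr => i _.
by rewrite mderivD mderivZ mulrDr scalerAr.
Qed.
HB.instance Definition _ c :=
  GRing.isLinear.Build K R R _ (der c) (der_is_linear c).

Lemma derM c p q : der c (p * q) = der c p * q + p * der c q.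
Proof.
rewrite /der mulr_suml mulr_sumr -big_split /=; apply: eq_bigr => i _.
by rewrite mderivM; ring.
Qed.

Lemma derXU c i : der c 'X_i = c i.
Proof.
rewrite /der (bigD1 i) //= big1 ?addr0 => [|j ji].
  have UU : (U_(i) - U_(i) = 0 :> 'X_{1..N})%MM.
    by apply/mnmP => k; rewrite mnmBE subnn mnm0E.
  by rewrite mderivX mnm1E eqxx UU mpolyX0 scale1r mulr1.
by rewrite mderivX mnm1E eq_sym (negPf ji) scale0r mulr0.
Qed.

Lemma derC c a : der c a%:MP = 0.
Proof. by rewrite /der big1 // => i _; rewrite mderivC mulr0. Qed.

Lemma der_coefD c d p : der (fun i => c i + d i) p = der c p + der d p.
Proof. by rewrite /der -big_split; apply: eq_bigr => i _; rewrite mulrDl. Qed.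

Lemma der_coefZ a c p : der (fun i => a *: c i) p = a *: der c p.
Proof. by rewrite /der scaler_sumr; apply: eq_bigr => i _; rewrite -scalerAl. Qed.

Lemma eq_der c d p : c =1 d -> der c p = der d p.
Proof. by move=> cd; apply: eq_bigr => i _; rewrite cd. Qed.

(** The commutator of two vector fields is a vector field: the second-order parts agree since
    partial derivatives commute. *)
Lemma der_comm c d p :
  der c (der d p) = der d (der c p) + der (fun i => der c (d i) - der d (c i)) p.
Proof.
have Dsum c' d' : der c' (der d' p) =
    der (fun i => der c' (d' i)) p + \sum_i \sum_j d' i * c' j * p^`M(i)^`M(j).
  rewrite {2}/der raddf_sum -big_split /=; apply: eq_bigr => i _.
  rewrite derM; congr (_ + _); rewrite /der mulr_sumr.
  by apply: eq_bigr => j _; rewrite mulrA.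
rewrite !Dsum [in LHS]exchange_big /=.
have -> : \sum_j \sum_i d i * c j * p^`M(i)^`M(j) =
          \sum_i \sum_j c i * d j * p^`M(i)^`M(j).
  by apply: eq_bigr => i _; apply: eq_bigr => j _; rewrite mderiv_comm [d j * _]mulrC.
rewrite [RHS]addrAC; congr (_ + _); rewrite -der_coefD.
by apply: eq_der => i; rewrite addrC subrK.
Qed.

Definition ddir w : R -> R := der (fun i => (w 0 i)%:MP).
Definition linform A i : R := \sum_j A j i *: 'X_j.
(** The linear vector field [v |-> v *m A]. For [A = ad a] this is [v |-> [a, v]], so the invariants
    are the polynomials killed by [mxder (ad a)] for all [a]. *)
Definition mxder A : R -> R := der (linform A).
HB.instance Definition _ w := GRing.Linear.on (ddir w).
HB.instance Definition _ A := GRing.Linear.on (mxder A).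

Lemma ddirM w p q : ddir w (p * q) = ddir w p * q + p * ddir w q.
Proof. exact: derM. Qed.
Lemma mxderM A p q : mxder A (p * q) = mxder A p * q + p * mxder A q.
Proof. exact: derM. Qed.
Lemma ddirXU w i : ddir w 'X_i = (w 0 i)%:MP.
Proof. exact: derXU. Qed.
Lemma mxderXU A i : mxder A 'X_i = linform A i.
Proof. exact: derXU. Qed.

Lemma ddirP a w w' p : ddir (a *: w + w') p = a *: ddir w p + ddir w' p.
Proof.
rewrite /ddir -der_coefZ -der_coefD; apply: eq_der => i.
by rewrite !mxE mpolyCD mpolyCM mul_mpolyC.
Qed.
Lemma ddir0 p : ddir 0 p = 0.
Proof. by have := ddirP (-1) 0 0 p; rewrite scaler0 addr0 scaleN1r addNr. Qed.
Lemma ddirD w w' p : ddir (w + w') p = ddir w p + ddir w' p.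
Proof. by have := ddirP 1 w w' p; rewrite !scale1r. Qed.
Lemma ddirZ a w p : ddir (a *: w) p = a *: ddir w p.
Proof. by have := ddirP a w 0 p; rewrite ddir0 !addr0. Qed.
Lemma ddirN w p : ddir (- w) p = - ddir w p.
Proof. by rewrite -scaleN1r ddirZ scaleN1r. Qed.

Lemma ddir_suml (I : Type) (r : seq I) P (F : I -> 'rV[K]_N) p :
  ddir (\sum_(i <- r | P i) F i) p = \sum_(i <- r | P i) ddir (F i) p.
Proof. exact: (big_morph (ddir^~ p) (fun u v => ddirD u v p) (ddir0 p)). Qed.

Lemma mxderP a A B p : mxder (a *: A + B) p = a *: mxder A p + mxder B p.
Proof.
rewrite /mxder -der_coefZ -der_coefD; apply: eq_der => i.
rewrite /linform scaler_sumr -big_split /=; apply: eq_bigr => j _.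
by rewrite !mxE scalerDl scalerA.
Qed.
Lemma mxder0 p : mxder 0 p = 0.
Proof. by have := mxderP (-1) 0 0 p; rewrite scaler0 addr0 scaleN1r addNr. Qed.
Lemma mxderD A B p : mxder (A + B) p = mxder A p + mxder B p.
Proof. by have := mxderP 1 A B p; rewrite !scale1r. Qed.
Lemma mxderZ a A p : mxder (a *: A) p = a *: mxder A p.
Proof. by have := mxderP a A 0 p; rewrite mxder0 !addr0. Qed.
Lemma mxderN A p : mxder (- A) p = - mxder A p.
Proof. by rewrite -scaleN1r mxderZ scaleN1r. Qed.

Lemma ddir_linform w A i : ddir w (linform A i) = ((w *m A) 0 i)%:MP.
Proof.
rewrite /linform raddf_sum mxE raddf_sum; apply: eq_bigr => j _ /=.
by rewrite linearZ /= ddirXU mulrC mpolyCM mul_mpolyC.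
Qed.

Lemma mxder_linform A B i : mxder A (linform B i) = linform (A *m B) i.
Proof.
rewrite /linform raddf_sum /=.
under eq_bigr do rewrite linearZ /= mxderXU /linform scaler_sumr.
rewrite exchange_big /=; apply: eq_bigr => j _; rewrite mxE scaler_suml.
by apply: eq_bigr => k _; rewrite scalerA mulrC.
Qed.

Lemma ddirC w w' p : ddir w (ddir w' p) = ddir w' (ddir w p).
Proof.
rewrite /ddir der_comm -[RHS]addr0; congr (_ + _).
by apply: big1 => i _; rewrite !derC subrr mul0r.
Qed.

Lemma ddir_mxder w A p : ddir w (mxder A p) = mxder A (ddir w p) + ddir (w *m A) p.
Proof.
rewrite /mxder {1}/ddir der_comm; congr (_ + _).
by apply: eq_der => i; rewrite -/(ddir w _) ddir_linform derC subr0.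
Qed.

Lemma mxder_comm A B p :
  mxder A (mxder B p) = mxder B (mxder A p) + mxder (A *m B - B *m A) p.
Proof.
rewrite /mxder der_comm; congr (_ + _); apply: eq_der => i.
rewrite -/(mxder A _) -/(mxder B _) !mxder_linform /linform -sumrB.
by apply: eq_bigr => j _; rewrite !mxE scalerBl.
Qed.

(** Euler's identity: [mxder 1%:M] is the Euler vector field. *)
Lemma mxder1_homog k p : p \is k.-homog -> mxder 1%:M p = k%:R *: p.
Proof.
move=> hp; rewrite [in RHS](mpolyE p) [in LHS](mpolyE p) raddf_sum scaler_sumr /=.
apply: eq_big_seq => m mp; rewrite linearZ /= !scalerA [_ * p@_m]mulrC -scalerA.
congr (_ *: _); rewrite -(homog_mdeg hp mp) mdegE natr_sum scaler_suml.
apply: eq_bigr => i _; rewrite mderivX.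
have -> : linform 1%:M i = 'X_i.
  rewrite /linform (bigD1 i) //= big1 ?addr0 => [|j ji].
    by rewrite mxE eqxx scale1r.
  by rewrite mxE (negPf ji) scale0r.
have [->|mi] := eqVneq (m i) 0%N; first by rewrite !scale0r mulr0.
by rewrite -scalerAr -mpolyXD addmC submK ?lep1mP.
Qed.

Lemma mderiv_homog k i p : p \is k.+1.-homog -> p^`M(i) \is k.-homog.
Proof.
move=> hp; apply/dhomogP => m; rewrite mcoeff_msupp mcoeff_deriv => nz.
have : (m + U_(i))%MM \in msupp p.
  by rewrite mcoeff_msupp; apply: contraNneq nz => ->; rewrite mul0rn.
by move/(homog_mdeg hp); rewrite mdegD mdeg1 addn1 => -[].
Qed.

Lemma ddir_homog k w p : p \is k.+1.-homog -> ddir w p \is k.-homog.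
Proof.
move=> hp; rewrite rpred_sum // => i _.
by rewrite mul_mpolyC rpredZ // mderiv_homog.
Qed.

Lemma ddir_homog0 w p : p \is 0.-homog -> ddir w p = 0.
Proof.
by move=> hp; rewrite (homog0_const hp) /ddir derC.
Qed.

Lemma linform_homog A i : linform A i \is 1.-homog.
Proof. by rewrite rpred_sum // => j _; rewrite rpredZ // dhomogX; apply/eqP; apply: mdeg1. Qed.

Lemma mxder_homog k A p : p \is k.-homog -> mxder A p \is k.-homog.
Proof.
case: k => [|k] hp.
  suff -> : mxder A p = 0 by rewrite rpred0.
  by rewrite (homog0_const hp) /mxder derC.
rewrite rpred_sum // => i _; rewrite -add1n dhomogM ?linform_homog //.
exact: mderiv_homog.
Qed.

Definition covec (c : 'cV[K]_N) : R := \sum_j c j 0 *: 'X_j.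

Lemma covec_homog c : covec c \is 1.-homog.
Proof.
by rewrite rpred_sum // => j _; rewrite rpredZ // dhomogX; apply/eqP; apply: mdeg1.
Qed.

Lemma covecZ a c : covec (a *: c) = a *: covec c.
Proof. by rewrite /covec scaler_sumr; apply: eq_bigr => j _; rewrite mxE scalerA. Qed.

Lemma ddir_covec w c : ddir w (covec c) = ((w *m c) 0 0)%:MP.
Proof.
rewrite /covec raddf_sum mxE raddf_sum; apply: eq_bigr => j _ /=.
by rewrite linearZ /= ddirXU mpolyCM mulrC mul_mpolyC.
Qed.

Lemma mxder_covec A c : mxder A (covec c) = covec (A *m c).
Proof.
rewrite /covec raddf_sum /=.
under eq_bigr do rewrite linearZ /= mxderXU /linform scaler_sumr.
rewrite exchange_big /=; apply: eq_bigr => j _; rewrite mxE scaler_suml.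
by apply: eq_bigr => k _; rewrite scalerA mulrC.
Qed.

Lemma ev_covec v c : (covec c).@[fun i => v 0 i] = (v *m c) 0 0.
Proof.
rewrite /covec raddf_sum mxE; apply: eq_bigr => j _ /=.
by rewrite mevalZ mevalXU mulrC.
Qed.

Definition ev v p : K := p.@[fun i => v 0 i].

Lemma ev_mxder A v p : ev v (mxder A p) = ev v (ddir (v *m A) p).
Proof.
rewrite /ev /mxder /ddir /der !raddf_sum; apply: eq_bigr => i _ /=.
rewrite !mevalM mevalC; congr (_ * _); rewrite /linform raddf_sum mxE.
by apply: eq_bigr => j _; rewrite /= mevalZ mevalXU mulrC.
Qed.

Definition on_line v w p : {poly K} :=
  mmap polyC (fun i => (v 0 i)%:P + w 0 i *: 'X) p.
Fact on_line_is_additive v w : additive (on_line v w).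
Proof. exact: mmap_is_additive. Qed.
Fact on_line_is_multiplicative v w : multiplicative (on_line v w).
Proof. exact: mmap_is_multiplicative. Qed.
HB.instance Definition _ v w := GRing.isAdditive.Build R {poly K} (on_line v w)
  (on_line_is_additive v w).
HB.instance Definition _ v w := GRing.isMultiplicative.Build R {poly K} (on_line v w)
  (on_line_is_multiplicative v w).

Lemma on_lineC v w c : on_line v w c%:MP = c%:P.
Proof. exact: mmapC. Qed.
Lemma on_lineXU v w i : on_line v w 'X_i = (v 0 i)%:P + w 0 i *: 'X.
Proof. by rewrite /on_line mmapX mmap1U. Qed.
Lemma on_lineZ v w c p : on_line v w (c *: p) = c *: on_line v w p.
Proof. by rewrite /on_line mmapZ mul_polyC. Qed.

Lemma horner_on_line v w p t : (on_line v w p).[t] = ev (v + t *: w) p.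
Proof.
rewrite /ev; elim/mpoly_alg_ind: p => [c|i|p q IHp IHq|p q IHp IHq].
- by rewrite on_lineC hornerC mevalC.
- by rewrite on_lineXU mevalXU !mxE !hornerE mulrC.
- by rewrite rmorphD hornerD IHp IHq mevalD.
- by rewrite rmorphM hornerM IHp IHq mevalM.
Qed.

Lemma deriv_on_line v w p : (on_line v w p)^`() = on_line v w (ddir w p).
Proof.
elim/mpoly_alg_ind: p => [c|i|p q IHp IHq|p q IHp IHq].
- by rewrite on_lineC derivC /ddir derC rmorph0.
- by rewrite on_lineXU ddirXU on_lineC derivD derivC derivZ derivX add0r alg_polyC.
- by rewrite raddfD /= [ddir w _]raddfD !rmorphD /= derivD IHp IHq.
- by rewrite ddirM rmorphD !rmorphM /= derivM IHp IHq.
Qed.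

End PolynomialDerivations.

(** * Evaluation, integration and locally nilpotent derivations in characteristic 0 *)

Section CharZero.
Variable K : fieldType.
Hypothesis char0 : [pchar K] =i pred0.

Lemma natr0 n : (n%:R == 0 :> K) = (n == 0%N).
Proof. by move/pcharf0P: char0 => ->. Qed.

Lemma natrS0 n : n.+1%:R != 0 :> K.
Proof. by rewrite natr0. Qed.

Lemma natr_inj : injective (fun n => n%:R : K).
Proof.
move=> m n /eqP; wlog le_mn : m n / (m <= n)%N => [hw|].
  by case/orP: (leq_total m n) => le; [|rewrite eq_sym => /eqP e; apply/esym; move/eqP: e];
    apply: hw.
by rewrite eq_sym -subr_eq0 -natrB // natr0 subn_eq0 => ge; apply/eqP; rewrite eqn_leq le_mn.
Qed.

Lemma fact_neq0 n : n`!%:R != 0 :> K.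
Proof. by rewrite natr0 -lt0n fact_gt0. Qed.

Lemma poly_vanish (q : {poly K}) : (forall t, t != 0 -> q.[t] = 0) -> q = 0.
Proof.
move=> q0; apply/eqP/negPn/negP => nz.
have := @max_poly_roots _ q [seq n.+1%:R | n <- iota 0 (size q)] nz.
rewrite size_map size_iota ltnn => h; apply: notF; apply: h.
  by apply/allP => _ /mapP [n _ ->]; rewrite rootE q0 ?natrS0.
by rewrite map_inj_uniq ?iota_uniq // => i j /natr_inj [].
Qed.

Lemma deriv0_const (q : {poly K}) : q^`() = 0 -> q = (q`_0)%:P.
Proof.
move=> dq; apply/polyP => -[|i]; rewrite coefC //=.
have : q^`()`_i = 0 by rewrite dq coef0.
by rewrite coef_deriv -mulr_natr => /eqP; rewrite mulf_eq0 (negPf (natrS0 i)) orbF => /eqP.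
Qed.

Variable N : nat.
Local Notation R := {mpoly K[N]}.

Lemma ddir_delta i (p : R) : ddir (delta_mx 0 i) p = p^`M(i).
Proof.
rewrite /ddir /der (bigD1 i) //= big1 => [|j ji].
  by rewrite mxE !eqxx mpolyC1 mul1r addr0.
by rewrite mxE (negPf ji) andbF mpolyC0 mul0r.
Qed.

Lemma ev0 (p : R) : ev 0 p = p@_0%MM.
Proof.
rewrite /ev; elim/mpoly_alg_ind: p => [c|i|p q IHp IHq|p q IHp IHq].
- by rewrite mevalC mcoeffC eqxx mulr1.
- by rewrite mevalXU mxE mcoeffX mnm1_eq0.
- by rewrite mevalD mcoeffD IHp IHq.
- by rewrite mevalM IHp IHq [RHS]rmorphM.
Qed.

(** Induction on the degree of the monomial: restricting to lines shows that the partial derivatives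
    vanish at every point too, and in characteristic 0 a coefficient of [p] is recovered from one of
    a partial derivative. *)
Lemma ev_eq0 (p : R) : (forall v, ev v p = 0) -> p = 0.
Proof.
move=> p0; apply/mpolyP => m; rewrite mcoeff0.
move: {2}(mdeg m) (erefl (mdeg m)) => n.
elim: n m p p0 => [|n IH] m p p0 mn.
  by move/eqP: mn; rewrite mdeg_eq0 => /eqP ->; rewrite -ev0.
have [i mi] : exists i, m i != 0%N.
  apply/existsP; apply: contraT; rewrite negb_exists => /forallP m0.
  move: mn; rewrite mdegE big1 // => i _.
  by apply/eqP; move: (m0 i); rewrite negbK.
have mE : m = (m - U_(i) + U_(i))%MM by rewrite submK ?lep1mP.
have d0 v : ev v p^`M(i) = 0.
  have line0 : on_line v (delta_mx 0 i) p = 0.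
    by apply: poly_vanish => t _; rewrite horner_on_line.
  have := deriv_on_line v (delta_mx 0 i) p.
  rewrite line0 deriv0 ddir_delta => /(congr1 (fun q => q.[0])).
  by rewrite horner0 horner_on_line scale0r addr0.
have := IH (m - U_(i))%MM _ d0.
rewrite mcoeff_deriv -mE -mulr_natr => /(_ _)/eqP.
rewrite mulf_eq0 (negPf (natrS0 _)) orbF => h; apply/eqP; apply: h.
by move: mn; rewrite {1}mE mdegD mdeg1 addn1 => -[].
Qed.

Lemma ev_translate (p : R) v w : ddir w p = 0 -> ev (v + w) p = ev v p.
Proof.
move=> wp; have := deriv_on_line v w p; rewrite wp rmorph0 => /deriv0_const e.
have := horner_on_line v w p 1; have := horner_on_line v w p 0.
by rewrite e !hornerC scale1r scale0r addr0 => <-.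
Qed.

Lemma iter_ddir_homog k j w (p : R) : p \is k.-homog -> (j <= k)%N ->
  iter j (ddir w) p \is (k - j).-homog.
Proof.
move=> hp; elim: j => [|j IH] jk; first by rewrite subn0.
rewrite iterS; apply: ddir_homog; rewrite -subSn // subSS; exact/IH/ltnW.
Qed.

Lemma iter_ddir_gt k j w (p : R) : p \is k.-homog -> (k < j)%N -> iter j (ddir w) p = 0.
Proof.
move=> hp kj; rewrite -(subnK kj) iterD iterS.
have := iter_ddir_homog w hp (leqnn k); rewrite subnn => /ddir_homog0 ->.
by elim: (j - k.+1)%N => //= i ->; rewrite raddf0.
Qed.

(* Integration of [psi] along [w], where [y] is a linear form with [y(w) = 1]. *)
Definition antideriv w (y psi : R) k : R :=
  \sum_(j < k.+1) (((-1) ^+ j / j.+1`!%:R) *: (y ^+ j.+1 * iter j (ddir w) psi)).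

Lemma ddir_exp w (y : R) j : ddir w (y ^+ j.+1) = j.+1%:R *: (y ^+ j * ddir w y).
Proof.
elim: j => [|j IH]; first by rewrite expr0 mul1r scale1r.
rewrite exprS ddirM IH -!mul_mpolyC !mpolyC_nat !exprS; ring.
Qed.

(** Repeated integration by parts: the terms telescope, and the last one vanishes because [k + 1]
    derivatives kill degree [k]. *)
Lemma antiderivP w (y psi : R) k : psi \is k.-homog -> ddir w y = 1 ->
  ddir w (antideriv w y psi k) = psi.
Proof.
move=> hpsi wy; pose u j : R := ((-1) ^+ j / j`!%:R) *: (y ^+ j * iter j (ddir w) psi).
have -> : ddir w (antideriv w y psi k) = \sum_(j < k.+1) (u j - u j.+1).
  rewrite raddf_sum; apply: eq_bigr => j _ /=.
  rewrite linearZ /= ddirM ddir_exp wy mulr1 scalerDr /u; congr (_ + _).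
    rewrite -scalerAl scalerA factS natrM invfM mulrA mulrAC.
    by rewrite divfK ?natrS0.
  by rewrite -scaleNr [(-1) ^+ j.+1]exprS mulN1r mulNr opprK.
under eq_bigr do rewrite -opprB.
rewrite sumrN -(big_mkord xpredT (fun j => u j.+1 - u j)) telescope_sumr //.
by rewrite opprB /u (iter_ddir_gt w hpsi (ltnSn k)) mulr0 scaler0 subr0 !expr0 divr1 scale1r mul1r.
Qed.

Lemma antideriv_homog w (y psi : R) k : psi \is k.-homog -> y \is 1.-homog ->
  antideriv w y psi k \is k.+1.-homog.
Proof.
move=> hpsi hy; rewrite rpred_sum // => -[j /= jk] _; apply: rpredZ.
have -> : k.+1 = (1 * j.+1 + (k - j))%N by lia.
by rewrite dhomogM // ?dhomogMn // iter_ddir_homog.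
Qed.

Lemma ddir_antideriv w w' (y psi : R) k : ddir w' y = 0 ->
  ddir w' (antideriv w y psi k) = antideriv w y (ddir w' psi) k.
Proof.
move=> wy; rewrite /antideriv raddf_sum; apply: eq_bigr => j _ /=.
rewrite linearZ /= ddirM ddir_exp wy mulr0 scaler0 mul0r add0r.
by congr (_ *: (_ * _)); elim: (nat_of_ord j) => //= i <-; rewrite ddirC.
Qed.

Lemma antideriv0 w (y : R) k : antideriv w y 0 k = 0.
Proof.
rewrite /antideriv big1 // => j _.
have -> : iter j (ddir w) (0 : R) = 0 by elim: (nat_of_ord j) => //= i ->; rewrite raddf0.
by rewrite mulr0 scaler0.
Qed.

(* Poincare's lemma, solving for one independent direction at a time. *)
Lemma closed_forms_exact p (W : 'M[K]_(p, N)) (psi : 'I_p -> R) k : row_free W ->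
  (forall i, psi i \is k.-homog) ->
  (forall i j, ddir (row i W) (psi j) = ddir (row j W) (psi i)) ->
  exists2 P : R, P \is k.+1.-homog & forall i, ddir (row i W) P = psi i.
Proof.
move=> freeW hpsi closed.
have [V WV] : exists V, W *m V = 1%:M by exists (pinvmx W); apply: mulmxVp.
pose y i : R := \sum_j V j i *: 'X_j.
have hy i : y i \is 1.-homog.
  by rewrite rpred_sum // => j _; rewrite rpredZ // dhomogX; apply/eqP; apply: mdeg1.
have wy i j : ddir (row i W) (y j) = (i == j)%:R.
  have -> : ddir (row i W) (y j) = ((W *m V) i j)%:MP.
    rewrite /y raddf_sum mxE raddf_sum; apply: eq_bigr => l _ /=.
    by rewrite linearZ /= ddirXU mxE mpolyCM mulrC mul_mpolyC.
  by rewrite WV mxE mpolyC_nat.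
suff /(_ p (leqnn p)) [P hP HP] : forall m, (m <= p)%N -> exists2 P : R,
    P \is k.+1.-homog & forall i : 'I_p, (i < m)%N -> ddir (row i W) P = psi i.
  by exists P => // i; apply: HP.
elim=> [|m IH] mp; first by exists 0; rewrite ?rpred0.
have [P hP HP] := IH (ltnW mp); pose i0 := Ordinal mp.
(* Closedness makes the earlier directions kill [rho], and they also kill [y i0]; adding the
   integral of [rho] along [row i0 W] therefore keeps the equations already solved. *)
pose rho := psi i0 - ddir (row i0 W) P.
have hrho : rho \is k.-homog by rewrite rpredB // ddir_homog.
exists (P + antideriv (row i0 W) (y i0) rho k).
  by rewrite rpredD // antideriv_homog.
move=> i; rewrite ltnS leq_eqVlt => /orP [/eqP im|im].
  have -> : i = i0 by apply: val_inj.
  by rewrite raddfD /= antiderivP // ?wy ?eqxx // /rho addrC subrK.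
have ii0 : (i == i0) = false by apply/eqP => ii; move: im; rewrite ii /= ltnn.
rewrite raddfD /= HP // ddir_antideriv ?wy ?ii0 //.
suff -> : ddir (row i W) rho = 0 by rewrite antideriv0 addr0.
by rewrite raddfB /= closed ddirC HP // subrr.
Qed.

(** Pigeonhole in the Leibniz rule: of [a + b + 1] derivatives, more than [a] fall on [p] or more
    than [b] on [q]. *)
Lemma mxder_nil_mul A a b (p q : R) : iter a.+1 (mxder A) p = 0 ->
  iter b.+1 (mxder A) q = 0 -> iter (a + b).+1 (mxder A) (p * q) = 0.
Proof.
move: {2}(a + b)%N (erefl (a + b)%N) => n.
elim: n a b p q => [|n IH] a b p q ab; rewrite ab.
  move: ab => /eqP; rewrite addn_eq0 => /andP [/eqP -> /eqP ->] /= p0 q0.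
  by rewrite mxderM p0 q0 mul0r mulr0 addr0.
have addfi i u v : iter i (mxder A) (u + v) = iter i (mxder A) u + iter i (mxder A) v.
  by elim: i => //= i ->; rewrite raddfD.
have iter0 i : iter i (mxder A) (0 : R) = 0 by elim: i => //= i ->; rewrite raddf0.
move=> pa qb; rewrite iterSr mxderM addfi.
suff [-> ->] : iter n.+1 (mxder A) (mxder A p * q) = 0 /\
               iter n.+1 (mxder A) (p * mxder A q) = 0 by rewrite addr0.
split.
  case: a ab pa => [|a] ab pa; first by rewrite /= in pa; rewrite pa mul0r iter0.
  have an : (a + b)%N = n by lia.
  by rewrite -an; apply: (IH a b) => //; rewrite -iterSr.
case: b ab qb => [|b] ab qb; first by rewrite /= in qb; rewrite qb mulr0 iter0.
have an : (a + b)%N = n by lia.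
by rewrite -an; apply: (IH a b) => //; rewrite -iterSr.
Qed.

Lemma iter_mxder_linform A i j : iter j (mxder A) 'X_i = linform (A ^+ j) i :> R.
Proof.
elim: j => [|j IH] /=.
  rewrite expr0 /linform (bigD1 i) //= big1 ?addr0 => [|l li].
    by rewrite mxE eqxx scale1r.
  by rewrite mxE (negPf li) scale0r.
by rewrite IH mxder_linform exprS.
Qed.

(** Each variable survives at most [m] applications, so a monomial of degree [k] survives at most
    [m * k]: one [M] serves a whole degree, although the polynomial ring is infinite-dimensional. *)
Lemma mxder_nilpotent (A : 'M[K]_N) m k : A ^+ m.+1 = 0 ->
  exists M, forall p : R, p \is k.-homog -> iter M (mxder A) p = 0.
Proof.
move=> Am; exists (m * k).+1 => p hp; rewrite (mpolyE p).
have iterD i u v : iter i (mxder A) (u + v) = iter i (mxder A) u + iter i (mxder A) v :> R.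
  by elim: i => //= i ->; rewrite raddfD.
have iterZ i c u : iter i (mxder A) (c *: u) = c *: iter i (mxder A) u :> R.
  by elim: i => //= i ->; rewrite linearZ.
have iter0 i : iter i (mxder A) (0 : R) = 0 by elim: i => //= i ->; rewrite raddf0.
rewrite big_seq; elim/big_ind: _ => [|u v|mm mp]; first exact: iter0.
  by rewrite iterD => -> ->; rewrite addr0.
rewrite iterZ -(homog_mdeg hp mp).
suff -> : iter (m * mdeg mm).+1 (mxder A) ('X_[mm] : R) = 0 by rewrite scaler0.
rewrite mdegE big_distrr mpolyXE_id /=.
elim/big_ind2: _ => [|n1 u n2 v|i _].
- by rewrite /= /mxder -mpolyC1 derC.
- exact: mxder_nil_mul.
elim: (mm i) => [|j IH]; first by rewrite muln0 expr0 /= /mxder -mpolyC1 derC.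
rewrite exprS mulnS; apply: mxder_nil_mul => //.
by rewrite iter_mxder_linform Am /linform big1 // => l _; rewrite mxE scale0r.
Qed.

End CharZero.

(** * Highest weight vectors and pencils of matrices *)

Section Sl2Chain.
Variables (K : fieldType) (V : lmodType K) (X Y H : {linear V -> V}).
Hypothesis char0 : [pchar K] =i pred0.
Hypothesis XY : forall v, X (Y v) - Y (X v) = H v.
Hypothesis HX : forall v, H (X v) - X (H v) = 2%:R *: X v.

Let XD u v : X (u + v) = X u + X v. Proof. exact: raddfD. Qed.
Let XB u v : X (u - v) = X u - X v. Proof. exact: raddfB. Qed.
Let XZ a u : X (a *: u) = a *: X u. Proof. exact: linearZ. Qed.
Let HZ a u : H (a *: u) = a *: H u. Proof. exact: linearZ. Qed.
Let HB u v : H (u - v) = H u - H v. Proof. exact: raddfB. Qed.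
Let HP a u v : H (a *: u + v) = a *: H u + H v. Proof. exact: linearP. Qed.

(** The usual commutator of [X^(n+1)] with [Y], derived without any relation between [H] and [Y]. *)
Lemma iterX_Y n u : iter n.+1 X (Y u) =
  Y (iter n.+1 X u) + n.+1%:R *: (H (iter n X u) - n%:R *: iter n X u).
Proof.
have XYE w : X (Y w) = Y (X w) + H w by rewrite -XY addrC subrK.
have XHE w : X (H w) = H (X w) - 2%:R *: X w by rewrite -HX opprB addrC subrK.
elim: n => [|n IH].
  by rewrite /= scale0r subr0 scale1r XYE.
rewrite iterS IH XD XZ XB XZ XYE XHE -addrA; congr (_ + _).
set w := X (iter n X u).
rewrite !scalerBr !scalerA -addrA -opprD -scalerDl addrA -{1}[H w]scale1r -scalerDl.
by congr (_ *: _ - _ *: _); ring.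
Qed.

Definition shifts (s : seq K) (v : V) : V := foldr (fun a u => H u - a *: u) v s.
Definition nats n : seq K := [seq i%:R | i <- rev (iota 0 n)].

Lemma natsS n : nats n.+1 = n%:R :: nats n.
Proof. by rewrite /nats -addn1 iotaD cats1 rev_rcons. Qed.

Lemma shiftsP s a u v : shifts s (a *: u + v) = a *: shifts s u + shifts s v.
Proof.
elim: s => //= b s ->; rewrite HP !scalerDr !scalerA [b * a]mulrC.
by rewrite opprD addrACA scalerN scalerA.
Qed.

Lemma shifts_H s v : shifts s (H v) = H (shifts s v).
Proof. by elim: s => //= b s ->; rewrite HB HZ. Qed.

Lemma shifts_shift s a v : shifts s (H v - a *: v) = H (shifts s v) - a *: shifts s v.
Proof. by rewrite -scaleNr addrC shiftsP shifts_H scaleNr addrC. Qed.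

Lemma shifts0 s : shifts s 0 = 0.
Proof. by have := shiftsP s (-1) 0 0; rewrite scaler0 addr0 scaleN1r addNr. Qed.

Lemma shifts_eigen s v c : H v = c *: v -> shifts s v = (\prod_(a <- s) (c - a)) *: v.
Proof.
move=> Hv; elim: s => [|a s IH] /=; first by rewrite big_nil scale1r.
by rewrite big_cons IH HZ Hv !scalerA -scalerBl; congr (_ *: _); ring.
Qed.

Lemma kerX_H v : X v = 0 -> X (H v) = 0.
Proof.
by move=> Xv; have := HX v; rewrite Xv raddf0 scaler0 sub0r => /eqP; rewrite oppr_eq0 => /eqP.
Qed.

Lemma kerX_shifts s v : X v = 0 -> X (shifts s v) = 0.
Proof.
by move=> Xv; elim: s => //= a s IH; rewrite XB XZ IH kerX_H // scaler0 subr0.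
Qed.

(** In [iterX_Y] at [Y^n v] the term starting with [Y] dies, since [X^n Y^n v] stays in the kernel
    of [X]; the other term contributes the factor [(n + 1) (H - n)]. *)
Lemma kerX_chain n v : X v = 0 ->
  iter n X (iter n Y v) = n`!%:R *: shifts (nats n) v.
Proof.
move=> Xv; elim: n => [|n IH]; first by rewrite scale1r.
rewrite [iter n.+1 Y v]iterS iterX_Y iterS IH XZ kerX_shifts // scaler0 raddf0 add0r.
by rewrite natsS /= HZ scalerA [_ * n`!%:R]mulrC -scalerA -scalerBr scalerA factS natrM.
Qed.

(** Hence [H] satisfies on [v] a split polynomial with the simple roots [0, ..., M - 1];
    semisimplicity and nonnegativity of the weights both come from this. *)
Lemma kerX_shifts_eq0 M v : X v = 0 -> iter M X (iter M Y v) = 0 ->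
  shifts (nats M) v = 0.
Proof.
move=> Xv; rewrite kerX_chain // => /eqP.
by rewrite scaler_eq0 (negPf (fact_neq0 char0 _)) => /eqP.
Qed.

Lemma kerX_eigenvalue M v c : X v = 0 -> iter M X (iter M Y v) = 0 ->
  H v = c *: v -> v != 0 -> exists2 i, (i < M)%N & c = i%:R.
Proof.
move=> Xv XY0 Hv v0; have := kerX_shifts_eq0 Xv XY0.
rewrite (shifts_eigen _ Hv) => /eqP; rewrite scaler_eq0 (negPf v0) orbF.
rewrite prodf_seq_eq0 => /hasP [a /mapP [i]]; rewrite mem_rev mem_iota => /andP [_ iM] -> /=.
by rewrite subr_eq0 => /eqP ->; exists i.
Qed.

Lemma shift_comm a b u : H (H u - a *: u) - b *: (H u - a *: u) =
  H (H u - b *: u) - a *: (H u - b *: u).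
Proof.
rewrite !HB !HZ !scalerBr !scalerA [b * a]mulrC !opprB.
by rewrite addrACA [RHS]addrACA [- _ - _]addrC.
Qed.

(** [S] and [Q] play [H]-stable subspaces. An eigenvector modulo [S] is corrected, inside [Q], to a
    true eigenvector with the same class, because [v] is annihilated by a polynomial in [H] with
    simple roots. *)
Lemma eigen_projection (S Q : V -> Prop) M v c :
  (forall a u w, S u -> S w -> S (a *: u + w)) -> S 0 -> (forall u, S u -> S (H u)) ->
  (forall a u w, Q u -> Q w -> Q (a *: u + w)) -> (forall u, Q u -> Q (H u)) ->
  X v = 0 -> iter M X (iter M Y v) = 0 -> Q v -> S (H v - c *: v) ->
  exists v', [/\ Q v', H v' = c *: v' & S (v - v')].
Proof.
move=> SL S0 SH QL QH Xv XY0 Qv Sv; have sh0 := kerX_shifts_eq0 Xv XY0.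
have uniq_nats : uniq (nats M) by rewrite map_inj_uniq ?rev_uniq ?iota_uniq //; apply: natr_inj.
(* If [c] is one of the roots, the factor [H - c] is already spent on [H v - c v] and is removed
   from the list; otherwise the full list does. *)
have [s /allP sc shc] : exists2 s, all (fun a => c - a != 0) s & shifts s (H v - c *: v) = 0.
  have [cM|cM] := boolP (c \in nats M); last first.
    exists (nats M); last by rewrite shifts_shift sh0 raddf0 scaler0 subr0.
    by apply/allP => a aM; rewrite subr_eq0; apply: contraNneq cM => ->.
  case/splitPr: cM uniq_nats sh0 => s1 s2; rewrite cat_uniq /= => /and3P [_ n1 /andP [n2 _]] sh0.
  exists (s1 ++ s2).
    apply/allP => a; rewrite mem_cat subr_eq0 => /orP as12; apply/eqP => ca.
    move: n1 n2; rewrite negb_or ca; case: as12 => ->; by rewrite ?andbF.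
  by rewrite /shifts foldr_cat -/(shifts _ _) -/(shifts _ _) shifts_shift -{}sh0 /shifts foldr_cat.
elim: s v Xv Qv Sv sc shc {XY0 sh0} => [|a s IH] v Xv Qv Sv sc shc.
  exists v; split=> //; last by rewrite subrr.
  by apply/eqP; rewrite -subr_eq0 -shc.
have ca : c - a != 0 by apply: sc; rewrite inE eqxx.
(* Modulo [S] the operator [H - a] is multiplication by [c - a], so [v1] has the class of [v] and
   needs one factor less. *)
pose v1 := (c - a)^-1 *: (H v - a *: v).
have vv1 : v - v1 = - (c - a)^-1 *: (H v - c *: v).
  apply: (scalerI ca); rewrite scalerBr !scalerA mulrN divff // scale1r scaleN1r.
  by rewrite scalerBl opprB opprB addrA subrK.
have SZ b u : S u -> S (b *: u) by move=> Su; rewrite -[b *: u]addr0; apply: SL.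
have Q0 : Q 0 by rewrite -(addNr v) -scaleN1r; apply: QL.
have QZ b u : Q u -> Q (b *: u) by move=> Qu; rewrite -[b *: u]addr0; apply: QL.
have [|||b bs||v' [Qv' Hv' Sv']] := IH v1.
- by rewrite XZ XB XZ kerX_H // Xv scaler0 subr0 scaler0.
- by apply: (QZ); rewrite addrC -scaleNr; apply: (QL) => //; apply: QH.
- have -> : H v1 - c *: v1 = (c - a)^-1 *: (H (H v - c *: v) - a *: (H v - c *: v)).
    by rewrite /v1 HZ [c *: _]scalerA [c * _]mulrC -scalerA -scalerBr shift_comm.
  by apply: (SZ); rewrite addrC -[- (a *: _)]scaleNr; apply: (SL) => //; apply: SH.
- by apply: sc; rewrite inE bs orbT.
- have -> : H v1 - c *: v1 = (c - a)^-1 *: (H (H v - c *: v) - a *: (H v - c *: v)) + 0.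
    by rewrite addr0 /v1 HZ [c *: _]scalerA [c * _]mulrC -scalerA -scalerBr shift_comm.
  rewrite shiftsP shifts0 addr0 shifts_shift; move: shc => /= ->; exact: scaler0.
exists v'; split=> //.
by rewrite -(subrK v1 v) -addrA vv1; apply: SL.
Qed.

End Sl2Chain.

(** * Semicontinuity of the rank in one-parameter families *)

Section RankFamilies.
Variable K : fieldType.
Hypothesis char0 : [pchar K] =i pred0.

Definition at_point m n (t : K) (A : 'M[{poly K}]_(m, n)) : 'M[K]_(m, n) :=
  map_mx (horner_eval t) A.

(** [L] and [R] compress the matrix at [0] to an identity of size its rank. The determinant of the
    same compression of [A] is a polynomial with value 1 at 0, hence nonzero at some [t != 0]. *)
Lemma rank_specialize m n (A : 'M[{poly K}]_(m, n)) :
  exists2 t : K, t != 0 & (\rank (at_point 0 A) <= \rank (at_point t A))%N.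
Proof.
set A0 := at_point 0 A.
pose L := pinvmx (col_base A0); pose R := pinvmx (row_base A0).
have LAR : L *m A0 *m R = 1%:M.
  have -> : L *m A0 *m R = L *m col_base A0 *m (row_base A0 *m R).
    have e : L *m A0 = L *m col_base A0 *m row_base A0 by rewrite -mulmxA mulmx_base.
    by rewrite {1}e mulmxA.
  by rewrite mulVpmx ?col_base_full // mulmxVp ?row_base_free // mulmx1.
pose q := \det (map_mx polyC L *m A *m map_mx polyC R).
have qE t : q.[t] = \det (L *m at_point t A *m R).
  have evC k l (B : 'M[K]_(k, l)) : map_mx (horner_eval t) (map_mx polyC B) = B.
    by apply/matrixP => i j; rewrite !mxE /horner_eval hornerC.
  by rewrite -horner_evalE -det_map_mx !map_mxM /= !evC.
have [t t0 qt] : exists2 t : K, t != 0 & q.[t] != 0.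
  have q0 : q != 0.
    by apply/eqP => q0; have := qE 0; rewrite q0 horner0 LAR det1 => /eqP; rewrite eq_sym oner_eq0.
  pose s := [seq i.+1%:R | i <- seq.iota 0 (size q)] : seq K.
  have [all0|] := boolP (all (root q) s); last first.
    by case/allPn => _ /mapP [i _ ->]; exists i.+1%:R; rewrite ?natrS0.
  have := max_poly_roots q0 all0; rewrite size_map size_iota ltnn => h; exfalso; apply: notF; apply: h.
  by rewrite map_inj_uniq ?iota_uniq // => i j /(natr_inj char0) [].
exists t => //; have := qt; rewrite qE -unitfE -unitmxE -row_full_unit => /eqP rk.
by rewrite -{1}rk (leq_trans (mxrankM_maxl _ _)) // mxrankM_maxr.
Qed.

(* If [A] lies in the left kernel of [X] to order [j] in [t] along the pencil [X + t Y], then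
   [a j *m Y] lies in the row space of [X + t Y] for all [t != 0]; were it outside the row
   space of [X], the rank would jump for generic [t]. *)
Lemma pencil_chain m n (X Y : 'M[K]_(m, n)) (a : nat -> 'rV[K]_m) j :
  (forall t, \rank (X + t *: Y)%R <= \rank X)%N ->
  a 0%N *m X = 0 -> (forall i, (i < j)%N -> a i.+1 *m X = - (a i *m Y)) ->
  (a j *m Y <= X)%MS.
Proof.
move=> rkXY a0 aS; apply: contraT => notin.
pose C := row_base X *m pinvmx X; have CX : C *m X = row_base X.
  by rewrite mulmxKpV // eq_row_base.
pose pC k l (B : 'M[K]_(k, l)) := map_mx (@polyC K) B.
pose A := col_mx (pC _ _ (C *m X) + 'X *: pC _ _ (C *m Y)) (pC _ _ (a j *m Y)).
have AE t : at_point t A = col_mx (C *m (X + t *: Y)) (a j *m Y).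
  rewrite /A /at_point map_col_mx; congr col_mx; apply/matrixP => r s.
    by rewrite mulmxDr -scalemxAr !mxE /horner_eval !hornerE.
  by rewrite !mxE /horner_eval hornerC.
have [t t0] := rank_specialize A; rewrite !AE scale0r addr0 CX.
pose M : 'M[K]_(m, n) := X + t *: Y.
have in_t : (a j *m Y <= M)%MS.
  (* The truncated series [sum t^i a_i] times [X + t Y] telescopes to its last term. *)
  suff /(_ j (leqnn j)) e : forall k, (k <= j)%N ->
      (\sum_(i < k.+1) t ^+ i *: a i) *m M = t ^+ k.+1 *: (a k *m Y).
    by rewrite -(eqmx_scale _ (expf_neq0 j.+1 t0)) -e submxMl.
  elim=> [|k IH] kj.
    by rewrite big_ord1 expr0 scale1r mulmxDr a0 add0r -scalemxAr expr1.
  rewrite big_ord_recr /= mulmxDl IH ?(ltnW kj) // -scalemxAl mulmxDr aS // scalerDr scalerN.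
  by rewrite addrA subrr add0r -scalemxAr scalerA -exprSr.
rewrite -/M leqNgt => /negP []; apply: (@leq_ltn_trans (\rank X)).
  by apply: leq_trans _ (rkXY t); apply: mxrankS; rewrite col_mx_sub submxMl.
rewrite -addsmxE; apply: leq_trans (_ : (\rank (X + a j *m Y)%MS <= _)%N).
  by apply: rank_ltmx; rewrite /ltmx addsmxSl addsmx_sub submx_refl.
by apply: mxrankS; apply: addsmxS; rewrite ?eq_row_base.
Qed.

End RankFamilies.

Section LieFacts.
Variables (K : fieldType) (n : nat) (br : 'rV[K]_n -> 'rV[K]_n -> 'rV[K]_n).
Hypothesis lie : lie_axioms br.
Local Notation ad := (ad_mx br).

Lemma brPl a x y z : br (a *: x + y) z = a *: br x z + br y z.
Proof. by case: lie. Qed.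
Lemma br_anti x y : br x y = - br y x.
Proof. by case: lie. Qed.
Lemma br_jacobi x y z : br x (br y z) + br y (br z x) + br z (br x y) = 0.
Proof. by case: lie. Qed.
Lemma brPr a x y z : br x (a *: y + z) = a *: br x y + br x z.
Proof. by rewrite br_anti brPl opprD -scalerN -!br_anti. Qed.
Lemma brDl x y z : br (x + y) z = br x z + br y z.
Proof. by rewrite -[x]scale1r brPl !scale1r. Qed.
Lemma brDr x y z : br x (y + z) = br x y + br x z.
Proof. by rewrite -[y]scale1r brPr !scale1r. Qed.
Lemma br0l z : br 0 z = 0.
Proof. by apply: (addrI (br 0 z)); rewrite -brDl !addr0. Qed.
Lemma br0r z : br z 0 = 0.
Proof. by rewrite br_anti br0l oppr0. Qed.
Lemma brZl a x z : br (a *: x) z = a *: br x z.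
Proof. by rewrite -[a *: x]addr0 brPl br0l addr0. Qed.
Lemma brZr a x z : br z (a *: x) = a *: br z x.
Proof. by rewrite br_anti brZl -scalerN -br_anti. Qed.
Lemma brNl x z : br (- x) z = - br x z.
Proof. by rewrite -scaleN1r brZl scaleN1r. Qed.
Lemma brNr x z : br z (- x) = - br z x.
Proof. by rewrite -scaleN1r brZr scaleN1r. Qed.
Lemma br_sumr (I : Type) (r : seq I) P (F : I -> 'rV[K]_n) x :
  br x (\sum_(i <- r | P i) F i) = \sum_(i <- r | P i) br x (F i).
Proof. exact: (big_morph _ (brDr x) (br0r x)). Qed.
Lemma br_suml (I : Type) (r : seq I) P (F : I -> 'rV[K]_n) x :
  br (\sum_(i <- r | P i) F i) x = \sum_(i <- r | P i) br (F i) x.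
Proof. exact: (big_morph (br^~ x) (fun y z => brDl y z x) (br0l x)). Qed.

Lemma br_self : [pchar K] =i pred0 -> forall x, br x x = 0.
Proof.
move=> char0 x; have := br_anti x x => /eqP.
rewrite -addr_eq0 -mulr2n -scaler_nat scaler_eq0 natr0 //= => /eqP //.
Qed.

Lemma mul_ad_mx x v : v *m ad x = br x v.
Proof.
rewrite [in RHS](row_sum_delta v) br_sumr mulmx_sum_row; apply: eq_bigr => i _.
by rewrite rowK brZr.
Qed.

Lemma ad_mxP a x y : ad (a *: x + y) = a *: ad x + ad y.
Proof. by apply/row_matrixP => i; rewrite !rowE mulmxDr -scalemxAr !mul_ad_mx brPl. Qed.
Lemma ad_mxN x : ad (- x) = - ad x.
Proof. by apply/row_matrixP => i; rewrite !rowE mulmxN !mul_ad_mx brNl. Qed.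
Lemma ad_mxZ a x : ad (a *: x) = a *: ad x.
Proof. by apply/row_matrixP => i; rewrite !rowE -scalemxAr !mul_ad_mx brZl. Qed.
Lemma ad_mxD x y : ad (x + y) = ad x + ad y.
Proof. by apply/row_matrixP => i; rewrite !rowE mulmxDr !mul_ad_mx brDl. Qed.

Lemma br_br x y z : br (br x y) z = br x (br y z) - br y (br x z).
Proof.
rewrite [br (br x y) z]br_anti; have := br_jacobi x y z; rewrite [br z x]br_anti brNr.
by move/eqP; rewrite addr_eq0 => /eqP <-.
Qed.

(** Matrices act on row vectors from the right, so products appear in reversed order; the sign in
    the later [H := mxder (- ad h)] has this origin. *)
Lemma ad_mx_br x y : ad (br x y) = ad y *m ad x - ad x *m ad y.
Proof.
apply/row_matrixP => i; rewrite !rowE mulmxBr !mulmxA !mul_ad_mx; exact: br_br.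
Qed.

End LieFacts.

(** * Invariants near a regular nilpotent element *)

Section RegularNilpotent.
Variables (K : fieldType) (N : nat) (br : 'rV[K]_N -> 'rV[K]_N -> 'rV[K]_N).
Hypotheses (char0 : [pchar K] =i pred0) (lie : lie_axioms br).
Local Notation ad := (ad_mx br).
Local Notation R := {mpoly K[N]}.
Local Notation D a := (mxder (ad a)).
Implicit Types (a v w : 'rV[K]_N) (p q : R).

Lemma ddir_D w a p : ddir w (D a p) = D a (ddir w p) + ddir (br a w) p.
Proof. by rewrite ddir_mxder mul_ad_mx. Qed.

Lemma D_comm a b p : D a (D b p) = D b (D a p) + D (br b a) p.
Proof. by rewrite mxder_comm ad_mx_br. Qed.

Lemma D_P c a b p : D (c *: a + b) p = c *: D a p + D b p.
Proof. by rewrite ad_mxP // mxderP. Qed.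

Lemma D_sum (I : Type) (r : seq I) P (F : I -> 'rV[K]_N) p :
  D (\sum_(i <- r | P i) F i) p = \sum_(i <- r | P i) D (F i) p.
Proof.
apply: (big_morph (fun a => D a p)) => [a b|]; first by rewrite ad_mxD // mxderD.
by rewrite -(scale0r 0) ad_mxZ // mxderZ scale0r.
Qed.

Variables (x h y : 'rV[K]_N) (m : nat).
Hypotheses (hx : br h x = 2%:R *: x) (xy : br x y = h) (x_nil : ad x ^+ m.+1 = 0).
Hypothesis x_reg : forall z, (\rank (ad z) <= \rank (ad x))%N.

(** [a |-> D a] reverses brackets ([D_comm]); with the minus sign, [D x], [D y] and [H] satisfy the
    relations required of [X], [Y] and [H] above. *)
Let H : R -> R := mxder (- ad h).
HB.instance Definition _ := GRing.Linear.on H.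

Let XY p : D x (D y p) - D y (D x p) = H p.
Proof.
rewrite D_comm addrAC subrr add0r (br_anti lie) xy.
by rewrite /H -ad_mxN.
Qed.

Let HX p : H (D x p) - D x (H p) = 2%:R *: D x p.
Proof.
rewrite /H -ad_mxN // D_comm addrAC subrr add0r (brNr lie) (br_anti lie) opprK hx.
by rewrite ad_mxZ // mxderZ.
Qed.

Let ddir_H a p : ddir (br a x) (H p) =
  H (ddir (br a x) p) - ddir (br (br h a) x) p - 2%:R *: ddir (br a x) p.
Proof.
have e : br h (br a x) = br (br h a) x + 2%:R *: br a x.
  by rewrite (br_br lie h a x) hx (brZr lie) subrK.
by rewrite /H ddir_mxder mulmxN mul_ad_mx // ddirN e ddirD ddirZ -addrA -opprD.
Qed.

Let H_D a p : H (D a p) = D a (H p) + D (br h a) p.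
Proof.
rewrite /H !mxderN linearN /= D_comm opprD; congr (_ + _).
by rewrite -mxderN -ad_mxN // -(br_anti lie).
Qed.

(* The order [k] Taylor data at [x] of a would-be invariant: the degree [j] component [P j] of
   [v |-> F (x + v)], for [j <= k]. *)
Definition jet_rec (P : nat -> R) k :=
  forall j a, (j < k)%N -> ddir (br a x) (P j.+1) = - D a (P j).

(** The first obstruction to a next coefficient: its derivative along [br a x = 0] must vanish.
    Regularity and [pencil_chain] extend [a = s 0] to a series [sum t^i s_i] commuting with
    [x + t v] to order [k]; each relation [[x, s (i+1)] = - [v, s i]] trades a derivative of
    [P (k - i)] for one of [P (k - i - 1)], down to the constant [P 0]. *)
Lemma jet_rec_stab P k a : P 0%N \is 0.-homog -> jet_rec P k -> br a x = 0 ->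
  D a (P k) = 0.
Proof.
move=> P0 recP ax; apply: (ev_eq0 char0) => v; rewrite ev_mxder mul_ad_mx //.
have chain j : exists s : nat -> 'rV[K]_N, s 0%N = a /\
    forall i, (i < j)%N -> s i.+1 *m ad x = - (s i *m ad v).
  elim: j => [|j [s [s0 sS]]]; first by exists (fun=> a).
  have : (s j *m ad v <= ad x)%MS.
    apply: (pencil_chain char0) sS => [t|].
      by rewrite -ad_mxZ // -ad_mxD.
    by rewrite s0 mul_ad_mx // (br_anti lie) ax oppr0.
  case/submxP => b vb; exists (fun i => if i == j.+1 then - b else s i); split=> // i.
  rewrite ltnS leq_eqVlt => /orP [/eqP ->|ij].
    by rewrite eqxx (ltn_eqF (ltnSn j)) mulNmx vb.
  by rewrite eqSS (ltn_eqF ij) (ltn_eqF (ltnW ij : (i < j.+1)%N)); apply: sS.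
have [s [s0 sS]] := chain k.
suff /(_ k (leqnn k)) : forall i, (i <= k)%N ->
    ev v (ddir (br a v) (P k)) = ev v (ddir (br (s i) v) (P (k - i)%N)).
  by rewrite subnn (ddir_homog0 _ P0) /ev meval0.
elim=> [|i IH] ik; first by rewrite s0 subn0.
rewrite (IH (ltnW ik)) -[(k - i)%N]prednK ?subn_gt0 // -subnS.
have -> : br (s i) v = - br (s i.+1) x.
  rewrite (br_anti lie (s i)) (br_anti lie (s i.+1)) opprK.
  by have := sS i ik; rewrite !mul_ad_mx // => ->.
by rewrite ddirN recP ?opprK ?ev_mxder ?mul_ad_mx //; lia.
Qed.

Variable d : nat.

(* [P] is extended so as to remain compatible with the Euler field: the component of degree [j]
   has [h]-weight [2 (d - j)]. *)
Definition jets (c : 'cV[K]_N) (P : nat -> R) k :=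
  [/\ P 0%N = 0, P 1%N = covec c,
      forall j, (j <= k)%N -> P j \is j.-homog,
      forall j, (j <= k)%N -> H (P j) = (2%:R * (d%:R - j%:R)) *: P j &
      jet_rec P k].

Lemma jets_step c P k : (0 < k)%N -> jets c P k -> exists P', jets c P' k.+1.
Proof.
move=> k0 [P0 P1 homP wtP recP].
have P0h : P 0%N \is 0.-homog by rewrite P0 rpred0.
pose W := row_base (ad x); pose C := W *m pinvmx (ad x).
have CW : C *m ad x = W by rewrite mulmxKpV // eq_row_base.
have rowW i : row i W = br (- row i C) x.
  by rewrite -CW row_mul mul_ad_mx // (br_anti lie) brNl.
(* The recursion is solved on a basis of [[q, x]]. Closedness of the data is the Jacobi identity
   combined with the recursion one degree lower, which explains [0 < k]. *)
have [|||Q homQ HQ] := @closed_forms_exact _ char0 N _ W (fun i => - D (- row i C) (P k)) k.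
- exact: row_base_free.
- by move=> i; rewrite rpredN mxder_homog // homP.
- move=> i j; rewrite !rowW !raddfN /= !ddir_D; congr (- _).
  set a := - row i C; set b := - row j C.
  have rec1 u : ddir (br u x) (P k) = - D u (P k.-1).
    by rewrite -{1}(prednK k0) recP // prednK.
  have -> : br a (br b x) = br b (br a x) + br (br a b) x by rewrite (br_br lie) addrC subrK.
  rewrite ddirD !rec1 !raddfN /= (D_comm b a) opprD -!addrA; congr (_ + _).
  by rewrite addrC.
(* A general [a] differs from a combination of the chosen preimages by an element centralizing [x],
   on which [jet_rec_stab] makes the right-hand side vanish. *)
have recQ a : ddir (br a x) Q = - D a (P k).
  have /submxP [z az] : (br a x <= W)%MS.
    by rewrite eq_row_base (br_anti lie) -mul_ad_mx // eqmx_opp submxMl.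
  have e : br a x = \sum_i z 0 i *: row i W by rewrite az mulmx_sum_row.
  pose a' := \sum_i z 0 i *: (- row i C).
  have aa' : br (a - a') x = 0.
    rewrite (brDl lie) (brNl lie) (br_suml lie) e -sumrB big1 // => i _.
    by rewrite rowW (brZl lie (z 0 i)) subrr.
  rewrite -[a in RHS](subrK a') -[a - a']scale1r D_P scale1r.
  rewrite (jet_rec_stab P0h recP aa') add0r e /a'.
  rewrite ddir_suml D_sum -sumrN; apply: eq_bigr => i _.
  by rewrite ddirZ HQ ad_mxZ // mxderZ scalerN.
pose P1' j := if j == k.+1 then Q else P j.
have P1'E j : (j <= k)%N -> P1' j = P j by move=> jk; rewrite /P1' ltn_eqF.
have P1'S : P1' k.+1 = Q by rewrite /P1' eqxx.
have rec1 : jet_rec P1' k.+1.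
  move=> j a; rewrite ltnS leq_eqVlt => /orP [/eqP ->|jk].
    by rewrite P1'S (P1'E k) // recQ.
  by rewrite !P1'E ?recP // ltnW.
have xQ : D x Q = 0.
  rewrite -P1'S; apply: jet_rec_stab rec1 _; first by rewrite P1'E.
  exact: br_self.
pose ker q := forall a, ddir (br a x) q = 0.
have [M DM] := mxder_nilpotent k.+1 x_nil.
(* [Q] has the right weight only modulo polynomials constant along [[q, x]], exactly the freedom
   left by the recursion; as [D x Q = 0], the weight can be corrected within that freedom. *)
have [|||||||||Q' [homQ' HQ' QQ']] := @eigen_projection _ _ (D x) (D y) H char0 XY HX ker
  (fun q => q \is k.+1.-homog) M Q (2%:R * (d%:R - k.+1%:R)).
- by move=> b u w ku kw a; rewrite linearP /= ku kw scaler0 addr0.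
- by move=> a; rewrite raddf0.
- by move=> u ku a; rewrite ddir_H !ku raddf0 scaler0 !subr0.
- by move=> b u w hu hw; rewrite rpredD // rpredZ.
- by move=> u hu; apply: mxder_homog.
- exact: xQ.
- apply: DM; elim: (M) => //= j IH; exact: mxder_homog.
- exact: homQ.
- move=> a; rewrite raddfB /= [ddir _ (_ *: Q)]linearZ /= ddir_H !recQ.
  have HN u : H (- u) = - H u by exact: raddfN.
  rewrite HN H_D wtP // [D a (_ *: _)]linearZ /= !scalerN !opprK -natr1.
  by rewrite -!mul_mpolyC !(mpolyCM, mpolyCB, mpolyCD, mpolyC_nat); ring.
have recQ' a : ddir (br a x) Q' = - D a (P k).
  by rewrite -recQ; apply/eqP; rewrite eq_sym -subr_eq0 -raddfB /=; apply/eqP/QQ'.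
exists (fun j => if j == k.+1 then Q' else P j).
have PE j : (j <= k)%N -> (if j == k.+1 then Q' else P j) = P j by move=> jk; rewrite ltn_eqF.
split=> [||j|j|j a].
- exact: P0.
- by rewrite PE.
- rewrite leq_eqVlt => /orP [/eqP ->|jk]; first by rewrite eqxx.
  by rewrite PE // homP.
- rewrite leq_eqVlt => /orP [/eqP ->|jk]; first by rewrite eqxx.
  by rewrite PE // wtP.
- rewrite ltnS leq_eqVlt => /orP [/eqP ->|jk]; first by rewrite eqxx PE.
  by rewrite !PE ?recP // ltnW.
Qed.

(** The recursion at [a = h], where [br h x = 2 x]: the weight condition becomes Euler's identity at
    [x] for a form of degree [d]. *)
Lemma jets_ddir_x c P k j : jets c P k -> (j < k)%N ->
  ddir x (P j.+1) = (d%:R - j%:R) *: P j.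
Proof.
move=> [P0 P1 homP wtP recP] jk.
have := recP j h jk; rewrite hx ddirZ -mxderN -/(H _) wtP ?(ltnW jk) // -scalerA.
exact/scalerI/natrS0.
Qed.

(* [jet_order t k p]: along [x] the polynomial [p] has degree [k] and leading coefficient [t]. *)
Definition jet_order (t : R) k p := iter k (ddir x) p = k`!%:R *: t /\ ddir x t = 0.

Lemma exists_invariant (c : 'cV[K]_N) : (0 < d)%N -> ad x *m c = 0 ->
  ad h *m c = - (2%:R * (d%:R - 1)) *: c ->
  exists F : R, [/\ F \is d.-homog, forall a, D a F = 0 &
                    jet_order (covec c) d.-1 F].
Proof.
move=> d0 xc hc.
have brxc a : (br a x *m c) 0 0 = 0.
  by rewrite (br_anti lie) -mul_ad_mx // mulNmx -mulmxA xc mulmx0 oppr0 mxE.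
have jets1 : jets c (fun j => if j == 1%N then covec c else 0) 1.
  split=> [//|//|j _|j _|[|//] a _].
  - by case: eqP => [->|_]; [apply: covec_homog | apply: rpred0].
  - case: eqP => [->|_]; last by rewrite raddf0 scaler0.
    by rewrite /H mxderN mxder_covec hc covecZ scaleNr opprK.
  - by rewrite /= ddir_covec brxc mpolyC0 raddf0 oppr0.
have jetsk k : exists P, jets c P k.+1.
  elim: k => [|k [P JP]]; first by eexists; apply: jets1.
  exact: jets_step JP.
have [P JP] := jetsk d; have [P0 P1 homP wtP recP] := JP.
(* [P d.+1] is killed by [D x] and has weight [2 (d - (d + 1)) = -2], whereas weights on the kernel
   of [D x] are natural numbers. *)
have Pd0 : P d.+1 = 0.
  have xP : D x (P d.+1) = 0.
    by apply: jet_rec_stab recP _; [rewrite P0 rpred0 | apply: br_self].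
  have [M DM] := mxder_nilpotent d.+1 x_nil.
  apply/eqP; apply: contraT => nz.
  have XYM : iter M (D x) (iter M (D y) (P d.+1)) = 0.
    by apply: DM; elim: (M) => [|j IH]; [apply: homP | apply: mxder_homog].
  have [i _] := kerX_eigenvalue char0 XY HX xP XYM (wtP _ (leqnn _)) nz.
  move/eqP; rewrite -[d.+1]addn1 natrD opprD addrA subrr add0r mulrN mulr1 eq_sym -subr_eq0 opprK -natrD.
  by rewrite natr0 // addn2.
(* With [P d.+1 = 0] the recursion says that [P d] itself is invariant. *)
exists (P d); split; first exact: homP.
  by move=> a; apply/eqP; rewrite -oppr_eq0 -recP // Pd0 raddf0.
split; last by rewrite ddir_covec -[x](scalerK (natrS0 char0 1)) -hx -scalemxAl mxE brxc mulr0 mpolyC0.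
have iterP i : (i < d)%N -> iter i (ddir x) (P d) = i`!%:R *: P (d - i)%N.
  elim: i => [|i IH] id; first by rewrite subn0 scale1r.
  rewrite iterS IH ?(ltnW id) // linearZ /= (_ : (d - i)%N = (d - i.+1).+1); last by lia.
  rewrite (jets_ddir_x JP); last by lia.
  have -> : d%:R - (d - i.+1)%:R = i.+1%:R :> K by rewrite -natrB ?leq_subr // subKn // ltnW.
  rewrite scalerA -natrM.
  by rewrite factS mulnC.
by rewrite iterP ?prednK // -subn1 subKn // P1.
Qed.

End RegularNilpotent.

(** * Leading coefficients along [x] *)

Section JetOrder.
Variables (K : fieldType) (N : nat) (x : 'rV[K]_N).
Hypothesis char0 : [pchar K] =i pred0.
Local Notation R := {mpoly K[N]}.
Local Notation iterx j := (iter j (ddir x)).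
Implicit Types p q s t : R.

Lemma iter_ddirP j a p q : iterx j (a *: p + q) = a *: iterx j p + iterx j q.
Proof. by elim: j => //= j ->; rewrite linearP. Qed.
Lemma iter_ddir0 j : iterx j (0 : R) = 0.
Proof. by elim: j => //= j ->; rewrite raddf0. Qed.
Lemma iter_ddir_comm j w p : ddir w (iterx j p) = iterx j (ddir w p).
Proof. by elim: j => //= j IH; rewrite ddirC IH. Qed.

Lemma jet_order0 c : jet_order x c%:MP 0 c%:MP.
Proof. by split; rewrite ?scale1r // /ddir derC. Qed.

Lemma jet_order_deriv t k p : jet_order x t k.+1 p -> jet_order x (k.+1%:R *: t) k (ddir x p).
Proof.
case=> e xt; split; last by rewrite linearZ /= xt scaler0.
by rewrite -iterSr e scalerA -natrM mulnC factS.
Qed.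

(** Leibniz splits off one derivative; the shares [k] and [l] of the two factors add up to [k + l],
    so the factorial normalization makes leading coefficients multiplicative. *)
Lemma jet_orderM s t k l p q : jet_order x s k p -> jet_order x t l q ->
  jet_order x (s * t) (k + l) (p * q).
Proof.
move=> sp tq; split; last by rewrite ddirM sp.2 tq.2 mul0r mulr0 addr0.
move: {2}(k + l)%N (erefl (k + l)%N) => n; elim: n k l s t p q sp tq => [|n IH] k l s t p q sp tq kl.
  move: kl sp tq => /eqP; rewrite addn_eq0 => /andP [/eqP -> /eqP ->] [/= -> _] [/= -> _].
  by rewrite !scale1r.
rewrite kl iterSr ddirM -[X in X + _]scale1r iter_ddirP scale1r.
have -> : iterx n (ddir x p * q) = n`!%:R *: (k%:R *: s * t).
  case: k sp kl => [|k] sp kl; last first.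
    have e : (k + l)%N = n by lia.
    by have := IH k l _ _ _ _ (jet_order_deriv sp) tq e; rewrite e.
  by case: sp => /= -> xs; rewrite !linearZ /= xs scaler0 mul0r iter_ddir0 scale0r mul0r scaler0.
have -> : iterx n (p * ddir x q) = n`!%:R *: (s * (l%:R *: t)).
  case: l tq kl => [|l] tq kl; last first.
    have e : (k + l)%N = n by lia.
    by have := IH k l _ _ _ _ sp (jet_order_deriv tq) e; rewrite e.
  by case: tq => /= -> xs; rewrite !linearZ /= xs scaler0 mulr0 iter_ddir0 scale0r mulr0 scaler0.
by rewrite -scalerAl -scalerAr -scalerDr -scalerDl -natrD kl scalerA -natrM mulnC.
Qed.

Lemma jet_orderX t k p i : jet_order x t k p -> jet_order x (t ^+ i) (k * i) (p ^+ i).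
Proof.
move=> tp; elim: i => [|i IH]; first by rewrite muln0 !expr0 -mpolyC1; apply: jet_order0.
by rewrite mulnS !exprS; apply: jet_orderM.
Qed.

Lemma jet_order_prod r (t p : 'I_r -> R) (k : 'I_r -> nat) :
  (forall i, jet_order x (t i) (k i) (p i)) ->
  jet_order x (\prod_i t i) (\sum_i k i) (\prod_i p i).
Proof.
move=> tp; elim/big_rec3: _ => [|i q k' s _]; first by rewrite -mpolyC1; apply: jet_order0.
by apply: jet_orderM.
Qed.

Lemma iter_homog_ev k p : p \is k.-homog -> iterx k p = (k`!%:R * ev x p)%:MP.
Proof.
elim: k p => [|k IH] p hp.
  by rewrite (homog0_const hp) mul1r /ev mevalC.
rewrite iterSr IH ?ddir_homog // -[x in ddir x]mulmx1 -ev_mxder (mxder1_homog hp) /ev mevalZ.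
by rewrite factS natrM mulrA [k`!%:R * _]mulrC.
Qed.

End JetOrder.

Lemma comp_homog (K : fieldType) N r (p : {mpoly K[N]}) (q : N.-tuple {mpoly K[r]}) k :
  p \is k.-homog -> (forall i, tnth q i \is 1.-homog) -> p \mPo q \is k.-homog.
Proof.
move=> hp hq; rewrite comp_mpolyEX big_seq rpred_sum // => m mp; rewrite rpredZ //.
rewrite comp_mpolyX -(homog_mdeg hp mp) mdegE.
elim/big_rec2: _ => [|i n s _ hs]; first exact: dhomog1.
by rewrite dhomogM //; have := dhomogMn (m i) (hq i); rewrite mul1n.
Qed.

(** * Generation and algebraic independence of the invariants *)

Section FreeInvariants.
Variables (K : fieldType) (N : nat) (br : 'rV[K]_N -> 'rV[K]_N -> 'rV[K]_N).
Hypotheses (char0 : [pchar K] =i pred0) (lie : lie_axioms br).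
Local Notation ad := (ad_mx br).
Local Notation R := {mpoly K[N]}.
Local Notation D a := (mxder (ad a)).
Local Notation iterx x j := (iter j (ddir x)).
Implicit Types (a v w : 'rV[K]_N) (p q : R).

Lemma iter_ddir_D x j a p : iterx x j (D a p) =
  D a (iterx x j p) + j%:R *: ddir (br a x) (iterx x j.-1 p).
Proof.
elim: j => [|j IH]; first by rewrite scale0r addr0.
rewrite iterS IH raddfD /= (ddir_D lie) linearZ /= -addrA; congr (_ + _).
rewrite ddirC -natr1 scalerDl scale1r addrC; congr (_ + _).
by case: j {IH} => [|j]; rewrite ?scale0r.
Qed.

Lemma pihomog_mxder A d p : pihomog mdeg d (mxder A p) = mxder A (pihomog mdeg d p).
Proof.
have [k le1 le2] : exists2 k, (msize p <= k)%N & (d < k)%N.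
  by exists (maxn (msize p) d.+1); rewrite ?leq_maxl // leq_maxr.
have -> : mxder A p = \sum_(i < k) mxder A (pihomog mdeg i p).
  by rewrite {1}(@pihomog_partitionE _ _ (@mdeg N) k p le1) raddf_sum.
rewrite [LHS]raddf_sum (bigD1 (Ordinal le2)) //= big1 ?addr0 => [|i id].
  by apply: pihomog_dE; apply/mxder_homog/pihomogP.
apply: (@pihomog_ne0 _ _ _ i); first by rewrite -val_eqE in id.
exact/mxder_homog/pihomogP.
Qed.

Definition invariant p := forall a, D a p = 0.

Variables (x h y : 'rV[K]_N) (m : nat).
Hypotheses (hx : br h x = 2%:R *: x) (xy : br x y = h) (x_nil : ad x ^+ m.+1 = 0).
Hypothesis x_reg : forall z, (\rank (ad z) <= \rank (ad x))%N.

Variables (ds : seq nat) (Xi : 'M[K]_(N, size ds)) (T : 'M[K]_(size ds, N)).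
Local Notation r := (size ds).
Local Notation d i := (nth 0%N ds i).
Hypotheses (ds_gt0 : forall i : 'I_r, (0 < d i)%N) (TXi : T *m Xi = 1%:M).
Hypotheses (xXi : ad x *m Xi = 0) (rank_xXi : (\rank (ad x) + r)%N = N).
Hypothesis hXi : forall i, ad h *m col i Xi = - (2%:R * ((d i)%:R - 1)) *: col i Xi.

Let xi i : R := covec (col i Xi).
Let xis : r.-tuple R := [tuple xi i | i < r].
Let lineT : N.-tuple {mpoly K[r]} := [tuple covec (col l T) | l < N].

Let ev_comp_xis (G : {mpoly K[r]}) v : ev v (G \mPo xis) = ev (v *m Xi) G.
Proof.
rewrite /ev comp_mpoly_meval; apply: meval_eq => i.
by rewrite tnth_mktuple ev_covec !mxE; apply: eq_bigr => j _; rewrite mxE.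
Qed.

Let comp_xis_eq0 (G : {mpoly K[r]}) : G \mPo xis = 0 -> G = 0.
Proof.
move=> G0; apply: (ev_eq0 char0) => c; have := ev_comp_xis G (c *m T).
by rewrite G0 -mulmxA TXi mulmx1 /ev meval0.
Qed.

(** By the rank count [[q, x]] is the whole kernel of [Xi], and the rows of [T] span a complement.
    [u] is constant along [[q, x]], so its restriction to that complement, namely [u \mPo lineT],
    determines it. *)
Let factor_xis k (u : R) : u \is k.-homog -> (forall a, ddir (br a x) u = 0) ->
  exists2 G : {mpoly K[r]}, G \is k.-homog & u = G \mPo xis.
Proof.
move=> hu u0; exists (u \mPo lineT).
  by apply: comp_homog => // i; rewrite tnth_mktuple covec_homog.
apply/eqP; rewrite -subr_eq0; apply/eqP/(ev_eq0 char0) => v.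
rewrite /ev mevalB -!/(ev _ _) ev_comp_xis.
have -> : ev (v *m Xi) (u \mPo lineT) = ev (v *m Xi *m T) u.
  rewrite /ev comp_mpoly_meval; apply: meval_eq => i.
  by rewrite tnth_mktuple ev_covec !mxE; apply: eq_bigr => j _; rewrite !mxE.
have /submxP [z zx] : (v - v *m Xi *m T <= ad x)%MS.
  have xker : (ad x <= kermx Xi)%MS by apply/sub_kermxP.
  have /andP [_ kerx] : (ad x == kermx Xi)%MS.
    rewrite -(geq_leqif (mxrank_leqif_eq xker)).
    rewrite mxrank_ker leq_subLR addnC -{1}rank_xXi leq_add2l.
    by rewrite -[X in (X <= _)%N](mxrank1 K) -TXi mxrankM_maxr.
  apply: submx_trans kerx; apply/sub_kermxP.
  by rewrite mulmxBl -!mulmxA TXi mulmx1 subrr.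
apply/eqP; rewrite subr_eq0 -[v in ev v u](subrK (v *m Xi *m T)) zx addrC ev_translate //.
by rewrite (mul_ad_mx lie) (br_anti lie) ddirN u0 oppr0.
Qed.

Section Generation.
Variable F : r.-tuple R.
Hypotheses (F_homog : forall i, tnth F i \is (d i).-homog)
  (F_inv : forall i, invariant (tnth F i))
  (F_jet : forall i, jet_order x (xi i) (d i).-1 (tnth F i)).

Let wt (mm : 'X_{1..r}) := (\sum_i mm i * d i)%N.

Lemma invariant_comp (G : {mpoly K[r]}) : invariant (G \mPo F).
Proof.
move=> a; elim/mpoly_alg_ind: G => [c|i|p q IHp IHq|p q IHp IHq].
- by rewrite comp_mpolyC /mxder derC.
- by rewrite comp_mpolyXU -tnth_nth F_inv.
- by rewrite comp_mpolyD raddfD /= IHp IHq addr0.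
- by rewrite rmorphM mxderM /= IHp IHq mul0r mulr0 addr0.
Qed.

Lemma mxder_prod A (t : 'I_r -> R) (k : 'I_r -> K) (mm : 'I_r -> nat) :
  (forall i, mxder A (t i) = k i *: t i) ->
  mxder A (\prod_i t i ^+ mm i) = (\sum_i (mm i)%:R * k i) *: \prod_i t i ^+ mm i.
Proof.
move=> tk; elim/big_rec2: _ => [|i s p _ IH]; first by rewrite scale0r /mxder -mpolyC1 derC.
rewrite mxderM IH -scalerAr scalerDl; congr (_ + _).
rewrite scalerAl; congr (_ * _); elim: (mm i) => [|l IHl].
  by rewrite mul0r scale0r expr0 /mxder -mpolyC1 derC.
rewrite exprS mxderM IHl tk -scalerAl -scalerAr -scalerDl -natr1.
by congr (_ *: _); ring.
Qed.

Let D_h_monomial (mm : 'X_{1..r}) : D h ('X_[mm] \mPo xis) =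
  (- (2%:R * ((wt mm)%:R - (mdeg mm)%:R))) *: ('X_[mm] \mPo xis).
Proof.
rewrite comp_mpolyX; pose k (i : 'I_r) : K := - (2%:R * ((d i)%:R - 1)).
rewrite (@mxder_prod _ _ k) => [|i]; last first.
  by rewrite tnth_mktuple mxder_covec hXi covecZ.
congr (_ *: _); rewrite /wt mdegE !natr_sum -sumrB mulr_sumr -sumrN.
by apply: eq_bigr => i _; rewrite /k natrM; ring.
Qed.

(** Monomials in the [xis] are linearly independent eigenvectors of [D h], so an eigenvector
    involves only those of its own eigenvalue; with the degree [k] fixed, the eigenvalue determines
    [wt]. *)
Let msupp_wt k e (G : {mpoly K[r]}) mm : G \is k.-homog ->
  D h (G \mPo xis) = (- (2%:R * (e%:R - k%:R))) *: (G \mPo xis) -> mm \in msupp G ->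
  wt mm = e.
Proof.
move=> hG DG mG; pose G' : {mpoly K[r]} :=
  \sum_(m' <- msupp G) (2%:R * ((wt m')%:R - e%:R) * G@_m') *: 'X_[m'].
have G'0 : G' = 0.
  apply: comp_xis_eq0.
  have -> : G' \mPo xis = \sum_(m' <- msupp G)
      (2%:R * ((wt m')%:R - e%:R) * G@_m') *: ('X_[m'] \mPo xis).
    by rewrite raddf_sum; apply: eq_bigr => m' _; rewrite /= comp_mpolyZ.
  have := DG; rewrite !comp_mpolyEX raddf_sum scaler_sumr => /eqP.
  rewrite eq_sym -subr_eq0 -sumrB => /eqP sum0; rewrite -[RHS]sum0; apply: eq_big_seq => m' mG'.
  have DZ c u : D h (c *: u) = c *: D h u by exact: linearZ.
  rewrite /= DZ D_h_monomial (homog_mdeg hG mG') !scalerA -scalerBl.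
  by congr (_ *: _); ring.
have : G'@_mm = 0 by rewrite G'0 mcoeff0.
rewrite /G' raddf_sum (bigD1_seq mm) ?msupp_uniq //= big1_seq ?addr0 => [|m' /andP [mm' _]].
  rewrite mcoeffZ mcoeffX eqxx mulr1 => /eqP; rewrite !mulf_eq0 (negPf (natrS0 char0 1)) /=.
  rewrite [G@_mm == 0](negPf _) ?orbF -?mcoeff_msupp // subr_eq0 => /eqP; exact: natr_inj.
by rewrite mcoeffZ mcoeffX (negPf mm') mulr0.
Qed.

(** Induction on the degree along [x]: the leading coefficient is a polynomial in the [xis], and
    substituting the [F_i] for the [xi_i] gives an invariant with the same leading coefficient. *)
Lemma homog_invariant_generated e p : p \is e.-homog -> invariant p ->
  exists G : {mpoly K[r]}, p = G \mPo F.
Proof.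
move=> hp ip; suff gen j : (j <= e.+1)%N -> forall p, p \is e.-homog -> invariant p ->
    iterx x j p = 0 -> exists G : {mpoly K[r]}, p = G \mPo F.
  by apply: (gen e.+1) => //; apply: iter_ddir_gt hp _.
elim: j {p hp ip} => [|j IH] je p hp ip pj.
  by exists 0; rewrite comp_mpoly0.
set u := iterx x j p; have hu : u \is (e - j).-homog by apply: iter_ddir_homog.
have u0 a : ddir (br a x) u = 0.
  have := iter_ddir_D x j.+1 a p; rewrite ip pj raddf0 add0r iter_ddir0 => /esym/eqP.
  by rewrite scaler_eq0 (negPf (natrS0 char0 j)) => /eqP.
have Dhu : D h u = (- (2%:R * (e%:R - (e - j)%:R))) *: u.
  have := iter_ddir_D x j h p; rewrite ip iter_ddir0 => /esym/eqP; rewrite addr_eq0 => /eqP.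
  have key : j%:R *: ddir x (iterx x j.-1 p) = j%:R *: u.
    by rewrite /u; case: (j) => [|j'] //=; rewrite !scale0r.
  have -> : e%:R - (e - j)%:R = j%:R :> K by rewrite -natrB ?leq_subr // subKn.
  rewrite -/u => ->; rewrite hx ddirZ scalerA mulrC -scalerA key scalerA -scaleNr.
  by [].
have [G hG uG] := factor_xis hu u0.
have wtG mm : mm \in msupp G -> wt mm = e.
  by apply: msupp_wt hG _; rewrite -uG.
(* Each monomial of [G] has weight [e] and degree [e - j], so its value at [F] has degree
   [sum m_i (d_i - 1) = j] along [x]. The [j]-th derivative produces [j!], while [u] is a bare
   derivative; hence the division. *)
pose q := (j`!%:R : K)^-1 *: (G \mPo F).
have hq : q \is e.-homog.
  rewrite rpredZ // comp_mpolyEX big_seq rpred_sum // => mm mG; rewrite rpredZ //.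
  rewrite comp_mpolyX -(wtG mm mG) /wt.
  elim/big_rec2: _ => [|i n s _ hs]; first exact: dhomog1.
  by rewrite dhomogM // mulnC dhomogMn.
have jq : iterx x j q = u.
  rewrite /q -[_ *: _]addr0 iter_ddirP iter_ddir0 addr0 uG.
  apply: (scalerI (fact_neq0 char0 j)); rewrite scalerA divff ?fact_neq0 // scale1r.
  rewrite comp_mpolyEX [in RHS]comp_mpolyEX scaler_sumr.
  have -> : iterx x j (\sum_(mm <- msupp G) G@_mm *: ('X_[mm] \mPo F)) =
            \sum_(mm <- msupp G) iterx x j (G@_mm *: ('X_[mm] \mPo F)).
    apply: big_morph; last exact: iter_ddir0.
    by move=> s t; rewrite -[s]scale1r iter_ddirP !scale1r.
  apply: eq_big_seq => mm mG.
  rewrite -[_ *: ('X_[mm] \mPo F)]addr0 iter_ddirP iter_ddir0 addr0 [RHS]scalerA mulrC -scalerA.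
  congr (_ *: _); rewrite !comp_mpolyX.
  have [+ _] := jet_order_prod (fun i : 'I_r => jet_orderX (mm i) (F_jet i)).
  have -> : (\sum_(i < r) (d i).-1 * (mm : 'X_{1..r}) i)%N = j.
    have : (\sum_(i < r) (d i).-1 * (mm : 'X_{1..r}) i + mdeg mm)%N = wt mm.
      rewrite mdegE -big_split /wt; apply: eq_bigr => i _ /=.
      by rewrite -{2}[d i]prednK // mulnS mulnC addnC.
    rewrite (wtG mm mG) (homog_mdeg hG mG); lia.
  by move=> ->; congr (_ *: _); apply: eq_bigr => i _; rewrite tnth_mktuple.
have [|||G' pG'] := IH (ltnW je) (p - q).
- by rewrite rpredB.
- by move=> a; rewrite raddfB /= ip linearZ /= invariant_comp scaler0 subr0.
- by rewrite -[p - q]addrC -scaleN1r iter_ddirP jq scaleN1r addNr.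
exists (G' + (j`!%:R : K)^-1 *: G).
by rewrite comp_mpolyD -pG' comp_mpolyZ -/q subrK.
Qed.

Lemma invariant_generated p : invariant p -> exists G : {mpoly K[r]}, p = G \mPo F.
Proof.
move=> ip; rewrite (@pihomog_partitionE _ _ (@mdeg N) _ p (leqnn _)).
elim/big_ind: _ => [|p1 p2 [G1 ->] [G2 ->]|i _].
- by exists 0; rewrite comp_mpoly0.
- by exists (G1 + G2); rewrite comp_mpolyD.
apply: homog_invariant_generated; first exact: pihomogP.
by move=> a; rewrite -pihomog_mxder ip pihomog0.
Qed.

(** By homogeneity, values and first derivatives at [x] can be read from iterated derivatives along
    [x]: the leading coefficient along [x] is also the linear term at [x]. *)
Let on_line_F v i : exists2 g : {poly K}, on_line x v (tnth F i) = 'X * g &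
  g.[0] = (v *m Xi) 0 i.
Proof.
have Xi_i w : (w *m Xi) 0 i = ev w (xi i).
  by rewrite /ev ev_covec !mxE; apply: eq_bigr => l _; rewrite mxE.
have [jF xF] := F_jet i; have di := prednK (ds_gt0 i).
have F0 : ev x (tnth F i) = 0.
  have := iter_homog_ev x (F_homog i); rewrite -{1}di iterS jF linearZ /= xF scaler0 => /esym/eqP.
  by rewrite mpolyC_eq0 mulf_eq0 (negPf (fact_neq0 char0 _)) => /eqP.
have dF : ev x (ddir v (tnth F i)) = (v *m Xi) 0 i.
  have hF : ddir v (tnth F i) \is (d i).-1.-homog by rewrite ddir_homog // di.
  have := iter_homog_ev x hF; rewrite -iter_ddir_comm jF linearZ /= ddir_covec.
  rewrite -mul_mpolyC -mpolyCM => /(congr1 (mcoeff 0)); rewrite !mcoeffC eqxx !mulr1 => /(mulfI (fact_neq0 char0 _)) <-.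
  by rewrite !mxE; apply: eq_bigr => l _; rewrite mxE.
have root0 : (on_line x v (tnth F i)).[0] = 0 by rewrite horner_on_line scale0r addr0.
have /factor_theorem [g eg] : root (on_line x v (tnth F i)) 0 by apply/rootP.
exists g; first by rewrite eg subr0 mulrC.
have := congr1 (fun q : {poly K} => q.[0]) (deriv_on_line x v (tnth F i)).
by rewrite /= horner_on_line scale0r addr0 dF eg subr0 derivM derivX !hornerE.
Qed.

(** On the line [x + s v] each [F_i] is [s g_i] with [g_i(0)] the [i]-th coordinate of [v *m Xi].
    The lowest coefficient in [s] of a relation is thus the lowest homogeneous part of [P] at an
    arbitrary point [c], reached by [v = c *m T]. *)
Lemma generators_independent (P : {mpoly K[r]}) : P \mPo F = 0 -> P = 0.
Proof.
move=> PF; suff P0 n mm : (mdeg mm < n)%N -> P@_mm = 0.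
  by apply/mpolyP => mm; rewrite mcoeff0 (P0 (mdeg mm).+1).
elim: n mm => [//|n IH] mm; rewrite ltnS leq_eqVlt => /orP [/eqP mmn|]; last exact: IH.
have supp_ge m' : m' \in msupp P -> (n <= mdeg m')%N.
  by rewrite leqNgt mcoeff_msupp; apply: contra => lt; rewrite IH.
have hom0 : pihomog mdeg n P = 0.
  apply: (ev_eq0 char0) => c; pose v := c *m T.
  have [g gF g0] := fin_all_exists2 (on_line_F v).
  pose S := \sum_(m' <- msupp P) P@_m' *: ('X^(mdeg m' - n) * \prod_i g i ^+ m' i).
  have S0 : S = 0.
    have := rmorph0 (on_line x v); rewrite -PF comp_mpolyEX raddf_sum /=.
    have -> : \sum_(m' <- msupp P) on_line x v (P@_m' *: ('X_[m'] \mPo F)) = 'X^n * S.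
      rewrite mulr_sumr; apply: eq_big_seq => m' mP.
      rewrite on_lineZ comp_mpolyX rmorph_prod -scalerAr mulrA -exprD subnKC ?supp_ge //=.
      congr (_ *: _); rewrite mdegE -prodrXr -big_split /=; apply: eq_bigr => i _.
      by rewrite rmorphXn /= gF exprMn.
    by move/eqP; rewrite mulf_eq0 expf_eq0 polyX_eq0 andbF => /eqP.
  have : S.[0] = 0 by rewrite S0 horner0.
  move=> <-; rewrite /S horner_sum pihomogE /ev raddf_sum /= big_mkcond /=.
  apply: eq_big_seq => m' mP; rewrite hornerZ hornerM hornerXn horner_prod expr0n subn_eq0.
  have -> : (mdeg m' == n) = (mdeg m' <= n)%N by rewrite eqn_leq supp_ge // andbT.
  case: ifP => _; last by rewrite mul0r mulr0.
  rewrite mul1r mevalZ mevalX; congr (_ * _); apply: eq_bigr => i _.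
  by rewrite horner_exp g0 /v -mulmxA TXi mulmx1.
have [mP|/memN_msupp_eq0 //] := boolP (mm \in msupp P).
have : (pihomog mdeg n P)@_mm = 0 by rewrite hom0 mcoeff0.
rewrite pihomogE raddf_sum big_mkcond (bigD1_seq mm) ?msupp_uniq //= mmn eqxx.
rewrite mcoeffZ mcoeffX eqxx mulr1 big1_seq ?addr0 // => m' /andP [mm' _].
by case: ifP => // _; rewrite mcoeffZ mcoeffX (negPf mm') mulr0.
Qed.

End Generation.

Lemma invariants_polynomial : exists F : r.-tuple R,
  [/\ forall i, tnth F i \is (d i).-homog, forall i, invariant (tnth F i),
      forall P : {mpoly K[r]}, P \mPo F = 0 -> P = 0 &
      forall p, invariant p -> exists P : {mpoly K[r]}, p = P \mPo F].
Proof.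
have hXi' (i : 'I_r) : exists f : R, [/\ f \is (d i).-homog, invariant f &
    jet_order x (xi i) (d i).-1 f].
  apply: (exists_invariant char0 lie hx xy x_nil x_reg (ds_gt0 i)); last exact: hXi.
  by rewrite colE mulmxA xXi mul0mx.
have [f Hf] := fin_all_exists hXi'; exists [tuple f i | i < r].
have homF i : tnth [tuple f i | i < r] i \is (d i).-homog by rewrite tnth_mktuple; case: (Hf i).
have invF i : invariant (tnth [tuple f i | i < r] i) by rewrite tnth_mktuple; case: (Hf i).
have jetF i : jet_order x (xi i) (d i).-1 (tnth [tuple f i | i < r] i).
  by rewrite tnth_mktuple; case: (Hf i).
split=> //; first exact: generators_independent.
exact: invariant_generated.
Qed.

End FreeInvariants.

(** * Degrees and slices *)

Section WeightLemmas.
Variables (K : fieldType) (N : nat).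
Hypothesis char0 : [pchar K] =i pred0.
Implicit Types (A G : 'M[K]_N) (v w : 'rV[K]_N).

(* On the stable range of the powers of [A], where [A] is invertible, the trace of
   [A^-1 G A - G = c] is [0], hence that range is zero. *)
Lemma eigen_ad_nilpotent A G c : c != 0 -> G *m A - A *m G = c *: A -> exists k, A ^+ k = 0.
Proof.
move=> c0 GA; have GA' : G *m A = A *m G + c *: A by rewrite -GA addrC subrK.
have Ak k : A ^+ k *m A = A *m A ^+ k by rewrite !mulmxE -exprS -exprSr.
have AkG k : (A ^+ k *m G <= A ^+ k)%MS.
  apply/submxP; elim: k => [|k [B IH]]; first by exists G; rewrite mul1mx mulmx1.
  exists (B - c%:M); have AG : A *m G = G *m A - c *: A by rewrite GA' addrK.
  rewrite exprSr -mulmxE -mulmxA AG mulmxBr [_ *m (G *m A)]mulmxA IH -scalemxAr mulmxBl mul_scalar_mx.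
  by rewrite mulmxA.
have [k mink] : exists k, (\rank (A ^+ k) <= \rank (A ^+ k.+1))%N.
  suff stab n : (exists k, \rank (A ^+ k) <= n)%N ->
      exists k, (\rank (A ^+ k) <= \rank (A ^+ k.+1))%N.
    by apply: (stab (\rank (A ^+ 0))); exists 0%N.
  elim: n => [|n IH] [k kn]; first by exists k; rewrite (leq_trans kn).
  have [le|lt] := leqP (\rank (A ^+ k)) (\rank (A ^+ k.+1)); first by exists k.
  by apply: IH; exists k.+1; rewrite -ltnS (leq_trans lt).
set U := row_base (A ^+ k); have fU : row_free U by apply: row_base_free.
have UE : (U :=: A ^+ k)%MS by apply: eq_row_base.
pose rst B := U *m B *m pinvmx U.
have rstP B : (A ^+ k *m B <= A ^+ k)%MS -> U *m B = rst B *m U.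
  move=> sub; rewrite /rst mulmxKpV // (submx_trans (submxMr B (_ : (U <= A ^+ k)%MS))) ?UE //.
have UA : U *m A = rst A *m U by apply: rstP; rewrite Ak submxMl.
have UG : U *m G = rst G *m U by apply: rstP.
move: {rst rstP} (rst A) (rst G) UA UG => A' G' UA UG.
have unitA : A' \in unitmx.
  rewrite -row_free_unit /row_free eqn_leq rank_leq_row /=.
  apply: leq_trans mink _; rewrite exprSr -mulmxE -(eqmxMr A UE) UA.
  exact: mxrankM_maxl.
have e : G' *m A' - A' *m G' = c *: A'.
  have GAU : G' *m A' *m U = U *m (G *m A).
    by rewrite -mulmxA -UA mulmxA -UG -mulmxA.
  have AGU : A' *m G' *m U = U *m (A *m G).
    by rewrite -mulmxA -UG mulmxA -UA -mulmxA.
  by apply: (row_free_inj fU); rewrite mulmxBl GAU AGU -mulmxBr GA -scalemxAr UA scalemxAl.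
have : \tr (G' - A' *m G' *m invmx (A')) = c * (\rank (A ^+ k))%:R.
  have -> : G' = G' *m A' *m invmx (A') by rewrite mulmxK.
  rewrite [in X in _ - X]mulmxK // -mulmxBl e -scalemxAl mulmxV // mxtraceZ mxtrace1 //.
rewrite raddfB /= mxtrace_mulC mulmxA mulVmx // mul1mx subrr => /esym/eqP.
rewrite mulf_eq0 (negPf c0) natr0 //= mxrank_eq0 => /eqP; by exists k.
Qed.

Definition wt_space A G (c : K) := (kermx A :&: kermx (G - c%:M))%MS.

Lemma wt_spaceP A G c v :
  reflect (v *m A = 0 /\ v *m G = c *: v) (v <= wt_space A G c)%MS.
Proof.
rewrite sub_capmx; apply: (iffP andP) => [[/sub_kermxP vA /sub_kermxP]|[vA vG]].
  by rewrite mulmxBr mul_mx_scalar => /eqP; rewrite subr_eq0 => /eqP.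
by split; apply/sub_kermxP => //; rewrite mulmxBr mul_mx_scalar vG subrr.
Qed.

Section Even.
Variables (A G : 'M[K]_N) (m : nat).
Hypotheses (AG : A *m G - G *m A = 2%:R *: A) (Am : A ^+ m = 0).
Hypothesis rk : (\rank (kermx A) <= \rank (kermx G))%N.

Let wt j : K := (j.*2)%:R.
Let S j := (\sum_(i < j) wt_space A G (wt i))%MS.

Let SS j : (S j.+1 :=: S j + wt_space A G (wt j))%MS.
Proof. by rewrite /S big_ord_recr. Qed.

Let S_stable j v : (v <= S j)%MS -> (v *m G <= S j)%MS.
Proof.
case/sub_sumsmxP => u ->; rewrite mulmx_suml summx_sub // => i _.
have /wt_spaceP [_ ->] : (u i *m wt_space A G (wt i) <= wt_space A G (wt i))%MS by exact: submxMl.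
by rewrite scalemx_sub // (sumsmx_sup i) // submxMl.
Qed.

Let S_eigen j v c : (v <= S j)%MS -> v *m G = c *: v ->
  (forall i, (i < j)%N -> c != wt i) -> v = 0.
Proof.
elim: j v => [|j IH] v; first by rewrite /S big_ord0 submx0 => /eqP.
rewrite SS => /sub_addsmxP [[a b] /= e] vG cw.
apply: IH => // [|i ij]; last by apply: cw; apply: ltnW.
have cj : c - wt j != 0 by rewrite subr_eq0 cw.
rewrite -(eqmx_scale v cj) scalerBl -vG e mulmxDl.
have /wt_spaceP [_ ->] : (b *m wt_space A G (wt j) <= wt_space A G (wt j))%MS by exact: submxMl.
rewrite scalerDr opprD addrACA subrr addr0 addmx_sub ?eqmx_opp ?scalemx_sub ?submxMl //.
by rewrite S_stable // submxMl.
Qed.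

Let mulAG j v : v *m G = 0 -> v *m A ^+ j *m G = wt j *: (v *m A ^+ j).
Proof.
move=> vG; elim: j => [|j IH]; first by rewrite mulmx1 vG scale0r.
have AG' : A *m G = G *m A + 2%:R *: A by rewrite -AG addrC subrK.
rewrite exprSr mulmxA -[_ *m A *m G]mulmxA AG' mulmxDr mulmxA IH -scalemxAl -scalemxAr -scalerDl.
by rewrite /wt doubleS -[j.*2.+2]addn2 natrD.
Qed.

Let Z j := (kermx G :&: kermx (A ^+ j))%MS.

(** Filtration of the zero weight space: [A ^+ j] sends [Z j.+1] to weight [2 j] vectors killed by
    [A], with kernel inside [Z j]. *)
Let rank_Z j : (\rank (Z j) <= \rank (S j))%N.
Proof.
elim: j => [|j IH].
  suff -> : Z 0 = 0 by rewrite mxrank0.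
  apply/eqP; rewrite -submx0 /Z expr0; apply: submx_trans (capmxSr _ _) _.
  by rewrite submx0 kermx_eq0 row_free_unit unitmx1.
have rkS : \rank (S j.+1) = (\rank (S j) + \rank (wt_space A G (wt j)))%N.
  rewrite SS; apply/eqP; rewrite -mxrank_sum_cap.
  rewrite (_ : (S j :&: _)%MS = 0) ?mxrank0 ?addn0 //.
  apply/eqP; rewrite -submx0; apply/row_subP => i; set v := row i _.
  have : (v <= S j :&: wt_space A G (wt j))%MS by apply: row_sub.
  rewrite sub_capmx => /andP [vS /wt_spaceP [_ vG]].
  rewrite (S_eigen vS vG) ?sub0mx // => l lj; apply/eqP => /(natr_inj char0); lia.
rewrite rkS; have := mxrank_mul_ker (Z j.+1) (A ^+ j); rewrite addnC => <-.
apply: leq_add; first apply: leq_trans IH.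
  apply: mxrankS; rewrite /Z !sub_capmx capmxSr andbT.
  exact: submx_trans (capmxSl _ _) (capmxSl _ _).
apply: mxrankS; apply/row_subP => i; rewrite row_mul; set v := row i _.
have : (v <= Z j.+1)%MS by apply: row_sub.
rewrite sub_capmx => /andP [/sub_kermxP vG /sub_kermxP vA].
by apply/wt_spaceP; split; [rewrite -mulmxA mulmxE -exprSr | apply: mulAG].
Qed.

(** The chain [dim ker G = dim Z m <= dim S m <= dim ker A] is closed by [rk], so even weights
    exhaust [ker A]. No lowering operator enters. *)
Lemma even_weights : (kermx A <= \sum_(i < m) wt_space A G (i.*2)%:R)%MS.
Proof.
have le : (S m <= kermx A)%MS by apply/sumsmx_subP => i _; apply: capmxSl.
have /andP [_ //] : (S m == kermx A)%MS.
rewrite -(geq_leqif (mxrank_leqif_eq le)); apply: leq_trans rk (leq_trans _ (rank_Z m)).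
by apply: mxrankS; rewrite /Z Am sub_capmx submx_refl; apply/sub_kermxP; rewrite mulmx0.
Qed.

End Even.

(** Greedy choice: as long as [E] is smaller than [W], some row of some [U i] lies outside it. The
    labels grow together with [E], whose height is [size ds]. *)
Lemma eigen_row_base G (W : 'M[K]_N) (I : finType) (U : I -> 'M[K]_N) (c : nat -> K) (d : I -> nat) :
  (W <= \sum_i U i)%MS -> (forall i, (U i <= W)%MS) ->
  (forall i v, (v <= U i)%MS -> v *m G = c (d i) *: v) ->
  exists ds : seq nat, exists E : 'M[K]_(size ds, N),
    [/\ row_free E, (E <= W)%MS, size ds = \rank W,
        forall i : 'I_(size ds), row i E *m G = c (nth 0%N ds i) *: row i E &
        forall i : 'I_(size ds), exists j, nth 0%N ds i = d j].
Proof.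
move=> WU UW Ueig.
suff /(_ _ (leqnn _)) [ds [E [sz fE EW Eeig Ed]]] : forall k, (k <= \rank W)%N ->
    exists ds : seq nat, exists E : 'M[K]_(size ds, N),
    [/\ size ds = k, row_free E, (E <= W)%MS,
        forall i : 'I_(size ds), row i E *m G = c (nth 0%N ds i) *: row i E &
        forall i : 'I_(size ds), exists j, nth 0%N ds i = d j].
  by exists ds, E.
elim=> [|k IH] kW.
  exists [::], 0; split; [by []|by rewrite /row_free mxrank0|exact: sub0mx|by case|by case].
have [ds [E [sz fE EW Eeig Ed]]] := IH (ltnW kW).
have [i] : exists i, ~~ (U i <= E)%MS.
  apply/existsP; rewrite -negb_forall; apply: contraL kW => /forallP UE.
  rewrite -leqNgt -sz -(eqP fE) mxrankS // (submx_trans WU) //.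
  by apply/sumsmx_subP => i _.
case/row_subPn => j; set w := row j (U i) => wE.
have wU : (w <= U i)%MS by apply: row_sub.
have EW' : (col_mx w E <= W)%MS by rewrite col_mx_sub (submx_trans wU).
have fE' : row_free (col_mx w E).
  rewrite /row_free -addsmxE eqn_leq; apply/andP; split.
    by rewrite addsmxE; apply: rank_leq_row.
  apply: (@leq_trans (\rank E).+1); first by rewrite (eqP fE).
  apply: rank_ltmx.
  by rewrite /ltmx addsmxSr addsmx_sub submx_refl andbT.
have Eeig' (l : 'I_(1 + size ds)) :
    row l (col_mx w E) *m G = c (nth 0%N (d i :: ds) l) *: row l (col_mx w E).
  case: (split_ordP l) => l' ->; rewrite ?rowKu ?rowKd.
    by rewrite (ord1 l') row_id /= (Ueig i).
  by rewrite Eeig.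
exists (d i :: ds), (col_mx w E : 'M[K]_(1 + size ds, N)); split=> //; first by rewrite /= sz.
move=> l; case: (@split_ordP 1 (size ds) l) => l' ->; last exact: Ed.
by rewrite (ord1 l') /=; exists i.
Qed.

End WeightLemmas.

(* A basis (columns of [Xi]) of the annihilator of [[q, x]], made of [h]-weight vectors, with a
   left inverse [T]; the weights are recorded as degrees. *)
Definition slice_data (K : fieldType) N (X H : 'M[K]_N) (ds : seq nat)
    (Xi : 'M[K]_(N, size ds)) (T : 'M[K]_(size ds, N)) : Prop :=
  [/\ forall i : 'I_(size ds), (0 < nth 0%N ds i)%N, T *m Xi = 1%:M, X *m Xi = 0,
      (\rank X + size ds)%N = N &
      forall i : 'I_(size ds),
        H *m col i Xi = - (2%:R * ((nth 0%N ds i)%:R - 1)) *: col i Xi].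

(** Transposition turns the annihilator of the image of [X] into the kernel of [X^T], on which
    [- H^T] has weights [2 j]; these are recorded as degrees [j + 1], hence positive. The rank
    assumption expresses regularity of [x]. *)
Lemma slice_data_exists (K : fieldType) N (X H : 'M[K]_N) m : [pchar K] =i pred0 ->
  X *m H - H *m X = 2%:R *: X -> X ^+ m = 0 -> (\rank H <= \rank X)%N ->
  exists ds, exists Xi, exists T, @slice_data K N X H ds Xi T.
Proof.
move=> char0 XH Xm rk; pose A := X^T; pose G := (- H)^T.
have AG : A *m G - G *m A = 2%:R *: A.
  by rewrite -!trmx_mul -linearB /= mulNmx mulmxN opprK addrC XH linearZ.
have Am : A ^+ m = 0.
  have trX k : (X^T) ^+ k = (X ^+ k)^T.
    by elim: k => [|k IH]; rewrite ?trmx1 // exprS exprSr -!mulmxE IH trmx_mul.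
  by rewrite trX Xm trmx0.
have rkG : (\rank (kermx A) <= \rank (kermx G))%N.
  by rewrite !mxrank_ker !mxrank_tr mxrank_opp leq_sub2l.
pose c (n : nat) : K := 2%:R * (n%:R - 1).
have WU := even_weights char0 AG Am rkG.
have [|i v|ds [E [fE EW sz Eeig Ed]]] := @eigen_row_base K N G _ _
  (fun i : 'I_m => wt_space A G (i.*2)%:R) c (fun i => i.+1) WU.
- by move=> i; apply: capmxSl.
- case/wt_spaceP => _ ->; congr (_ *: _).
  by rewrite /c -[i.+1]addn1 natrD addrK -muln2 natrM mulrC.
exists ds, E^T, (pinvmx E)^T; split.
- by move=> i; have [j ->] := Ed i.
- by rewrite -trmx_mul mulmxVp // trmx1.
- by apply: trmx_inj; rewrite trmx_mul trmxK trmx0; apply/sub_kermxP.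
- by rewrite sz mxrank_ker mxrank_tr subnKC // rank_leq_row.
move=> i; apply: trmx_inj; rewrite trmx_mul tr_col trmxK linearZ /= tr_col trmxK.
rewrite scaleNr -Eeig /G linearN /= mulmxN opprK //.
Qed.

(** [P] intertwines just the two operators and is not a morphism of Lie algebras; it is what gives
    [g_e] and [g(0)] the same list [ds]. *)
Lemma slice_data_transport (K : fieldType) N N' (X H : 'M[K]_N) (X' H' : 'M[K]_N')
    (P : 'M[K]_(N', N)) (ds : seq nat) Xi T :
  N = N' -> row_free P -> X' *m P = P *m X -> H' *m P = P *m H ->
  @slice_data K N X H ds Xi T -> exists Xi', exists T', @slice_data K N' X' H' ds Xi' T'.
Proof.
move=> NN' fP XP HP [ds0 TXi XXi rk HXi].
have fullP : row_full P by rewrite /row_full (eqP fP) NN'.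
exists (P *m Xi), (T *m pinvmx P); split=> //.
- by rewrite mulmxA -[_ *m pinvmx P *m P]mulmxA mulVpmx // mulmx1.
- by rewrite mulmxA XP -mulmxA XXi mulmx0.
- rewrite -[in RHS]NN' -[in RHS]rk; congr (_ + _)%N.
  have -> : \rank X' = \rank (X' *m P) by rewrite mxrankMfree.
  by rewrite XP (eqmxMfull _ fullP).
by move=> i; rewrite !colE !mulmxA HP -!mulmxA -colE HXi -scalemxAr.
Qed.

(** * Subalgebras in coordinates *)

Section Subalgebra.
Variables (K : fieldType) (n : nat) (br : 'rV[K]_n -> 'rV[K]_n -> 'rV[K]_n).
Hypotheses (char0 : [pchar K] =i pred0) (lie : lie_axioms br).
Variable Q : 'M[K]_n.
Hypothesis subQ : forall u v, (u <= Q)%MS -> (v <= Q)%MS -> (br u v <= Q)%MS.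
Local Notation pt := (@point_of K n Q).
Local Notation co := (coord_of Q).

Definition br_in (c c' : 'rV[K]_(\rank Q)) : 'rV[K]_(\rank Q) := co (br (pt c) (pt c')).

Lemma pt_in c : (pt c <= Q)%MS.
Proof. by rewrite /point_of (submx_trans (submxMl _ _)) // eq_row_base. Qed.
Lemma coK v : (v <= Q)%MS -> pt (co v) = v.
Proof. by move=> vQ; rewrite /point_of /coord_of mulmxKpV // eq_row_base. Qed.
Lemma pt_br c c' : pt (br_in c c') = br (pt c) (pt c').
Proof. by rewrite coK // subQ // pt_in. Qed.

Lemma br_in_lie : lie_axioms br_in.
Proof.
have ptP a u v : pt (a *: u + v) = a *: pt u + pt v by rewrite /point_of mulmxDl -scalemxAl.
have coP a u v : co (a *: u + v) = a *: co u + co v by rewrite /coord_of mulmxDl -scalemxAl.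
split=> [a x y z|x y|x y z].
- by rewrite /br_in ptP (brPl lie) coP.
- by rewrite /br_in (br_anti lie) -scaleN1r /coord_of -scalemxAl scaleN1r.
rewrite {1 3 5}/br_in !pt_br /coord_of -!mulmxDl (br_jacobi lie) mul0mx //.
Qed.

Lemma ad_br_in c : ad_mx br_in c = row_base Q *m ad_mx br (pt c) *m pinvmx (row_base Q).
Proof.
apply/row_matrixP => i; rewrite !rowE (mul_ad_mx br_in_lie) /br_in /coord_of /point_of -(mul_ad_mx lie).
by move: (row_base Q) (pinvmx _) => B B'; rewrite !mulmxA.
Qed.

Lemma ad_stable c : (c <= Q)%MS -> (row_base Q *m ad_mx br c <= row_base Q)%MS.
Proof.
move=> cQ; apply/row_subP => i; rewrite row_mul (mul_ad_mx lie) eq_row_base subQ //.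
by rewrite (submx_trans (row_sub _ _)) // eq_row_base.
Qed.

Lemma ad_br_inK c : ad_mx br_in c *m row_base Q = row_base Q *m ad_mx br (pt c).
Proof. by rewrite ad_br_in mulmxKpV // ad_stable // pt_in. Qed.

Lemma ad_br_in_nilpotent x m : (x <= Q)%MS -> ad_mx br x ^+ m = 0 ->
  ad_mx br_in (co x) ^+ m = 0.
Proof.
move=> xQ xm; apply: (row_free_inj (row_base_free Q)); rewrite mul0mx.
suff -> : ad_mx br_in (co x) ^+ m *m row_base Q = row_base Q *m ad_mx br x ^+ m.
  by rewrite xm mulmx0.
elim: (m) => [|k IH]; first by rewrite mul1mx mulmx1.
by rewrite exprSr exprS -!mulmxE -mulmxA ad_br_inK coK // mulmxA IH -mulmxA !mulmxE -exprS -exprSr.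
Qed.

Lemma br_in_co u v : (u <= Q)%MS -> (v <= Q)%MS -> br_in (co u) (co v) = co (br u v).
Proof. by move=> uQ vQ; rewrite /br_in !coK. Qed.

Lemma rank_ad_br_in c :
  (\rank (ad_mx br_in c) + \rank (centralizer_in br Q (pt c)))%N = \rank Q.
Proof.
have -> : \rank (ad_mx br_in c) = \rank (Q *m ad_mx br (pt c)).
  rewrite -(mxrankMfree _ (row_base_free Q)) ad_br_inK.
  by rewrite (eqmxMr _ (eq_row_base Q)).
exact: mxrank_mul_ker.
Qed.

Lemma ad_invariantP p : ad_invariant br p <-> invariant br_in p.
Proof.
have e cx cy : \sum_(i < \rank Q)
    (co (br (pt cx) (pt cy))) 0 i * (mderiv i p).@[fun j => cy 0 j] =
    ev cy (mxder (ad_mx br_in cx) p).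
  rewrite ev_mxder (mul_ad_mx br_in_lie) /ev /ddir /der raddf_sum; apply: eq_bigr => i _ /=.
  by rewrite mevalM mevalC.
split=> [ip a|ip cx cy]; last by rewrite /= e ip /ev meval0.
by apply: (ev_eq0 char0) => v; rewrite -e; apply: ip.
Qed.

Lemma invariants_free (x h y : 'rV[K]_n) m ds Xi T :
  (x <= Q)%MS -> (h <= Q)%MS -> (y <= Q)%MS ->
  br h x = 2%:R *: x -> br x y = h -> ad_mx br x ^+ m = 0 ->
  (forall z, (z <= Q)%MS ->
     (\rank (centralizer_in br Q x) <= \rank (centralizer_in br Q z))%N) ->
  @slice_data K _ (ad_mx br_in (co x)) (ad_mx br_in (co h)) ds Xi T ->
  invariants_free_with_degrees br Q ds.
Proof.
move=> xQ hQ yQ hx xy xm reg [ds0 TXi xXi rk hXi].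
have hx' : br_in (co h) (co x) = 2%:R *: co x by rewrite br_in_co // hx /coord_of scalemxAl.
have xy' : br_in (co x) (co y) = co h by rewrite br_in_co // xy.
have xm' : ad_mx br_in (co x) ^+ m.+1 = 0.
  by rewrite exprS (ad_br_in_nilpotent xQ xm) mulr0.
have reg' z : (\rank (ad_mx br_in z) <= \rank (ad_mx br_in (co x)))%N.
  rewrite -(leq_add2r (\rank (centralizer_in br Q x))) -[X in (_ <= _ + \rank (centralizer_in _ _ X))%N](coK xQ).
  rewrite rank_ad_br_in -[X in (_ <= X)%N](rank_ad_br_in z) leq_add2l; by apply: reg; apply: pt_in.
have [F [Fh Fi Find Fgen]] :=
  invariants_polynomial char0 br_in_lie hx' xy' xm' reg' ds0 TXi xXi rk hXi.
exists F; split=> // [i|p /ad_invariantP]; [exact/ad_invariantP/Fi | exact: Fgen].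
Qed.

End Subalgebra.

(** * Weights and splitting for [sl2] acting by matrices *)

Section Sl2Matrices.
Variables (K : fieldType) (n M : nat) (X Y H : 'M[K]_n).
Hypothesis char0 : [pchar K] =i pred0.
Hypotheses (YX : Y *m X - X *m Y = H) (XH : X *m H - H *m X = 2%:R *: X).
Hypotheses (YH : Y *m H - H *m Y = - (2%:R *: Y)) (XM : X ^+ M = 0) (YM : Y ^+ M = 0).
Implicit Types v u : 'rV[K]_n.

Let XY' v : mulmxr X (mulmxr Y v) - mulmxr Y (mulmxr X v) = mulmxr H v.
Proof. by rewrite /= -!mulmxA -mulmxBr YX. Qed.

Let HX' v : mulmxr H (mulmxr X v) - mulmxr X (mulmxr H v) = 2%:R *: mulmxr X v.
Proof. by rewrite /= -!mulmxA -mulmxBr XH scalemxAr. Qed.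

Let iterE (A : 'M[K]_n) k v : iter k (mulmxr A) v = v *m A ^+ k.
Proof. by elim: k => [|k IH]; rewrite ?mulmx1 // iterS IH /= exprSr -mulmxA. Qed.

Let XY0 v : iter M (mulmxr X) (iter M (mulmxr Y) v) = 0.
Proof. by rewrite iterE XM mulmx0. Qed.

Lemma kerX_weight v c : v *m X = 0 -> v *m H = c *: v -> v != 0 -> exists i : nat, c = i%:R.
Proof.
by move=> vX vH v0; have [i _ ->] := kerX_eigenvalue char0 XY' HX' vX (XY0 v) vH v0; exists i.
Qed.

(** Peeling off the top weight: [u], the product of the lower factors applied to [v], has weight
    [m], and [v - c^-1 u] is killed by the lower factors alone. *)
Lemma kerX_decomposition : (kermx X <= \sum_(i < M) wt_space X H i%:R)%MS.
Proof.
apply/rV_subP => v /sub_kermxP vX; have := kerX_shifts_eq0 char0 XY' HX' vX (XY0 v).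
elim: (M) v vX => [|m IH] v vX; first by move=> /= ->; rewrite sub0mx.
rewrite natsS /= => /eqP; rewrite subr_eq0 => /eqP uH.
set u := shifts _ _ _ in uH; rewrite big_ord_recr /=.
pose c := \prod_(a <- nats K m) (m%:R - a : K).
have c0 : c != 0.
  rewrite /c prodf_seq_neq0; apply/allP => a /mapP [i]; rewrite mem_rev mem_iota => /andP [_ im] ->.
  by rewrite subr_eq0; apply/eqP => /(natr_inj char0) mi; rewrite -mi ltnn in im.
have uX : u *m X = 0 by apply: (kerX_shifts HX').
have wu : (c^-1 *: u <= wt_space X H m%:R)%MS by rewrite scalemx_sub //; apply/wt_spaceP.
rewrite -[v](subrK (c^-1 *: u)); apply: addmx_sub; last first.
  exact: submx_trans wu (addsmxSr _ _).
apply: submx_trans (addsmxSl _ _); apply: IH.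
  by rewrite mulmxBl vX -scalemxAl uX scaler0 subr0.
rewrite addrC -scaleNr shiftsP -/u (@shifts_eigen _ _ (mulmxr H) _ _ _ uH) -/c.
by rewrite scalerA mulNr mulVf // scaleN1r addNr.
Qed.

Lemma mulY_weight v c k : v *m H = c *: v -> v *m Y ^+ k *m H = (c - 2%:R * k%:R) *: (v *m Y ^+ k).
Proof.
move=> vH; elim: k => [|k IH]; first by rewrite mulmx1 vH mulr0 subr0.
have YH' : Y *m H = H *m Y - 2%:R *: Y by rewrite -YH addrC subrK.
rewrite exprSr -mulmxE mulmxA -[_ *m Y *m H]mulmxA YH' mulmxBr mulmxA IH -scalemxAl -scalemxAr.
by rewrite -scalerBl -natr1; congr (_ *: _); ring.
Qed.

Lemma mulYX v k : v *m X = 0 -> v *m Y ^+ k *m X ^+ k = k`!%:R *: shifts (mulmxr H) (nats K k) v.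
Proof. by move=> vX; rewrite -!iterE (kerX_chain XY' HX'). Qed.

Lemma mulYX_weight v c k : v *m X = 0 -> v *m H = c *: v ->
  v *m Y ^+ k *m X ^+ k = (k`!%:R * \prod_(a <- nats K k) (c - a)) *: v.
Proof.
by move=> vX vH; rewrite mulYX // (@shifts_eigen _ _ (mulmxr H) _ _ _ vH) scalerA.
Qed.

Lemma mulYXS v c k : v *m X = 0 -> v *m H = c *: v -> v *m Y ^+ k *m X ^+ k.+1 = 0.
Proof.
by move=> vX vH; rewrite exprSr -mulmxE mulmxA (mulYX_weight _ vX vH) -scalemxAl vX scaler0.
Qed.

(* [k (H - k - 1) v = X^(k+1) Y w] for [v = X^k w] in the kernel of [Y] *)
Lemma kerY_imX_step k v w : v *m Y = 0 -> v = w *m X ^+ k.+1 ->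
  (v *m H - k.+2%:R *: v <= X ^+ k.+2)%MS.
Proof.
move=> vY vw; have := iterX_Y XY' HX' k w; rewrite !iterE /= -vw vY add0r.
move=> /(congr1 (mulmx^~ X)); rewrite -scalemxAl mulmxBl -scalemxAl.
have HX'' : H *m X = X *m H - 2%:R *: X by rewrite -XH opprB addrC subrK.
rewrite -[w *m X ^+ k *m H *m X]mulmxA HX'' mulmxBr -scalemxAr mulmxA.
rewrite -[w *m X ^+ k *m X]mulmxA !mulmxE -exprSr -vw -mulmxA mulmxE -exprSr => e.
rewrite -(eqmx_scale _ (natrS0 char0 k)) (_ : _ *: (_ - _) = w *m Y *m X ^+ k.+2) ?submxMl //.
by rewrite e -addrA -opprD -scalerDl -natrD addnC addn2.
Qed.

End Sl2Matrices.

Section Sl2Split.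
Variables (K : fieldType) (n M : nat) (X Y H : 'M[K]_n).
Hypothesis char0 : [pchar K] =i pred0.
Hypotheses (YX : Y *m X - X *m Y = H) (XH : X *m H - H *m X = 2%:R *: X).
Hypotheses (YH : Y *m H - H *m Y = - (2%:R *: Y)) (XM : X ^+ M = 0) (YM : Y ^+ M = 0).

Let XY : X *m Y - Y *m X = - H. Proof. by rewrite -YX opprB. Qed.
Let YNH : Y *m (- H) - - H *m Y = 2%:R *: Y.
Proof. by rewrite mulmxN mulNmx opprK addrC -opprB YH opprK. Qed.
Lemma kerY_weight (v : 'rV[K]_n) c : v *m Y = 0 -> v *m H = c *: v -> v != 0 -> exists i : nat, c = - i%:R.
Proof.
move=> vY vH v0; have vNH : v *m (- H) = (- c) *: v by rewrite mulmxN vH scaleNr.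
by have [i ci] := kerX_weight char0 XY YNH YM vY vNH v0; exists i; rewrite -ci opprK.
Qed.

(** Downward induction on the power of [X]. For [v] in [ker Y] and the image of [X^(k+1)], the
    vector [(H - (k + 2)) v] lies in the next, zero, intersection, so [v] has positive weight, while
    weights on [ker Y] are at most 0. *)
Lemma kerY_imX : (kermx Y :&: X = 0)%MS.
Proof.
suff gen j k : (k.+1 + j >= M)%N -> (kermx Y :&: X ^+ k.+1 = 0)%MS by apply: (gen M 0%N); lia.
elim: j k => [|j IH] k kM.
  have -> : X ^+ k.+1 = 0 by rewrite addn0 in kM; rewrite -(subnKC kM) exprD XM mul0r.
  exact: capmx0.
apply/eqP; rewrite -submx0; apply/rV_subP => v; rewrite sub_capmx => /andP [/sub_kermxP vY].
case/submxP => w vw; rewrite submx0; apply: contraT => v0.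
have : (v *m H - k.+2%:R *: v <= kermx Y :&: X ^+ k.+2)%MS.
  rewrite sub_capmx (kerY_imX_step char0 YX XH vY vw) andbT; apply/sub_kermxP.
  have HY : H *m Y = Y *m H + 2%:R *: Y by rewrite -[Y *m H](subrK (H *m Y)) YH addrAC addNr add0r.
  by rewrite mulmxBl -mulmxA HY mulmxDr mulmxA vY mul0mx -!scalemxAr -scalemxAl vY !scaler0 addr0 subr0.
rewrite IH ?submx0; last by rewrite addSnnS.
rewrite subr_eq0 => /eqP vH; have [i] := kerY_weight vY vH v0.
move/eqP; rewrite -addr_eq0 -natrD addSn => /eqP i0.
by have := natrS0 char0 (k.+1 + i); rewrite i0 eqxx.
Qed.

End Sl2Split.

(** The two trivial intersections [ker Y] with [im X] and [ker X] with [im Y] give, by rank-nullity,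
    [rank X <= rank Y] and then a sum of full dimension. *)
Lemma sl2_split (K : fieldType) (n M : nat) (X Y H : 'M[K]_n) : [pchar K] =i pred0 ->
  Y *m X - X *m Y = H -> X *m H - H *m X = 2%:R *: X -> Y *m H - H *m Y = - (2%:R *: Y) ->
  X ^+ M = 0 -> Y ^+ M = 0 -> (1%:M <= kermx X + Y)%MS.
Proof.
move=> char0 YX XH YH XM YM; have YX0 := kerY_imX char0 YX XH YH XM YM.
have XY0 : (kermx X :&: Y = 0)%MS.
  apply: (kerY_imX (H := - H)) YM XM => //; first by rewrite -YX opprB.
    by rewrite mulmxN mulNmx opprK addrC -opprB YH opprK.
  by rewrite mulmxN mulNmx opprK addrC -opprB XH.
have rk1 : (\rank (kermx Y + X)%MS <= n)%N by apply: rank_leq_row.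
rewrite sub1mx /row_full eqn_leq rank_leq_row /= mxrank_disjoint_sum // mxrank_ker.
rewrite mxrank_disjoint_sum // mxrank_ker in rk1.
have := rank_leq_row X; have := rank_leq_row Y; lia.
Qed.

(** * Cartan's criterion *)

Section Nilpotent.
Variable K : fieldType.

(** Induction on the size: with the rank factorization [A = C R], the trace is that of [R C], which
    is again nilpotent and smaller. *)
Lemma mxtrace_nilpotent n (A : 'M[K]_n) k : A ^+ k = 0 -> \tr A = 0.
Proof.
elim/ltn_ind: n => n IH in A k *; move=> Ak.
have [rA|rA] := eqVneq (\rank A) n.
  have rAk l : \rank (A ^+ l) = n.
    elim: l => [|l IHl]; first exact: mxrank1.
    by rewrite exprSr -mulmxE mxrankMfree // /row_free rA.
  have := rAk k; rewrite Ak mxrank0 => n0.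
  by rewrite /mxtrace big1 // => i; have := ltn_ord i; rewrite -{2}n0.
rewrite -[A in LHS](mulmx_base A) mxtrace_mulC.
apply: (IH _ _ _ k.+1); first by rewrite ltn_neqAle rA rank_leq_row.
have conj l : (row_base A *m col_base A) ^+ l.+1 = row_base A *m A ^+ l *m col_base A.
  elim: l => [|l IHl]; first by rewrite mulmx1.
  rewrite exprSr IHl [A ^+ l.+1]exprSr -!mulmxE; have := mulmx_base A.
  move: (row_base A) (col_base A) => X Y base; rewrite -!mulmxA.
  by congr (_ *m (_ *m _)); rewrite mulmxA base.
by rewrite conj Ak mulmx0 mul0mx.
Qed.

Lemma mxtrace_idempotent n (A : 'M[K]_n) : A *m A = A -> \tr A = (\rank A)%:R.
Proof.
move=> AA; rewrite -[A in LHS](mulmx_base A) mxtrace_mulC.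
suff -> : row_base A *m col_base A = 1%:M by rewrite mxtrace1.
have := mulmx_base A; have := row_base_free A; have := col_base_full A.
move: (row_base A) (col_base A) => X Y fY fX base.
apply: (row_free_inj fX); apply: (row_full_inj fY).
by rewrite mul1mx !mulmxA base -mulmxA base AA.
Qed.

Hypothesis char0 : [pchar K] =i pred0.

Section Jacobson.
Variables (n : nat) (A B : 'M[K]_n).
Let C := A * B - B * A.
Hypothesis AC : GRing.comm A C.

Let AB : A * B = B * A + C. Proof. by rewrite addrC subrK. Qed.

Let AjB j : A ^+ j.+1 * B = B * A ^+ j.+1 + (A ^+ j * C) *+ j.+1.
Proof.
elim: j => [|j IH]; first by rewrite expr1 mul1r.
have CA : C * A ^+ j.+1 = A ^+ j.+1 * C by apply: commrX; apply: commr_sym.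
rewrite exprS -mulrA IH mulrDr mulrA AB mulrDl -mulrA -exprS CA -mulrnAr mulrA -exprS mulrnAr.
by rewrite -addrA -mulrS.
Qed.

(* [0 = C^k A^(j+1) B C^k = (j+1) A^j C^(2k+1)] *)
Let C_nilpotent m : A ^+ m = 0 -> exists k, C ^+ k = 0.
Proof.
move=> Am; suff gen j k : A ^+ j * C ^+ k = 0 -> exists l, C ^+ l = 0.
  by apply: (gen m 0%N); rewrite mulr1.
elim: j k => [|j IH] k Ajk; first by exists k; rewrite mul1r in Ajk.
have CA i l : C ^+ i * A ^+ l = A ^+ l * C ^+ i.
  by apply: commrX; apply: commr_sym; apply: commrX.
apply: (IH (k + k.+1)%N); have : C ^+ k * (A ^+ j.+1 * B) * C ^+ k = 0.
  by rewrite mulrA CA Ajk !mul0r.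
rewrite AjB mulrDr mulrDl -!mulrA Ajk !mulr0 add0r mulrnAl mulrnAr.
rewrite -mulrA -exprS [C ^+ k * _]mulrA CA -mulrA -exprD -[_ *+ _]scaler_nat => /eqP.
by rewrite scaler_eq0 (negPf (natrS0 char0 j)) => /eqP.
Qed.

(** Descent on the power of [A]: once [A^(j+1) T^l = 0], one has [A^j T^(l+1) = (j + 1) C A^j T^l],
    and [C] is nilpotent. *)
Lemma nilpotent_mul m : A ^+ m = 0 -> exists k, (A * B) ^+ k = 0.
Proof.
move=> Am; have [c Cc] := C_nilpotent Am; set T := A * B.
suff gen i : (i <= m)%N -> exists k, A ^+ (m - i) * T ^+ k = 0.
  by have [k] := gen m (leqnn m); rewrite subnn mul1r; exists k.
elim: i => [|i IH] im; first by exists 0%N; rewrite subn0 Am mul0r.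
have [k0] := IH (ltnW im); rewrite -subnSK //; set j := (m - i.+1)%N => jk0.
have step l : (k0 <= l)%N -> A ^+ j * T ^+ l.+1 = (C * (A ^+ j * T ^+ l)) *+ j.+1.
  move=> kl; have jl : A ^+ j.+1 * T ^+ l = 0 by rewrite -(subnKC kl) exprD mulrA jk0 mul0r.
  have CA : C * A ^+ j = A ^+ j * C by apply: commrX; apply: commr_sym.
  rewrite [T ^+ l.+1]exprS mulrA {1}/T mulrA -exprSr AjB mulrDl -mulrA jl mulr0 add0r mulrnAl.
  by rewrite -CA -mulrA.
exists (k0 + c)%N; suff -> l : A ^+ j * T ^+ (k0 + l) = (C ^+ l * (A ^+ j * T ^+ k0)) *+ (j.+1 ^ l).
  by rewrite Cc mul0r mul0rn.
elim: l => [|l IHl]; first by rewrite addn0 mul1r.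
by rewrite addnS step ?leq_addr // IHl mulrnAr -mulrnA mulrA -exprS -expnSr.
Qed.

End Jacobson.

(** The rational-functional trick of Cartan's criterion, for maps [phi] respecting only the
    relations [t i + t j = t k]. Over the rationals, these relations (rows of [B]) and the
    [d]-scaled vectors orthogonal to them span everything, by positivity of [d]. A multiple of [t i]
    thus becomes a combination of relations, zero in [K], and of a sum that the hypothesis kills. *)
Lemma additive_weights_eq0 m (t : 'I_m -> K) (d : 'I_m -> nat) : (forall i, (0 < d i)%N) ->
  (forall phi : 'I_m -> int,
     (forall i j k, t i + t j = t k -> phi i + phi j = phi k) ->
     \sum_i (t i *~ phi i) *+ d i = 0) ->
  forall i, t i = 0.
Proof.
move=> d0 ort.
pose b (a : 'I_m * 'I_m * 'I_m) (l : 'I_m) : int :=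
  if t a.1.1 + t a.1.2 == t a.2 then (l == a.1.1)%:Z + (l == a.1.2)%:Z - (l == a.2)%:Z else 0.
pose B : 'M[rat]_(#|{: 'I_m * 'I_m * 'I_m}|, m) := \matrix_(a, l) (b (enum_val a) l)%:~R.
pose S := (B + kermx (B^T) *m diag_mx (\row_l (d l)%:R))%MS.
(* A vector [u] orthogonal to both summands satisfies [sum d_l u_l^2 = 0]. *)
have S_full : row_full S.
  have ortS k (W : 'M_(k, m)) (u : 'rV_m) : u *m S^T = 0 -> (W <= S)%MS -> u *m W^T = 0.
    by move=> uS /submxP [X ->]; rewrite trmx_mul mulmxA uS mul0mx.
  rewrite /row_full -mxrank_tr -/(row_free _) -kermx_eq0 -submx0; apply/rV_subP => u /sub_kermxP uS.
  have uB : (u <= kermx (B^T))%MS by apply/sub_kermxP/ortS; rewrite // addsmxSl.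
  have : u *m (u *m diag_mx (\row_l (d l)%:R))^T = 0.
    by apply: ortS uS _; rewrite (submx_trans _ (addsmxSr _ _)) // submxMr.
  move=> /(congr1 (fun M : 'M_1 => M 0 0)); rewrite mxE [RHS]mxE.
  under eq_bigr => l _ do rewrite mxE mul_mx_diag !mxE mulrA -expr2.
  move=> /eqP; rewrite psumr_eq0 => [/allP u0|l _]; last by rewrite mulr_ge0 ?sqr_ge0 ?ler0n.
  rewrite submx0; apply/eqP/rowP => l; rewrite mxE; have := u0 l (mem_index_enum l).
  by rewrite mulf_eq0 sqrf_eq0 pnatr_eq0 -[d l == _]negbK -lt0n d0 orbF => /eqP.
move=> i; have /sub_addsmxP [[c1 c2] /= ei] : ((delta_mx 0 i : 'rV_m) <= S)%MS
  by apply: submx_full.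
move: ei; set phi := c2 *m kermx (B^T); rewrite mulmxA -/phi => ei.
have phiB : phi *m B^T = 0 by rewrite -mulmxA mulmx_ker mulmx0.
(* Rational coefficients cannot act on [K] by [*~], and the [phi] of the hypothesis are integral, so
   denominators are cleared in the whole identity at once. *)
have clear k (w : 'rV[rat]_k) : exists2 M : int, M != 0 &
    exists z : 'I_k -> int, forall l, M%:~R * w 0 l = (z l)%:~R.
  exists (\prod_l denq (w 0 l)); first by apply/prodf_neq0 => l _; apply: denq_neq0.
  exists (fun l => numq (w 0 l) * \prod_(l' | l' != l) denq (w 0 l')) => l.
  rewrite (bigD1 l) //= !rmorphM /= mulrAC; congr (_ * _).
  by rewrite -[w 0 l in X in _ * X]divq_num_den mulrC divfK // intr_eq0 denq_neq0.
have [M M0 [z zw]] := clear _ (row_mx c1 phi).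
pose z1 a := z (lshift _ a); pose z2 l := z (rshift _ l).
have z1E a : M%:~R * c1 0 a = (z1 a)%:~R by rewrite -zw row_mxEl.
have z2E l : M%:~R * phi 0 l = (z2 l)%:~R by rewrite -zw row_mxEr.
have eint l : M * (l == i)%:Z = \sum_a z1 a * b (enum_val a) l + z2 l * (d l)%:Z.
  apply: (@intr_inj rat); rewrite rmorphD rmorphM rmorph_sum /= rmorphM /= -z2E.
  have := congr1 (fun u : 'rV_m => M%:~R * u 0 l) ei; rewrite mxE eqxx /= eq_sym => ->.
  rewrite mxE mulrDr mul_mx_diag !mxE mulr_sumr mulrA; congr (_ + _).
  by apply: eq_bigr => a _; rewrite mxE mulrA z1E rmorphM.
have add_z2 j1 j2 j3 : t j1 + t j2 = t j3 -> z2 j1 + z2 j2 = z2 j3.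
  move=> t123; apply: (@intr_inj rat); rewrite rmorphD /= -!z2E -mulrDr; congr (_ * _).
  have := congr1 (fun u : 'rV_ _ => u 0 (enum_rank (j1, j2, j3))) phiB.
  have pick (j : 'I_m) : \sum_l phi 0 l * (l == j)%:Z%:~R = phi 0 j.
    by rewrite (bigD1 j) //= eqxx mulr1 big1 ?addr0 // => l /negPf ->; rewrite mulr0.
  rewrite [LHS]mxE [RHS]mxE (eq_bigr (fun l => phi 0 l * (l == j1)%:Z%:~R +
    phi 0 l * (l == j2)%:Z%:~R - phi 0 l * (l == j3)%:Z%:~R)) => [|l _]; last first.
    rewrite [B^T _ _]mxE [B _ _]mxE enum_rankK /b /= t123 eqxx.
    by rewrite rmorphB rmorphD /= mulrBr mulrDr.
  by rewrite sumrB big_split /= !pick => /eqP; rewrite subr_eq0 => /eqP.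
have sumt a : \sum_l t l *~ b a l = 0.
  rewrite /b; have [t3|_] := eqVneq; last by rewrite big1.
  have pick (j : 'I_m) : \sum_l t l *~ (l == j)%:Z = t j.
    by rewrite (bigD1 j) //= eqxx big1 ?addr0 // => l /negPf ->.
  under eq_bigr => l _ do rewrite mulrzBr mulrzDr.
  by rewrite sumrB big_split /= !pick t3 subrr.
have : \sum_l t l *~ (M * (l == i)%:Z) = 0.
  under eq_bigr => l _ do rewrite eint mulrzDr mulrz_sumr.
  rewrite big_split /= exchange_big /= big1 ?add0r => [|a _].
    rewrite -[RHS](ort z2 add_z2); apply: eq_bigr => l _.
    by rewrite mulrzA pmulrn.
  under eq_bigr => l _ do rewrite mulrC mulrzA.
  by rewrite -mulrz_suml sumt mul0rz.
rewrite (bigD1 i) //= eqxx mulr1 big1 ?addr0 => [/eqP|l /negPf ->]; last by rewrite mulr0.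
rewrite -mulrzr mulf_eq0 => /orP [/eqP //|].
case: M M0 {zw z1E z2E eint} => k k0; last first.
  by rewrite NegzE rmorphN /= oppr_eq0 -[_%:~R]/(k.+1%:R) (negPf (natrS0 char0 k)).
by case: k k0 => // k _; rewrite -[_%:~R]/(k.+1%:R) (negPf (natrS0 char0 k)).
Qed.

End Nilpotent.

(** Bezout idempotents for the coprime factors [(X - t_i)^(n+1)]; being polynomials in [A] they
    commute with it. The common exponent exceeds every multiplicity, so the product is a multiple of
    the characteristic polynomial. *)
Lemma spectral_idempotents (K : closedFieldType) n (A : 'M[K]_n) :
  let U t := kermx ((A - t%:M) ^+ n.+1) in
  exists m, exists t : 'I_m -> K, exists p : 'I_m -> 'M[K]_n,
  [/\ (1%:M <= \sum_i U (t i))%MS,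
      forall i, exists2 v : 'rV_n, v *m A = t i *: v & v != 0,
      forall i, [/\ p i *m p i = p i, p i *m A = A *m p i &
                    (A - (t i)%:M) ^+ n.+1 *m p i = 0] &
      forall i (v : 'rV_n), (v <= U (t i))%MS -> v *m p i = v /\ forall j, j != i -> v *m p j = 0].
Proof.
case: n A => [|n'] A U.
  exists 0%N, (fun=> 0), (fun=> 0); split; [by rewrite flatmx0 sub0mx|by case..].
have [rs] := closed_field_poly_normal (char_poly A).
rewrite (monicP (char_poly_monic A)) scale1r => Dchar.
pose s := undup rs; pose t (i : 'I_(size s)) := s`_i.
have t_inj : injective t.
  by move=> i j /eqP; rewrite /t nth_uniq ?undup_uniq // => /eqP/val_inj.
pose F i : {poly K} := ('X - (t i)%:P) ^+ n'.+2.
pose q i := \prod_(j | j != i) F j; pose P := \prod_i F i.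
have Pq i : P = F i * q i by rewrite /P (bigD1 i).
have coF i j : i != j -> coprimep (F i) (F j).
  move=> ij; apply/coprimep_expl/coprimep_expr/coprimep_XsubC2.
  by rewrite subr_eq0; apply: contra ij => /eqP/t_inj ->.
have coq i : coprimep (F i) (q i).
  rewrite /q; elim/big_ind: _ => [|a b ca cb|j ji]; first exact: coprimep1.
    by rewrite coprimepMr ca.
  by apply: coF; rewrite eq_sym.
have P0 : horner_mx A P = 0.
  suff /dvdpP [c ->] : char_poly A %| P by rewrite rmorphM /= Cayley_Hamilton mulr0.
  have szrs : size rs = n'.+1.
    by have := size_char_poly A; rewrite Dchar size_prod_XsubC => -[].
  rewrite Dchar /P prodrXl exprS -szrs dvdp_mull //; set Q := \prod_i _.
  have rQ z : z \in rs -> 'X - z%:P %| Q.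
    rewrite -mem_undup -/s -index_mem => zs.
    have -> : z = t (Ordinal zs) by rewrite /t nth_index // -index_mem.
    by rewrite /Q (bigD1 (Ordinal zs)) //= dvdp_mulr.
  elim: (rs) rQ => [|z r IH] rQ; first by rewrite big_nil dvd1p.
  rewrite big_cons exprS dvdp_mul //; first by rewrite rQ // mem_head.
  by apply: IH => z' zr; rewrite rQ // in_cons zr orbT.
have bez i : exists uv : {poly K} * {poly K}, uv.1 * F i + uv.2 * q i = 1.
  exact/Bezout_eq1_coprimepP.
have [uv uvE] := fin_all_exists bez.
pose pp i := (uv i).2 * q i.
have FE i : (A - (t i)%:M) ^+ n'.+2 = horner_mx A (F i).
  by rewrite rmorphXn rmorphB /= horner_mx_X horner_mx_C.
have Fp0 i : horner_mx A (F i * pp i) = 0.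
  by rewrite /pp mulrCA -Pq rmorphM /= P0 mulr0.
have ppE i : pp i = 1 - (uv i).1 * F i 
  by apply/eqP; rewrite eq_sym subr_eq [_ + _]addrC uvE.
exists (size s), t, (fun i => horner_mx A (pp i)); split.
- have PE : (kermxpoly A P :=: \sum_i U (t i))%MS.
    apply: eqmx_trans (kermxpoly_prod _ _) _ => [i j _ _ ij|]; first by apply: coF; rewrite eq_sym.
    by apply/eqmx_sums => i _; rewrite /U FE.
  by rewrite -PE /kermxpoly P0 kermx0.
- move=> i; apply/eigenvalueP; rewrite eigenvalue_root_char Dchar root_prod_XsubC.
  by rewrite -mem_undup mem_nth.
- move=> i; split; last by rewrite FE mulmxE -rmorphM /= Fp0.
    rewrite mulmxE -rmorphM {2}ppE mulrBr mulr1 mulrCA [pp i * F i]mulrC.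
    by rewrite rmorphB [X in _ - X]rmorphM /= Fp0 mulr0 subr0.
  by rewrite -{2 3}[A]horner_mx_X !mulmxE -!rmorphM mulrC.
move=> i v /sub_kermxP; rewrite FE => vF; split.
  by rewrite ppE mulrC rmorphB rmorph1 rmorphM /= mulmxBr mulmx1 -mulmxE mulmxA vF mul0mx subr0.
move=> j ji; have -> : pp j = F i * ((uv j).2 * \prod_(l | (l != j) && (l != i)) F l).
  by rewrite /pp /q (bigD1 i) 1?eq_sym //= mulrCA.
by rewrite rmorphM /= -mulmxE mulmxA vF mul0mx.
Qed.

(** * Derivations and generalized weights *)

Section Derivations.
Variables (K : fieldType) (n : nat) (br : 'rV[K]_n -> 'rV[K]_n -> 'rV[K]_n).
Hypothesis lie : lie_axioms br.
Local Notation ad := (ad_mx br).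
Implicit Types (u v w x y z : 'rV[K]_n).

Definition derivation (D : 'M[K]_n) := forall u v, br u v *m D = br (u *m D) v + br u (v *m D).

Lemma br_leibniz x u v : br x (br u v) = br (br x u) v + br u (br x v).
Proof. by rewrite (br_br lie) subrK. Qed.

Lemma ad_derivation x : derivation (ad x).
Proof. by move=> u v; rewrite !(mul_ad_mx lie) br_leibniz. Qed.

Lemma ad_mx_derivation D v : derivation D -> ad (v *m D) = ad v *m D - D *m ad v.
Proof.
move=> dD; apply/row_matrixP => i; rewrite !rowE mulmxBr !mulmxA !(mul_ad_mx lie) dD.
by rewrite addrK.
Qed.

Lemma derivation_weight D s t k l u v : derivation D ->
  u *m (D - s%:M) ^+ k = 0 -> v *m (D - t%:M) ^+ l = 0 ->
  br u v *m (D - (s + t)%:M) ^+ (k + l) = 0.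
Proof.
move=> dD; have [N] := ubnP (k + l); elim: N k l u v => [//|N IH] [|k] l u v.
  by move=> _; rewrite mulmx1 => -> _; rewrite (br0l lie) mul0mx.
case: l => [|l] lt.
  by move=> _; rewrite mulmx1 => ->; rewrite (br0r lie) mul0mx.
rewrite exprS -mulmxE mulmxA => uk; rewrite exprS -mulmxE mulmxA => vl.
have step : br u v *m (D - (s + t)%:M) =
    br (u *m (D - s%:M)) v + br u (v *m (D - t%:M)).
  rewrite !mulmxBr !mul_mx_scalar dD !(brDl lie) !(brDr lie) (brNl lie) (brNr lie).
  by rewrite (brZl lie) (brZr lie) scalerDl opprD addrACA.
rewrite addSn exprS -mulmxE mulmxA step mulmxDl.
rewrite IH ?add0r //; last by rewrite exprS -mulmxE mulmxA.
  rewrite -addSnnS IH //; last by rewrite exprS -mulmxE mulmxA.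
  by move: lt; rewrite addnS addSn.
Qed.

Lemma disjoint_weights (A : 'M[K]_n) s t k l w : s != t ->
  w *m (A - s%:M) ^+ k = 0 -> w *m (A - t%:M) ^+ l = 0 -> w = 0.
Proof.
move=> st; have [N] := ubnP (k + l); elim: N k l w => [//|N IH] [|k] l w.
  by move=> _; rewrite mulmx1.
case: l => [|l] lt; first by rewrite mulmx1.
move=> wk wl; have comm c d m :
    w *m (A - c%:M) *m (A - d%:M) ^+ m = w *m (A - d%:M) ^+ m *m (A - c%:M).
  rewrite -!mulmxA; congr (_ *m _); rewrite !mulmxE; apply: commrX.
  have cs M a : GRing.comm M (a%:M : 'M[K]_n) by rewrite /GRing.comm -!mulmxE scalar_mxC.
  by apply: commrB (cs _ _); apply: commr_sym; apply: commrB (cs _ _).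
have ws : w *m (A - s%:M) = 0.
  apply: (IH k l.+1); first by move: lt; rewrite addSn.
    by rewrite -mulmxA mulmxE -exprS.
  by rewrite comm wl mul0mx.
have wt : w *m (A - t%:M) = 0.
  apply: (IH k.+1 l); first by move: lt; rewrite addnS.
    by rewrite comm wk mul0mx.
  by rewrite -mulmxA mulmxE -exprS.
have : (s - t) *: w = 0.
  move: ws wt; rewrite !mulmxBr !mul_mx_scalar scalerBl => /eqP; rewrite subr_eq0 => /eqP <-.
  by move/eqP; rewrite subr_eq0 => /eqP ->; rewrite subrr.
by move/eqP; rewrite scaler_eq0 subr_eq0 (negPf st) => /eqP.
Qed.

End Derivations.

(* The semisimple part of [ad x], with its eigenvalues moved by an additive map to the
   integers, is still a derivation. *)
Lemma nilpotent_of_trace (K : closedFieldType) (n : nat) (br : 'rV[K]_n -> 'rV[K]_n -> 'rV[K]_n) x :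
  [pchar K] =i pred0 -> lie_axioms br ->
  (forall D, derivation br D -> \tr (ad_mx br x *m D) = 0) -> exists k, ad_mx br x ^+ k = 0.
Proof.
move=> char0 lie; move: (ad_mx br x) (ad_derivation lie x) => A dA trA.
have [m [t [p [sumU eig pE pU]]]] := spectral_idempotents A.
pose U s := kermx ((A - s%:M) ^+ n.+1).
have {}pU i (v : 'rV_n) : (v <= U (t i))%MS -> v *m p i = v /\ forall j, j != i -> v *m p j = 0.
  exact: pU.
have comm_p i s : GRing.comm (A - s%:M) (p i).
  by have [_ pA _] := pE i; rewrite /GRing.comm -!mulmxE mulmxBl mulmxBr pA scalar_mxC.
have decomp (w : 'rV_n) : exists2 a : 'I_m -> 'rV_n, forall i, (a i <= U (t i))%MS & w = \sum_i a i.
  have /sub_sumsmxP [c ->] := submx_trans (submx1 w) sumU.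
  by exists (fun i => c i *m U (t i)) => // i; apply: submxMl.
have pw i (a : 'rV_n) : (a <= U (t i))%MS -> forall j, a *m p j = (j == i)%:R *: a.
  move=> aU j; have [ai aj] := pU _ _ aU; have [->|ji] := eqVneq; first by rewrite scale1r.
  by rewrite aj // scale0r.
pose d i := \rank (p i).
have t0 : forall i, t i = 0.
  apply: (additive_weights_eq0 char0 (d := d)) => [i|phi add_phi].
    rewrite /d lt0n mxrank_eq0; apply/eqP => pi0; have [v vt /eqP []] := eig i.
    suff vU : (v <= U (t i))%MS by have [<- _] := pU _ _ vU; rewrite pi0 mulmx0.
    apply/sub_kermxP; rewrite exprS -mulmxE mulmxA mulmxBr vt mul_mx_scalar subrr.
    by rewrite mul0mx.
  pose D := \sum_i (phi i)%:~R *: p i.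
  have DU i (a : 'rV_n) : (a <= U (t i))%MS -> a *m D = (phi i)%:~R *: a.
    move=> aU; rewrite mulmx_sumr (bigD1 i) //= -scalemxAr (pw i) // eqxx scale1r.
    by rewrite big1 ?addr0 // => j /negPf ji; rewrite -scalemxAr (pw i) // ji scale0r scaler0.
  (* A vector of generalized weight [s] has components only at the indices with [t i = s]. If [s] is
     not an eigenvalue, the vector is 0 and any [c] is allowed. *)
  have Dw (w : 'rV_n) N s c : w *m (A - s%:M) ^+ N = 0 ->
      (forall i, t i = s -> phi i = c) -> w *m D = c%:~R *: w.
    move=> ws pc; have [a aU wE] := decomp w.
    have aE i : a i = w *m p i.
      rewrite wE mulmx_suml (bigD1 i) //= (pw i) // eqxx scale1r big1 ?addr0 // => j ji.
      by rewrite (pw j) // eq_sym (negPf ji) scale0r.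
    rewrite {1}wE mulmx_suml [in RHS]wE scaler_sumr; apply: eq_bigr => i _.
    rewrite (DU i) //; have [/pc -> //|ts] := eqVneq (t i) s.
    suff -> : a i = 0 by rewrite !scaler0.
    apply: (@disjoint_weights _ _ A _ _ n.+1 N _ ts); first exact/sub_kermxP/aU.
    rewrite aE -mulmxA mulmxE; have -> : p i * (A - s%:M) ^+ N = (A - s%:M) ^+ N * p i.
      by apply: commrX; apply: commr_sym.
    by rewrite -mulmxE mulmxA ws mul0mx.
  have dD : derivation br D.
    move=> u v; have [a aU ->] := decomp u; have [b bU ->] := decomp v.
    rewrite !mulmx_suml !(br_suml lie) mulmx_suml -big_split; apply: eq_bigr => i _ /=.
    rewrite !(br_sumr lie) mulmx_suml -big_split; apply: eq_bigr => j _ /=.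
    rewrite (DU i _ (aU i)) (DU j _ (bU j)) (brZl lie) (brZr lie) -scalerDl -rmorphD.
    apply: (Dw _ (n.+1 + n.+1)%N (t i + t j)); last by move=> k tk; rewrite (add_phi _ _ _ (esym tk)).
    by apply: (derivation_weight lie) dA _ _; apply/sub_kermxP; [exact: aU | exact: bU].
  (* On each block [A] is the scalar [t i] plus a nilpotent, and the nilpotent has no trace; the
     block contributes [phi i * t i * d i]. *)
  rewrite -[RHS](trA D dD) mulmx_sumr raddf_sum; apply: eq_bigr => i _ /=.
  rewrite -scalemxAr mxtraceZ; have [pp pA pn] := pE i.
  have -> : A *m p i = t i *: p i + (A - (t i)%:M) *m p i.
    by rewrite mulmxBl mul_scalar_mx addrC subrK.
  rewrite raddfD /= mxtraceZ mxtrace_idempotent // [X in _ + X](@mxtrace_nilpotent _ _ _ n.+1).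
    by rewrite addr0 mulrA mulrzl mulr_natr.
  have {}pn : (A - (t i)%:M) ^+ n.+1 * p i = 0 by [].
  by rewrite mulmxE exprMn_comm // [p i ^+ _]exprS mulrA pn mul0r.
exists n.+1; have : (1%:M <= U 0)%MS.
  by apply: submx_trans sumU _; apply/sumsmx_subP => i _; rewrite t0.
by move=> /sub_kermxP; rewrite mul1mx raddf0 subr0.
Qed.

(** * Engel's theorem for ideals of [br] *)

Section Engel.
Variables (K : fieldType) (n : nat) (br : 'rV[K]_n -> 'rV[K]_n -> 'rV[K]_n).
Hypotheses (char0 : [pchar K] =i pred0) (lie : lie_axioms br).
Local Notation ad := (ad_mx br).
Implicit Types (A M P U V : 'M[K]_n) (u v w x y z : 'rV[K]_n).

Definition stable M U := forall x u, (x <= M)%MS -> (u <= U)%MS -> (br x u <= U)%MS.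

Lemma bracket_span_sub A p (B : 'M[K]_(p, n)) :
  (forall u v, (u <= A)%MS -> (v <= A)%MS -> (br u v <= B)%MS) -> (bracket_span br A <= B)%MS.
Proof.
move=> AB; apply/sumsmx_subP => i _; apply/sumsmx_subP => j _.
by rewrite genmxE AB ?row_sub.
Qed.

Lemma sub_bracket_span A u v : (u <= A)%MS -> (v <= A)%MS -> (br u v <= bracket_span br A)%MS.
Proof.
case/submxP => a ->; case/submxP => b ->; rewrite !mulmx_sum_row.
rewrite (br_suml lie) summx_sub // => i _; rewrite (br_sumr lie) summx_sub // => j _.
rewrite (brZl lie) (brZr lie) !scalemx_sub // /bracket_span.
by rewrite (sumsmx_sup i) // (sumsmx_sup j) // genmxE.
Qed.

Lemma bracket_span_ideal A : is_ideal br A -> is_ideal br (bracket_span br A).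
Proof.
move=> iA x u; case/submxP => c ->; rewrite -(mul_ad_mx lie) -mulmxA.
apply: submx_trans (submxMl _ _) _; rewrite {1}/bracket_span sumsmxMr.
apply/sumsmx_subP => i _; rewrite sumsmxMr; apply/sumsmx_subP => j _.
rewrite (eqmxMr _ (genmxE _)) (mul_ad_mx lie) (br_leibniz lie).
by rewrite addmx_sub // sub_bracket_span ?iA ?row_sub.
Qed.

Lemma derived_ideal A k : is_ideal br A -> is_ideal br (derived br A k) /\ (derived br A k <= A)%MS.
Proof.
move=> iA; elim: k => [//|k [iD DA]]; split; first exact: bracket_span_ideal.
by apply: bracket_span_sub => u v _ vD; apply: iA; apply: submx_trans vD DA.
Qed.

Lemma sub_adds_row M x z : (x <= M + z)%MS ->
  exists2 m, (m <= M)%MS & exists c, x = m + c *: z.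
Proof.
case/sub_addsmxP => [[a b] /= ->]; exists (a *m M); first exact: submxMl.
by exists (b 0 0); rewrite [b in LHS]mx11_scalar mul_scalar_mx.
Qed.

Lemma br_adds_row M z x u : stable M M -> (forall m, (m <= M)%MS -> (br m z <= M)%MS) ->
  (x <= M + z)%MS -> (u <= M + z)%MS -> (br x u <= M)%MS.
Proof.
move=> MM Mz /sub_adds_row [m mM [c ->]] /sub_adds_row [m' mM' [c' ->]].
rewrite !(brDl lie) !(brDr lie) !(brZl lie) !(brZr lie) (br_self lie char0) !scaler0 addr0.
by rewrite !addmx_sub ?MM ?scalemx_sub ?Mz // (br_anti lie) eqmx_opp Mz.
Qed.

Lemma rank_adds_row M z : ~~ (z <= M)%MS -> \rank (M + z)%MS = (\rank M).+1.
Proof.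
move=> zM; apply/eqP; rewrite eqn_leq; apply/andP; split.
  apply: leq_trans (mxrank_adds_leqif _ _) _.
  by rewrite -[X in (_ <= X)%N]addn1 leq_add2l rank_leq_row.
by apply: rank_ltmx; rewrite /ltmx addsmxSl addsmx_sub submx_refl.
Qed.

(* A flag form of Engel's theorem; a hyperplane of [P] with this property is an ideal. *)
Lemma engel_chain P : stable P P -> (forall x, (x <= P)%MS -> exists k, ad x ^+ k = 0) ->
  forall k, (k <= \rank P)%N -> exists M, [/\ (M <= P)%MS, \rank M = k, stable M M &
    forall U V, (U <= V)%MS -> ~~ (V <= U)%MS -> stable M U -> stable M V ->
      exists v, [/\ (v <= V)%MS, ~~ (v <= U)%MS & forall x, (x <= M)%MS -> (br x v <= U)%MS]].
Proof.
move=> PP nilP; elim=> [|k IH] kP.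
  exists 0; split; rewrite ?sub0mx ?mxrank0 //.
    by move=> x u; rewrite submx0 => /eqP ->; rewrite (br0l lie) sub0mx.
  move=> U V _ /row_subPn [i vi] _ _; exists (row i V); rewrite row_sub; split=> // x.
  by rewrite submx0 => /eqP ->; rewrite (br0l lie) sub0mx.
have [M [MP rM MM EM]] := IH (ltnW kP).
have PM : ~~ (P <= M)%MS by apply: contraL kP => /mxrankS; rewrite rM -leqNgt.
have [|z [zP zM Mz]] := EM _ _ MP PM MM.
  by move=> x u xM; apply: PP; apply: submx_trans xM MP.
exists (M + z)%MS; split.
- by rewrite addsmx_sub MP.
- by rewrite rank_adds_row // rM.
- by move=> x u xM uM; apply: submx_trans (addsmxSl M z); apply: br_adds_row uM.
move=> U V UV VU sU sV.
have MM' : (M <= M + z)%MS by apply: addsmxSl.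
have zM' : (z <= M + z)%MS by apply: addsmxSr.
have [||v [vV vU Mv]] := EM U V UV VU.
- by move=> x u xM; apply: sU; apply: submx_trans xM MM'.
- by move=> x u xM; apply: sV; apply: submx_trans xM MM'.
(* Among [v, [z, v], [z, [z, v]], ...] the last one outside [U] is chosen; all of them are sent into
   [U] by [M], since [[M, z]] lies in [M]. *)
have [j zj] := nilP z zP; have {zj} : (v *m ad z ^+ j <= U)%MS by rewrite zj mulmx0 sub0mx.
elim: j v vV vU Mv => [|j IHj] v vV vU Mv; first by rewrite mulmx1 (negPf vU).
rewrite exprS -mulmxE mulmxA (mul_ad_mx lie) => zvj.
have [zvU|zvU] := boolP (br z v <= U)%MS.
  exists v; split=> // x /sub_adds_row [m mM [c ->]].
  by rewrite (brDl lie) (brZl lie) addmx_sub ?Mv ?scalemx_sub.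
apply: (IHj (br z v)) => //; first exact: sV.
move=> x xM; rewrite (br_leibniz lie) addmx_sub //; first by rewrite Mv ?Mz.
by apply: sU => //; apply: Mv.
Qed.

(** For nonzero [P] the chain gives [M] of codimension 1 and [z] with [[M, z]] in [M]; then
    [P = M + z] and all brackets land in [M], against perfectness. *)
Lemma engel P : stable P P -> (forall x, (x <= P)%MS -> exists k, ad x ^+ k = 0) ->
  (P <= bracket_span br P)%MS -> P = 0.
Proof.
move=> PP nilP Pbs; apply/eqP; rewrite -mxrank_eq0 -leqn0 leqNgt; apply/negP => rP.
have [|M [MP rM MM EM]] := engel_chain PP nilP (k := (\rank P).-1); first exact: leq_pred.
have PM : ~~ (P <= M)%MS.
  by apply: contraL rP => /mxrankS; rewrite rM -leqNgt leqn0; case: (\rank P) => //= r; rewrite ltnn.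
have [|z [zP zM Mz]] := EM _ _ MP PM MM.
  by move=> x u xM; apply: PP; apply: submx_trans xM MP.
case/negP: PM; apply: submx_trans Pbs _.
have MzP : (M + z <= P)%MS by rewrite addsmx_sub MP.
have /andP [_ PMz] : (M + z == P)%MS.
  by rewrite -(geq_leqif (mxrank_leqif_eq MzP)) rank_adds_row // rM prednK.
by apply: bracket_span_sub => u v uP vP; apply: (br_adds_row MM Mz); apply: submx_trans PMz.
Qed.

End Engel.

(** * The Killing form and its radical *)

Section Killing.
Variables (K : closedFieldType) (n : nat) (br : 'rV[K]_n -> 'rV[K]_n -> 'rV[K]_n).
Hypotheses (char0 : [pchar K] =i pred0) (lie : lie_axioms br).
Local Notation ad := (ad_mx br).
Implicit Types (u v w x y z : 'rV[K]_n).

Definition killing x y : K := \tr (ad x *m ad y).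

Lemma killingC x y : killing x y = killing y x.
Proof. exact: mxtrace_mulC. Qed.

Lemma killing_br x y z : killing (br x y) z = killing x (br y z).
Proof.
rewrite /killing !(ad_mx_br lie) mulmxBl mulmxBr !raddfB /=.
by rewrite -[ad y *m ad x *m ad z]mulmxA mxtrace_mulC !mulmxA.
Qed.

Lemma killingPr a x y z : killing x (a *: y + z) = a * killing x y + killing x z.
Proof. by rewrite /killing (ad_mxP lie) mulmxDr -scalemxAr raddfD /= mxtraceZ. Qed.

Lemma linear_coord (f : 'rV[K]_n -> K) x :
  (forall a y z, f (a *: y + z) = a * f y + f z) -> f x = (x *m \col_i f (delta_mx 0 i)) 0 0.
Proof.
move=> fP; have f0 : f 0 = 0 by have := fP (-1) 0 0; rewrite scaler0 addr0 mulN1r addNr.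
rewrite {1}(row_sum_delta x) mxE.
have fsum (I : Type) (r : seq I) (a : I -> K) (g : I -> 'rV[K]_n) :
    f (\sum_(i <- r) a i *: g i) = \sum_(i <- r) a i * f (g i).
  by elim/big_rec2: _ => [|i s t _ <-]; rewrite ?f0 ?fP.
by rewrite fsum; apply: eq_bigr => i _; rewrite mxE.
Qed.

Definition killing_mx := \matrix_(i, j) killing (delta_mx 0 i) (delta_mx 0 j).

Lemma killingE x y : killing x y = (x *m killing_mx *m y^T) 0 0.
Proof.
rewrite (linear_coord (f := killing x) y (fun a => killingPr a x)) mxE [RHS]mxE.
apply: eq_bigr => j _; rewrite mxE mulrC [y^T _ _]mxE; congr (_ * _); rewrite killingC.
rewrite (linear_coord (f := killing _) x (fun a => killingPr a _)) !mxE.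
by apply: eq_bigr => i _; rewrite !mxE killingC.
Qed.

(* [tr (ad [a, b] D) = - killing a (D b)] *)
Lemma mxtrace_derivation D a b : derivation br D -> (forall y, killing a y = 0) ->
  \tr (ad (br a b) *m D) = 0.
Proof.
move=> dD a0; have := a0 (b *m D); rewrite /killing (ad_mx_derivation lie _ dD).
rewrite (ad_mx_br lie) mulmxBr mulmxBl !raddfB /= => /eqP; rewrite subr_eq0 => /eqP e.
by rewrite -[ad b *m ad a *m D]mulmxA mxtrace_mulC -!mulmxA e subrr.
Qed.

(** The radical [R] is an ideal whose derived series stabilizes at a perfect ideal [P]. By
    [mxtrace_derivation] the elements of [[P, P] = P] satisfy the trace condition for ad-nilpotency,
    Engel gives [P = 0], and [R] is solvable. *)
Theorem cartan_criterion : semisimple br -> forall x, (forall y, killing x y = 0) -> x = 0.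
Proof.
move=> ss x kx; pose R := kermx killing_mx.
have inR z : (z <= R)%MS -> forall y, killing z y = 0.
  by move=> /sub_kermxP zR y; rewrite killingE zR mul0mx mxE.
have Rin z : (forall y, killing z y = 0) -> (z <= R)%MS.
  move=> z0; apply/sub_kermxP/rowP => j; have := z0 (delta_mx 0 j).
  by rewrite killingE trmx_delta -colE [X in X = _ -> _]mxE => ->; rewrite mxE.
have iR : is_ideal br R.
  move=> y u uR; apply: Rin => z; rewrite (br_anti lie) killingC.
  rewrite -scaleN1r -[_ *: _]addr0 killingPr [killing z 0]killingC (inR 0) ?sub0mx // addr0.
  by rewrite killingC killing_br inR // mulr0.
have [k rk] : exists k, (\rank (derived br R k) <= \rank (derived br R k.+1))%N.
  suff stab N : (exists k, \rank (derived br R k) <= N)%N ->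
      exists k, (\rank (derived br R k) <= \rank (derived br R k.+1))%N.
    by apply: (stab (\rank R)); exists 0%N.
  elim: N => [|N IH] [k kN]; first by exists k; rewrite (leq_trans kN).
  have [le|lt] := leqP (\rank (derived br R k)) (\rank (derived br R k.+1)); first by exists k.
  by apply: IH; exists k.+1; rewrite -ltnS (leq_trans lt).
have [iP PR] := derived_ideal lie k iR; set P := derived br R k in rk iP PR.
have bsP : (bracket_span br P <= P)%MS by apply: bracket_span_sub => u v _ /iP.
have {rk} Pbs : (P <= bracket_span br P)%MS.
  by have /andP [] : (bracket_span br P == P)%MS by rewrite -(geq_leqif (mxrank_leqif_eq bsP)).
have nilP u : (u <= P)%MS -> exists l, ad u ^+ l = 0.
  move=> uP; apply: (nilpotent_of_trace char0 lie) => D dD.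
  pose c : 'cV[K]_n := \col_i \tr (ad (delta_mx 0 i) *m D).
  have trc v : v *m c = (\tr (ad v *m D))%:M.
    rewrite [LHS]mx11_scalar -(linear_coord (f := fun w => \tr (ad w *m D))) // => a y z.
    by rewrite (ad_mxP lie) mulmxDl -scalemxAl raddfD /= mxtraceZ.
  have : (u <= kermx c)%MS.
    apply: submx_trans uP (submx_trans Pbs _); apply: bracket_span_sub => a b aP _.
    apply/sub_kermxP; rewrite trc mxtrace_derivation ?raddf0 //.
    by apply: inR; apply: submx_trans aP PR.
  by move=> /sub_kermxP; rewrite trc => /(congr1 (fun M : 'M_1 => M 0 0)); rewrite !mxE.
have P0 : P = 0 by apply: (engel char0 lie) Pbs => // u v _ /iP.
have R0 : \rank R = 0%N by apply: ss => //; exists k; rewrite -/P P0 mxrank0.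
by have := Rin x kx; move/eqP: R0; rewrite mxrank_eq0 => /eqP ->; rewrite submx0 => /eqP.
Qed.

End Killing.

(** * Even triples *)

(** Cauchy product of two truncated series; [M + M] terms capture every nonzero [C i j]. *)
Lemma sum_antidiagonals (V : nmodType) M (C : nat -> nat -> V) :
  (forall i j, (M <= i)%N || (M <= j)%N -> C i j = 0) ->
  \sum_(k < M + M) \sum_(i < k.+1) C i (k - i)%N = \sum_(i < M) \sum_(j < M) C i j.
Proof.
move=> C0; pose c i k := if (i <= k)%N then C i (k - i)%N else 0.
transitivity (\sum_(0 <= k < M + M) \sum_(0 <= i < M + M) c i k).
  rewrite big_mkord; apply: eq_bigr => k _.
  rewrite -(big_mkord xpredT (fun i => C i (k - i)%N)) (@big_cat_nat _ _ _ k.+1 0 (M + M)) //=.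
  rewrite [X in _ = _ + X]big_nat_cond [X in _ = _ + X]big1 ?addr0 => [|i]; last first.
    by rewrite andbT /c => /andP [ki _]; rewrite leqNgt ki.
  by apply: eq_big_nat => i /andP [_ ik]; rewrite /c -ltnS ik.
rewrite exchange_big_nat /= (@big_cat_nat _ _ _ M) ?leq_addr //=.
rewrite [X in _ + X]big_nat_cond [X in _ + X]big1 ?addr0 => [|i]; last first.
  rewrite andbT => /andP [Mi _]; apply: big1 => k _; rewrite /c.
  by case: ifP => // _; rewrite C0 // Mi.
rewrite big_mkord; apply: eq_bigr => i _.
have iM : (i <= M + M)%N by rewrite (leq_trans (ltnW (ltn_ord i))) // leq_addr.
rewrite (@big_cat_nat _ _ _ i) //= big_nat_cond big1 ?add0r => [|k]; last first.
  by rewrite andbT /c => /andP [_ ki]; rewrite leqNgt ki.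
rewrite -{1}[val i]add0n big_addn (@big_cat_nat _ _ _ M) //=; last by have := ltn_ord i; lia.
rewrite [X in _ + X]big_nat_cond [X in _ + X]big1 ?addr0 => [|k]; last first.
  rewrite andbT => /andP [Mk _]; rewrite /c leq_addl addnK C0 // Mk orbT //.
by rewrite big_mkord; apply: eq_bigr => j _; rewrite /c leq_addl addnK.
Qed.

(** * Exponentials of nilpotent derivations are automorphisms *)

Section ExpDerivation.
Variables (K : fieldType) (n : nat) (br : 'rV[K]_n -> 'rV[K]_n -> 'rV[K]_n).
Hypotheses (char0 : [pchar K] =i pred0) (lie : lie_axioms br).
Variables (D : 'M[K]_n) (M : nat).
Hypotheses (dD : derivation br D) (DM : D ^+ M = 0).
Implicit Types u v : 'rV[K]_n.

(** Divided powers turn the iterated Leibniz rule into an antidiagonal sum free of binomial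
    coefficients. *)
Definition divpow k : 'M[K]_n := (k`!%:R)^-1 *: D ^+ k.
Definition mxexp s : 'M[K]_n := \sum_(k < M) s ^+ k *: divpow k.

Lemma divpow0 : divpow 0 = 1.
Proof. by rewrite /divpow invr1 scale1r. Qed.

Lemma divpowS k : k.+1%:R *: divpow k.+1 = divpow k *m D.
Proof.
rewrite /divpow scalerA factS natrM invfM mulrA divff ?natrS0 // mul1r.
by rewrite -scalemxAl mulmxE -exprSr.
Qed.

Lemma divpow_eq0 k : (M <= k)%N -> divpow k = 0.
Proof. by move=> Mk; rewrite /divpow -(subnKC Mk) exprD DM mul0r scaler0. Qed.

Lemma divpow_leibniz u v k :
  br u v *m divpow k = \sum_(i < k.+1) br (u *m divpow i) (v *m divpow (k - i)).
Proof.
elim: k => [|k IH]; first by rewrite big_ord1 divpow0 !mulmx1.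
pose B i j := br (u *m divpow i) (v *m divpow j).
apply: (scalerI (natrS0 char0 k)); rewrite [LHS]scalemxAr divpowS mulmxA IH mulmx_suml.
transitivity (\sum_(i < k.+1) i.+1%:R *: B i.+1 (k - i)%N +
              \sum_(i < k.+1) (k - i).+1%:R *: B i (k - i).+1).
  rewrite -big_split; apply: eq_bigr => i _ /=; rewrite dD /B.
  by rewrite -(brZl lie) -(brZr lie) !scalemxAr !divpowS !mulmxA.
have -> : \sum_(i < k.+1) i.+1%:R *: B i.+1 (k - i)%N =
    \sum_(i < k.+2) (i : nat)%:R *: B i (k.+1 - i)%N.
  by rewrite [RHS]big_ord_recl scale0r add0r.
have -> : \sum_(i < k.+1) (k - i).+1%:R *: B i (k - i).+1 =
    \sum_(i < k.+2) (k.+1 - i)%:R *: B i (k.+1 - i)%N.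
  rewrite [RHS]big_ord_recr /= subnn scale0r addr0; apply: eq_bigr => i _.
  by rewrite subSn // -ltnS.
rewrite -big_split scaler_sumr; apply: eq_bigr => i _ /=.
by rewrite -scalerDl -natrD subnKC // -ltnS.
Qed.

Lemma mxexp_br s u v : br (u *m mxexp s) (v *m mxexp s) = br u v *m mxexp s.
Proof.
have sc w k : w *m (s ^+ k *: divpow k) = s ^+ k *: (w *m divpow k) by rewrite -scalemxAr.
pose C i j := s ^+ (i + j) *: br (u *m divpow i) (v *m divpow j).
transitivity (\sum_(i < M) \sum_(j < M) C i j).
  rewrite !mulmx_sumr (br_suml lie); apply: eq_bigr => i _.
  rewrite (br_sumr lie); apply: eq_bigr => j _.
  by rewrite !sc (brZl lie) (brZr lie) scalerA -exprD.
rewrite -sum_antidiagonals => [|i j /orP [] le]; last 2 first.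
- by rewrite /C divpow_eq0 // mulmx0 (br0l lie) scaler0.
- by rewrite /C [divpow j]divpow_eq0 // mulmx0 (br0r lie) scaler0.
have -> : mxexp s = \sum_(k < M + M) s ^+ k *: divpow k.
  rewrite big_split_ord /= [X in _ + X]big1 ?addr0 // => k _.
  by rewrite divpow_eq0 ?leq_addr // scaler0.
rewrite mulmx_sumr; apply: eq_bigr => k _; rewrite sc divpow_leibniz scaler_sumr.
by apply: eq_bigr => i _; rewrite /C subnKC // -ltnS.
Qed.

Lemma mxexp_free s : (0 < M)%N -> row_free (mxexp s).
Proof.
move=> M0; rewrite -kermx_eq0 -submx0; apply/rV_subP => v /sub_kermxP vS.
suff gen i : (i <= M)%N -> v *m D ^+ (M - i) = 0.
  by have := gen M (leqnn M); rewrite subnn mulmx1 => ->; rewrite sub0mx.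
elim: i => [|i IH] iM; first by rewrite subn0 DM mulmx0.
have {IH} := IH (ltnW iM); rewrite -subnSK //; set j := (M - i.+1)%N => vj.
have : v *m mxexp s *m D ^+ j = 0 by rewrite vS mul0mx.
rewrite /mxexp mulmx_sumr mulmx_suml (bigD1 (Ordinal M0)) //= divpow0 scale1r mulmx1.
rewrite big1 ?addr0 // => k; rewrite -val_eqE /= -lt0n => k0.
rewrite /divpow -!scalemxAr -!scalemxAl -mulmxA mulmxE -exprD.
have -> : (k + j = j.+1 + k.-1)%N by lia.
by rewrite exprD -mulmxE mulmxA vj mul0mx !scaler0.
Qed.

End ExpDerivation.

Lemma ad_nilpotentP (K : fieldType) n (br : 'rV[K]_n -> 'rV[K]_n -> 'rV[K]_n) x :
  lie_axioms br -> ad_nilpotent br x -> exists k, ad_mx br x ^+ k = 0.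
Proof.
move=> lie [k xk]; exists k; apply/row_matrixP => i; rewrite row0 rowE -(xk (delta_mx 0 i)).
elim: (k) => [|j IH]; first by rewrite mulmx1.
by rewrite exprSr -mulmxE mulmxA IH (mul_ad_mx lie).
Qed.

Section EvenTriple.
Variables (K : fieldType) (n : nat) (br : 'rV[K]_n -> 'rV[K]_n -> 'rV[K]_n).
Hypotheses (char0 : [pchar K] =i pred0) (lie : lie_axioms br).
Variables e h f : 'rV[K]_n.
Hypotheses (triple : sl2_triple br e h f) (even_h : even_triple br h).
Local Notation ad := (ad_mx br).
Local Notation E := (ad e).
Local Notation F := (ad f).
Local Notation H := (ad h).
Variable M : nat.
Hypotheses (M_gt1 : (1 < M)%N) (EM : E ^+ M = 0).
Implicit Types u v w x y z : 'rV[K]_n.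

Lemma triple_FE : F *m E - E *m F = H.
Proof. by have [_ _ <-] := triple; rewrite (ad_mx_br lie). Qed.
Lemma triple_EH : E *m H - H *m E = 2%:R *: E.
Proof. by have [he _ _] := triple; rewrite -(ad_mx_br lie) he (ad_mxZ lie). Qed.
Lemma triple_FH : F *m H - H *m F = - (2%:R *: F).
Proof. by have [_ hf _] := triple; rewrite -(ad_mx_br lie) hf (ad_mxN lie) (ad_mxZ lie). Qed.

Let wt j : 'M[K]_n := wt_space E H (j.*2)%:R.

Lemma ker_e_weights : (kermx E <= \sum_(j < M) wt j)%MS.
Proof.
apply: submx_trans (kerX_decomposition char0 triple_FE triple_EH EM) _.
apply/sumsmx_subP => i _; have := odd_double_half i.
case: odd => [oi|ei]; last first.
  have iM : (i./2 < M)%N by apply: leq_ltn_trans (ltn_ord i); rewrite -{2}ei -addnn leq_addl.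
  by rewrite (sumsmx_sup (Ordinal iM)) // /wt /= -{1}ei.
apply/rV_subP => v /wt_spaceP [_ vH]; have [->|v0] := eqVneq v 0; first exact: sub0mx.
have [|k ik] := even_h (a := i%:R) v0; first by rewrite -(mul_ad_mx lie).
have : (i%:Z - 2 * k)%:~R = 0 :> K by rewrite rmorphB /= -ik subrr.
have i0 : i%:Z - 2 * k != 0 by lia.
move: (i%:Z - 2 * k) i0 => [] [|l] // _ /eqP; first by rewrite (negPf (natrS0 char0 l)).
  by rewrite NegzE rmorphN /= oppr_eq0 (negPf (natrS0 char0 0)).
by rewrite NegzE rmorphN /= oppr_eq0 (negPf (natrS0 char0 l.+1)).
Qed.

Lemma ker_e_decomposition v : v *m E = 0 ->
  exists2 a : 'I_M -> 'rV[K]_n, forall j, (a j <= wt j)%MS & v = \sum_j a j.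
Proof.
move=> vE; have vk : (v <= kermx E)%MS by apply/sub_kermxP.
have /sub_sumsmxP [c ->] := submx_trans vk ker_e_weights.
by exists (fun j => c j *m wt j) => // j; apply: submxMl.
Qed.

Let dbl_neq (i j : 'I_M) : i != j -> (i.*2)%:R - (j.*2)%:R != 0 :> K.
Proof.
move=> ij; rewrite subr_eq0; apply: contra ij => /eqP/(natr_inj char0)/double_inj ij.
exact/eqP/val_inj.
Qed.

(* The Lagrange polynomial in [ad h] projecting [g_e] to its weight space of weight [2 j]. *)
Definition weight_proj (j : 'I_M) : 'M[K]_n :=
  \prod_(l < M | l != j) (((j.*2)%:R - (l.*2)%:R)^-1 *: (H - (l.*2)%:R%:M)).

Lemma weight_projP (i j : 'I_M) v : (v <= wt i)%MS -> v *m weight_proj j = (i == j)%:R *: v.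
Proof.
case/wt_spaceP => _ vH.
have -> : v *m weight_proj j =
    (\prod_(l < M | l != j) (((j.*2)%:R - (l.*2)%:R)^-1 * ((i.*2)%:R - (l.*2)%:R))) *: v.
  rewrite /weight_proj; elim/big_rec2: _ => [|l a A _ IH]; first by rewrite mulmx1 scale1r.
  rewrite -mulmxE mulmxA -scalemxAr mulmxBr vH mul_mx_scalar -scalerBl scalerA.
  by rewrite -scalemxAl IH scalerA.
congr (_ *: _); have [ij|ij] := eqVneq i j.
  by apply: big1 => l lj; rewrite ij mulVf // dbl_neq // eq_sym.
by rewrite (bigD1 i) //= subrr mulr0 mul0r.
Qed.

(** Written as a polynomial in [ad h] and [ad f] on the whole algebra, so that it commutes with
    whatever commutes with both, in particular with [ad z] for [z] in [g_e(0)]. *)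
Definition even_shift : 'M[K]_n := \sum_(j < M) weight_proj j *m F ^+ j.

Lemma even_shift_weight (j : 'I_M) v : (v <= wt j)%MS -> v *m even_shift = v *m F ^+ j.
Proof.
move=> vj; rewrite /even_shift mulmx_sumr (bigD1 j) //= mulmxA (weight_projP _ vj) eqxx scale1r.
by rewrite big1 ?addr0 // => i ij; rewrite mulmxA (weight_projP _ vj) eq_sym (negPf ij) scale0r mul0mx.
Qed.

Lemma even_shift_comm A : GRing.comm A H -> GRing.comm A F -> GRing.comm A even_shift.
Proof.
move=> AH AF; apply: commr_sum => j _; apply: commrM; last exact: commrX.
apply: commr_prod => l _; rewrite /GRing.comm -!mulmxE -scalemxAr -scalemxAl; congr (_ *: _).
by apply: commrB => //; rewrite /GRing.comm -!mulmxE scalar_mxC.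
Qed.

Lemma weight_F j v : (v <= wt j)%MS -> v *m F ^+ j *m H = 0.
Proof.
case/wt_spaceP => _ vH; rewrite (mulY_weight triple_FH j vH) -mul2n natrM subrr scale0r //.
Qed.

(** This is [(2 j)!], the scalar by which lowering and then raising [j] times acts on a highest
    weight vector of weight [2 j]. *)
Definition raise_coef j : K := j`!%:R * \prod_(a <- nats K j) ((j.*2)%:R - a).

Lemma raise_coef_neq0 j : raise_coef j != 0.
Proof.
rewrite mulf_neq0 ?fact_neq0 // prodf_seq_neq0; apply/allP => a /mapP [i].
rewrite mem_rev mem_iota => /andP [_ ij] ->; rewrite subr_eq0.
by apply/eqP => /(natr_inj char0) e2; lia.
Qed.

Lemma raise_lower (j : 'I_M) v : (v <= wt j)%MS -> v *m F ^+ j *m E ^+ j = raise_coef j *: v.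
Proof. by case/wt_spaceP => vE vH; rewrite (mulYX_weight triple_FE triple_EH _ vE vH). Qed.

Lemma raise_lower_gt (j : 'I_M) k v : (v <= wt j)%MS -> (j < k)%N -> v *m F ^+ j *m E ^+ k = 0.
Proof.
case/wt_spaceP => vE vH jk; rewrite -(subnKC jk) exprD -mulmxE mulmxA.
by rewrite (mulYXS triple_FE triple_EH _ vE vH) mul0mx.
Qed.

Lemma even_shift_in v : v *m E = 0 -> v *m even_shift *m H = 0.
Proof.
move=> /ker_e_decomposition [a aj ->]; rewrite !mulmx_suml big1 // => j _.
by rewrite (even_shift_weight (aj j)) (weight_F (aj j)).
Qed.

Lemma even_shift_inj v : v *m E = 0 -> v *m even_shift = 0 -> v = 0.
Proof.
move=> /ker_e_decomposition [a aj ->]; rewrite mulmx_suml => s0.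
apply: big1 => j _; have {}s0 : \sum_i a i *m F ^+ i = 0.
  by rewrite -[RHS]s0; apply: eq_bigr => i _; rewrite (even_shift_weight (aj i)).
(* Triangularity, from the top index down: [E ^+ i] kills the terms of index below [i] and
   multiplies the [i]-th by [raise_coef i]. *)
suff gen m (i : 'I_M) : (M - m <= i)%N -> a i = 0 by apply: (gen M); rewrite subnn.
elim: m i => [|m IH] i; first by rewrite subn0 leqNgt ltn_ord.
rewrite leq_eqVlt => /orP [/eqP mi|mi]; last first.
  by apply: IH; move: mi; have := ltn_ord i; lia.
have := congr1 (mulmx^~ (E ^+ i)) s0; rewrite mul0mx mulmx_suml (bigD1 i) //= (raise_lower (aj i)).
rewrite big1 ?addr0 => [/eqP|l li].
  by rewrite scaler_eq0 (negPf (raise_coef_neq0 _)) => /eqP.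
have [il|il] := leqP l i; first by rewrite (raise_lower_gt (aj l)) // ltn_neqAle il andbT.
by rewrite (IH l) ?mul0mx //; move: il mi; have := ltn_ord l; lia.
Qed.

Section Deform.
Variable t : K.
Hypothesis t0 : t != 0.
(** Since [[e, h] = - 2 e], the automorphism [exp (s ad e)] sends [h] to [h - 2 s e]; this [s] makes
    [t h] go to [e + t h]. *)
Let s : K := - (2%:R * t)^-1.
Let S := mxexp E M s.

Lemma deform_br u v : br (u *m S) (v *m S) = br u v *m S.
Proof. exact: (mxexp_br char0 lie (ad_derivation lie e) EM). Qed.

Lemma deform_free : row_free S.
Proof. by apply: mxexp_free EM _ _; apply: ltnW. Qed.

Lemma deform_h : t *: (h *m S) = e + t *: h.
Proof.
have [he _ _] := triple.
have hE : h *m E = - (2%:R *: e) by rewrite (mul_ad_mx lie) (br_anti lie) he.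
have hEk k : h *m E ^+ k.+2 = 0.
  by rewrite exprS -mulmxE mulmxA hE exprS -mulmxE mulmxA mulNmx -scalemxAl (mul_ad_mx lie)
    (br_self lie char0) scaler0 oppr0 mul0mx.
have hS : h *m S = h + s *: (h *m E).
  rewrite /S /mxexp -[in LHS](subnKC M_gt1) big_ord_recl big_ord_recl /= mulmxDr divpow0 scale1r.
  rewrite mulmx1; congr (_ + _); rewrite mulmxDr mulmx_sumr big1 ?addr0 => [|k _]; last first.
    by rewrite /divpow -!scalemxAr hEk !scaler0.
  by rewrite /divpow /= /bump /= invr1 scale1r -scalemxAr.
rewrite hS hE scalerDr addrC scalerN scalerA scalerN scalerA -scaleNr; congr (_ + _).
by rewrite -[RHS]scale1r; congr (_ *: _); rewrite /s; field; rewrite t0 (natrS0 char0 1).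
Qed.

End Deform.

(** For [t != 0] the centralizer of [e + t h] is a conjugate of that of [h], and centralizers can
    only grow in the limit [t = 0]. *)
Lemma rank_ker_h : (\rank (kermx H) <= \rank (kermx E))%N.
Proof.
pose A : 'M[{poly K}]_n := map_mx polyC E + 'X *: map_mx polyC H.
have AE t : at_point t A = E + t *: H.
  by apply/matrixP => i j; rewrite !mxE /horner_eval !hornerE.
have [t t0] := rank_specialize char0 A; rewrite !AE scale0r addr0 => rk.
rewrite !mxrank_ker leq_sub2l //; apply: leq_trans rk _.
suff : (\rank (kermx H) <= \rank (kermx (E + t *: H)%R))%N.
  rewrite !mxrank_ker; have := rank_leq_row H; have := rank_leq_row (E + t *: H)%R; lia.
rewrite -(mxrankMfree _ (deform_free t)); apply/mxrankS/rV_subP => w /submxP [c ->].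
apply/sub_kermxP; set u := c *m kermx H; have uH : br h u = 0.
  by rewrite -(mul_ad_mx lie) -mulmxA mulmx_ker mulmx0.
rewrite mulmxA -/u -(ad_mxZ lie) -(ad_mxD lie) -(deform_h t0) (mul_ad_mx lie) (brZl lie).
by rewrite deform_br uH mul0mx scaler0.
Qed.

(** [z] is the value at [t = 0] of a polynomial family [w t], where for [t != 0] the pair [e + t h],
    [w t] is conjugate to [t h], [y] with [y] in [g(0)]. Common centralizers can only grow at
    [t = 0]. *)
Lemma deform_centralizer z r : z *m E = 0 ->
  (forall y, y *m H = 0 -> (r <= \rank (kermx H :&: kermx (ad y))%MS)%N) ->
  (r <= \rank (kermx E :&: kermx (ad z))%MS)%N.
Proof.
move=> /ker_e_decomposition [a aj zE] ry.
(* With [y = sum b_j t^j (a_j F^j)], the factor [s^k = (-1/2)^k t^(-k)] of the exponential leaves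
   [t^(j-k)], and terms with [k > j] vanish: [w] is polynomial in [t]. At [t = 0] only [k = j]
   remains, and [b j] normalizes that term to [a j]. *)
pose b j : K := ((- 2%:R^-1) ^+ j / j`!%:R * raise_coef j)^-1.
pose c (j k : nat) : K := b j * ((- 2%:R^-1) ^+ k / k`!%:R).
pose v (j : 'I_M) (k : nat) := c j k *: (a j *m F ^+ j *m E ^+ k).
pose w t := \sum_(j < M) \sum_(k < M | (k <= j)%N) t ^+ (j - k) *: v j k.
pose A2 : 'M[{poly K}]_n :=
  \sum_(j < M) \sum_(k < M | (k <= j)%N) 'X^(j - k) *: map_mx polyC (ad (v j k)).
(* The left kernel of [A] at [t] is the common centralizer of [e + t h] and [w t]. *)
pose A := row_mx (map_mx polyC E + 'X *: map_mx polyC H) A2.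
have ad_sum (I : finType) (P : pred I) (g : I -> 'rV[K]_n) :
    ad (\sum_(i | P i) g i) = \sum_(i | P i) ad (g i).
  apply: (big_morph _ (ad_mxD lie)); by have := ad_mxZ lie 0 0; rewrite !scale0r.
have AE t : at_point t A = row_mx (ad (e + t *: h)) (ad (w t)).
  rewrite /at_point /A map_row_mx; congr row_mx.
    rewrite (ad_mxD lie) (ad_mxZ lie).
    by apply/matrixP => i j; rewrite !mxE /horner_eval !hornerE.
  rewrite /A2 /w raddf_sum ad_sum; apply: eq_bigr => j _ /=.
  rewrite raddf_sum ad_sum; apply: eq_bigr => k _ /=.
  rewrite (ad_mxZ lie); apply/matrixP => i l.
  by rewrite 3!mxE [in RHS]mxE /horner_eval hornerM hornerXn hornerC.
have w0 : w 0 = z.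
  rewrite /w zE; apply: eq_bigr => j _; rewrite (bigD1 j) //= subnn scale1r big1 ?addr0.
    rewrite /v (raise_lower (aj j)) scalerA /c /b -mulrA mulVf ?scale1r //.
    rewrite mulf_neq0 ?raise_coef_neq0 // mulf_neq0 ?invr_eq0 ?fact_neq0 //.
    by rewrite expf_neq0 // oppr_eq0 invr_eq0 natrS0.
  move=> k /andP [kj kj']; rewrite expr0n subn_eq0 leqNgt ltn_neqAle kj kj' scale0r //.
have [t t0] := rank_specialize char0 A; rewrite !AE scale0r addr0 w0 => rk.
have ker_row u (B C : 'M[K]_n) : (u <= kermx (row_mx B C))%MS = (u <= kermx B :&: kermx C)%MS.
  rewrite sub_capmx; apply/sub_kermxP/andP => [|[/sub_kermxP uB /sub_kermxP uC]].
    by rewrite mul_mx_row -row_mx0 => /eq_row_mx [uB uC]; split; apply/sub_kermxP.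
  by rewrite mul_mx_row uB uC row_mx0.
have ker_rank (B C : 'M[K]_n) : \rank (kermx (row_mx B C)) = \rank (kermx B :&: kermx C)%MS.
  apply/eqP; rewrite eqn_leq; apply/andP; split; apply/mxrankS/rV_subP => u; by rewrite ker_row.
rewrite -ker_rank mxrank_ker; apply: leq_trans _ (leq_sub2l _ rk).
rewrite -mxrank_ker.
pose s : K := - (2%:R * t)^-1; pose y := \sum_(j < M) (b j * t ^+ j) *: (a j *m F ^+ j).
have yH : y *m H = 0.
  by rewrite mulmx_suml big1 // => j _; rewrite -scalemxAl (weight_F (aj j)) scaler0.
have yS : y *m mxexp E M s = w t.
  rewrite mulmx_suml; apply: eq_bigr => j _.
  rewrite /mxexp mulmx_sumr (bigID (fun k : 'I_M => (k <= j)%N)) /=.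
  rewrite [X in _ + X]big1 ?addr0 => [|k]; last first.
    by rewrite -ltnNge => jk; rewrite /divpow -!scalemxAr -!scalemxAl (raise_lower_gt (aj j)) // !scaler0.
  apply: eq_bigr => k kj; rewrite /divpow -!scalemxAr -!scalemxAl /v !scalerA; congr (_ *: _).
  have tj : t ^+ j = t ^+ (j - k) * t ^+ k by rewrite -exprD subnK.
  have ts : t ^+ k * (- (2%:R * t)^-1) ^+ k = (- 2%:R^-1) ^+ k.
    by rewrite -exprMn; congr (_ ^+ _); field; rewrite t0 natrS0.
  by rewrite /c tj -ts -/s; ring.
apply: leq_trans (ry y yH) _; rewrite -(mxrankMfree _ (deform_free t)).
apply/mxrankS/rV_subP => _ /submxP [d ->]; rewrite mulmxA; set u := d *m _.
have : (u <= kermx H :&: kermx (ad y))%MS by apply: submxMl.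
rewrite sub_capmx => /andP [/sub_kermxP uH /sub_kermxP uy].
rewrite ker_row sub_capmx; apply/andP; split; apply/sub_kermxP.
  rewrite -(deform_h t0) (mul_ad_mx lie) (brZl lie) deform_br -(mul_ad_mx lie) uH.
  by rewrite mul0mx scaler0.
by rewrite -yS (mul_ad_mx lie) deform_br -(mul_ad_mx lie) uy mul0mx.
Qed.

End EvenTriple.

(** * The centralizer [g_e(0)] of the triple and its Killing form *)

Section CentralizerOfTriple.
Variables (K : closedFieldType) (n : nat) (br : 'rV[K]_n -> 'rV[K]_n -> 'rV[K]_n).
Hypotheses (char0 : [pchar K] =i pred0) (lie : lie_axioms br) (ss : semisimple br).
Variables e h f : 'rV[K]_n.
Hypotheses (triple : sl2_triple br e h f) (even_h : even_triple br h).
Local Notation ad := (ad_mx br).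
Variable M : nat.
Hypotheses (M_gt1 : (1 < M)%N) (EM : ad e ^+ M = 0) (FM : ad f ^+ M = 0).
Implicit Types u v w x y z : 'rV[K]_n.
Local Notation killing := (killing br).
Let k : 'M[K]_n := (centralizer br e :&: grade br h 0)%MS.

Lemma triple_centralizerP z : reflect (br e z = 0 /\ br h z = 0) (z <= k)%MS.
Proof.
rewrite /k /centralizer /grade mulr0z raddf0 subr0 sub_capmx -!(mul_ad_mx lie).
by apply: (iffP andP) => -[/sub_kermxP ? /sub_kermxP ?].
Qed.

(** [[f, z]] would be killed by [ad e] and have weight [-2]. *)
Lemma br_f_eq0 z : (z <= k)%MS -> br f z = 0.
Proof.
case/triple_centralizerP => ez hz; apply/eqP; apply: contraT => v0.
have FE := triple_FE lie triple; have FH := triple_FH lie triple.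
have [|||i] := @kerX_weight K n M _ _ _ char0 FE (triple_EH lie triple) EM (br f z) (- 2%:R).
- rewrite -[br f z](mul_ad_mx lie) -mulmxA; have -> : ad f *m ad e = ad e *m ad f + ad h.
    by rewrite -FE addrC subrK.
  by rewrite mulmxDr mulmxA !(mul_ad_mx lie) ez hz (br0r lie) addr0.
- rewrite -[br f z](mul_ad_mx lie) -mulmxA; have -> : ad f *m ad h = ad h *m ad f - 2%:R *: ad f.
    by rewrite -FH addrC subrK.
  by rewrite mulmxBr mulmxA -scalemxAr !(mul_ad_mx lie) hz (br0r lie) sub0r scaleNr.
- by [].
move/eqP; rewrite eq_sym -subr_eq0 opprK -natrD addn2 (negPf (natrS0 char0 _)) //.
Qed.

Lemma triple_centralizer_br y z : (y <= k)%MS -> (z <= k)%MS -> (br y z <= k)%MS.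
Proof.
case/triple_centralizerP => ey hy /triple_centralizerP [ez hz]; apply/triple_centralizerP.
rewrite (br_leibniz lie e) (br_leibniz lie h) ey hy ez hz (br0l lie) (br0r lie) addr0 //.
Qed.

Let killing_sumr z (I : finType) (g : I -> 'rV[K]_n) :
  killing z (\sum_i g i) = \sum_i killing z (g i).
Proof.
apply: (big_morph (killing z)) => [u v|]; first by rewrite -[u]scale1r killingPr // mul1r scale1r.
by have := killingPr lie (-1) z 0 0; rewrite scaler0 addr0 mulN1r addNr.
Qed.

Let killingZr z a u : killing z (a *: u) = a * killing z u.
Proof.
have k0 : killing z 0 = 0 by have := killingPr lie (-1) z 0 0; rewrite scaler0 addr0 mulN1r addNr.
by rewrite -[a *: u]addr0 killingPr // k0 addr0.
Qed.

(** Orthogonality to [k] extends to all of [g = ker (ad e) + im (ad f)]: the image of [ad f] is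
    orthogonal to [z] because [[f, z] = 0], positive weights because [[h, z] = 0], and the weight 0
    part of [ker (ad e)] is [k]. *)
Lemma killing_nondegenerate z : (z <= k)%MS -> (forall u, (u <= k)%MS -> killing z u = 0) -> z = 0.
Proof.
move=> zk orth; apply: (cartan_criterion char0 lie ss) => y.
have [ez hz] := triple_centralizerP _ zk; have fz := br_f_eq0 zk.
have split1 := sl2_split char0 (triple_FE lie triple) (triple_EH lie triple) (triple_FH lie triple) EM FM.
have /sub_addsmxP [[a b] /= ->] := submx_trans (submx1 y) split1.
have aE : a *m kermx (ad e) *m ad e = 0 by rewrite -mulmxA mulmx_ker mulmx0.
have [c cw ->] := ker_e_decomposition char0 lie triple even_h M_gt1 EM aE.
rewrite -[\sum_i _]scale1r killingPr // mul1r killing_sumr.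
have -> : killing z (b *m ad f) = 0.
  rewrite (mul_ad_mx lie) -(killing_br lie) (br_anti lie) fz oppr0.
  by rewrite killingC -[0](scale0r b) killingZr mul0r.
rewrite addr0 big1 // => j _; have /wt_spaceP [cE cH] := cw j.
have [j0|j0] := posnP j.
  apply: orth; apply/triple_centralizerP; rewrite -!(mul_ad_mx lie) cE cH.
  by rewrite j0 scale0r.
apply: (mulfI (x := (j.*2)%:R)); first by rewrite (natr0 char0) double_eq0 -lt0n.
rewrite mulr0 -killingZr -cH (mul_ad_mx lie) -(killing_br lie) (br_anti lie) hz oppr0.
by rewrite killingC -[0](scale0r b) killingZr mul0r.
Qed.

(* The map [(ad x)^2] is self-adjoint on [k], so its image is the orthogonal of its kernel. *)
Lemma exists_opposite x : (x <= k)%MS -> ad_nilpotent br x ->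
  exists y, (y <= k)%MS /\ br (br x y) x = 2%:R *: x.
Proof.
move=> xk /(ad_nilpotentP lie) [N xN]; pose W := k *m ad x *m ad x.
have killingBr z u : killing (br x z) u = - killing z (br x u).
  by rewrite (br_anti lie) killingC -scaleN1r killingZr mulN1r killingC killing_br.
suff /submxP [c xc] : (x <= W)%MS.
  pose y := c *m k; have xy : br x (br x y) = x.
    by rewrite -!(mul_ad_mx lie) {3}xc /W !mulmxA.
  (* From [[x, [x, y]] = x] the factor [-2] yields [[[x, -2 y], x] = 2 x]. *)
  exists (- 2%:R *: y); split; first by rewrite scalemx_sub // submxMl.
  by rewrite (br_anti lie) (brZr lie) (brZr lie) xy scaleNr opprK.
suff : x *m cokermx W = 0 by rewrite submxE => ->.
apply/matrixP => i j; rewrite ord1 [RHS]mxE; pose c := col j (cokermx W).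
have -> : (x *m cokermx W) 0 j = (x *m c) 0 0.
  by rewrite [LHS]mxE [RHS]mxE; apply: eq_bigr => l _; rewrite [c _ _]mxE.
have Wc : W *m c = 0 by rewrite /c colE mulmxA mulmx_coker mul0mx.
have [B fB eB] : exists2 B : 'M[K]_(\rank k, n), row_free B & (B :=: k)%MS.
  by exists (row_base k); [apply: row_base_free | apply: eq_row_base].
pose G := B *m killing_mx br *m B^T.
have Bk : (B <= k)%MS by rewrite eB.
have unitG : G \in unitmx.
  rewrite -row_free_unit -kermx_eq0 -submx0; apply/rV_subP => d /sub_kermxP dG.
  have dB : d *m B = 0.
    apply: killing_nondegenerate; first exact: submx_trans (submxMl _ _) Bk.
    move=> u uk; have /submxP [a ->] : (u <= B)%MS by rewrite eB.
    rewrite (killingE lie) trmx_mul !mulmxA -[X in (X *m a^T) 0 0]mulmxA.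
    by move: dG; rewrite /G !mulmxA => ->; rewrite mul0mx mxE.
  by rewrite submx0; apply/eqP/(row_free_inj fB); rewrite dB mul0mx.
(* [b] represents on [k], through the Killing form, the functional [c] that vanishes on [W]; [G] is
   the Gram matrix of a basis of [k]. *)
pose b := (invmx G *m (B *m c))^T *m B.
have bk : (b <= k)%MS by apply: submx_trans (submxMl _ _) Bk.
have rep v : (v <= k)%MS -> (v *m c) 0 0 = killing v b.
  move=> vk; have /submxP [a ->] : (v <= B)%MS by rewrite eB.
  rewrite (killingE lie) /b trmx_mul trmxK !mulmxA.
  have -> : a *m B *m killing_mx br *m B^T = a *m G by rewrite /G !mulmxA.
  by rewrite -[a *m G *m _]mulmxA mulmxV // mulmx1.
have xxb : br x (br x b) = 0.
  apply: killing_nondegenerate; first by rewrite !triple_centralizer_br.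
  move=> v vk; rewrite !killingBr opprK killingC -rep; last by rewrite !triple_centralizer_br.
  have /submxP [d vd] := vk.
  have e1 : br x (br x v) = d *m W by rewrite -!(mul_ad_mx lie) vd /W !mulmxA.
  by rewrite e1 -mulmxA Wc mulmx0 mxE.
(* [[x, [x, b]] = 0] says that [ad x] commutes with its commutator with [ad b], so the product of
   [ad x] and [ad b] is nilpotent and its trace [killing x b] vanishes. *)
rewrite rep //; have comm : GRing.comm (ad x) (ad x * ad b - ad b * ad x).
  have -> : ad x * ad b - ad b * ad x = - ad (br x b) by rewrite (ad_mx_br lie) opprB.
  apply: commrN; have := ad_mx_br lie x (br x b); rewrite xxb.
  have -> : ad 0 = 0 by have := ad_mxZ lie 0 0; rewrite !scale0r.
  by move=> /esym/eqP; rewrite subr_eq0 => /eqP/esym.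
have [l /mxtrace_nilpotent trl] := nilpotent_mul char0 comm xN.
exact: trl.
Qed.

End CentralizerOfTriple.

Lemma grade0 (K : fieldType) n (br : 'rV[K]_n -> 'rV[K]_n -> 'rV[K]_n) h :
  grade br h 0 = kermx (ad_mx br h).
Proof. by rewrite /grade mulr0z raddf0 subr0. Qed.

Lemma kermx_ad_br (K : fieldType) n (br : 'rV[K]_n -> 'rV[K]_n -> 'rV[K]_n) w u v :
  lie_axioms br -> (u <= kermx (ad_mx br w))%MS -> (v <= kermx (ad_mx br w))%MS ->
  (br u v <= kermx (ad_mx br w))%MS.
Proof.
move=> lie /sub_kermxP uw /sub_kermxP vw; apply/sub_kermxP; move: uw vw.
by rewrite !(mul_ad_mx lie) (br_leibniz lie) => -> ->; rewrite (br0l lie) (br0r lie) addr0.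
Qed.

(** * The centralizer of an even nilpotent element *)

Theorem theorem6p1 (K : closedFieldType) (n : nat)
    (br : 'rV[K]_n -> 'rV[K]_n -> 'rV[K]_n) (e h f : 'rV[K]_n) :
  [pchar K] =i pred0 ->
  is_lie_bracket br ->
  semisimple br ->
  ad_nilpotent br e ->
  sl2_triple br e h f ->
  even_triple br h ->
  (exists x : 'rV[K]_n,
     regular_nilpotent_in br (centralizer br e :&: grade br h 0)%MS x /\
     regular_nilpotent_in br (grade br h 0) x) ->
  exists ds : seq nat,
    invariants_free_with_degrees br (centralizer br e) ds /\
    invariants_free_with_degrees br (grade br h 0) ds.
Proof.
move=> char0 lie0 ss e_nil triple even_h [x [[[xk _] x_nil] [[xQ0 reg0] _]]].
have lie := semisimple_lie_axioms char0 lie0 ss.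
have [k1 Ek1] := ad_nilpotentP lie e_nil.
have [k2 Fk2] : exists k, ad_mx br f ^+ k = 0.
  apply: (@eigen_ad_nilpotent _ _ char0 _ (ad_mx br h) 2%:R); first exact: natrS0.
  by rewrite -opprB (triple_FH lie triple) opprK.
(* A common nilpotency bound for [ad e] and [ad f]; the extra 2 keeps the linear term of the
   truncated exponential. *)
pose M := (k1 + k2 + 2)%N.
have M_gt1 : (1 < M)%N by rewrite /M addn2.
have EM : ad_mx br e ^+ M = 0 by rewrite /M -addnA exprD Ek1 mul0r.
have FM : ad_mx br f ^+ M = 0 by rewrite /M addnAC addnC exprD Fk2 mul0r.
have [y [yk hx]] := exists_opposite char0 lie ss triple even_h M_gt1 EM FM xk x_nil.
pose h' := br x y.
have h'k := triple_centralizer_br lie xk yk.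
have [N xN] := ad_nilpotentP lie x_nil.
set k := (_ :&: _)%MS in xk yk h'k.
pose Q1 := centralizer br e; pose Q0 := grade br h 0.
have kQ1 (u : 'rV_n) : (u <= k)%MS -> (u <= Q1)%MS by move=> uk; rewrite (submx_trans uk) // capmxSl.
have kQ0 (u : 'rV_n) : (u <= k)%MS -> (u <= Q0)%MS by move=> uk; rewrite (submx_trans uk) // capmxSr.
have Q0E : Q0 = kermx (ad_mx br h) by apply: grade0.
have sub1 u v : (u <= Q1)%MS -> (v <= Q1)%MS -> (br u v <= Q1)%MS by apply: kermx_ad_br.
have sub0 u v : (u <= Q0)%MS -> (v <= Q0)%MS -> (br u v <= Q0)%MS.
  by rewrite Q0E; apply: kermx_ad_br.
pose Psi := even_shift br h f M.
have Psi_comm z : (z <= k)%MS -> GRing.comm (ad_mx br z) Psi.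
  move=> zk; have [_ hz] := triple_centralizerP lie e h _ zk.
  have fz := br_f_eq0 char0 lie triple EM zk.
  have ad0 : ad_mx br 0 = 0 by have := ad_mxZ lie 0 0; rewrite !scale0r.
  apply: even_shift_comm; [have := ad_mx_br lie h z | have := ad_mx_br lie f z].
    by rewrite hz ad0 => /esym/eqP; rewrite subr_eq0 => /eqP.
  by rewrite fz ad0 => /esym/eqP; rewrite subr_eq0 => /eqP.
have Psi_in (u : 'rV_n) : (u <= Q1)%MS -> (u *m Psi <= Q0)%MS.
  move=> /sub_kermxP uE; rewrite Q0E; apply/sub_kermxP.
  exact: (even_shift_in char0 lie triple even_h M_gt1 EM uE).
have Psi_inj (U : 'M[K]_n) : (U <= Q1)%MS -> \rank (U *m Psi) = \rank U.
  move=> UQ1; rewrite -(mxrank_mul_ker U Psi) (_ : (U :&: kermx Psi)%MS = 0) ?mxrank0 ?addn0 //.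
  apply/eqP; rewrite -submx0; apply/rV_subP => u; rewrite sub_capmx submx0 => /andP [uU /sub_kermxP u0].
  apply/eqP; apply: (even_shift_inj char0 lie triple even_h M_gt1 EM) u0.
  exact/sub_kermxP/(submx_trans uU).
(* [Psi] embeds the centralizer of [x] in [g_e] into its centralizer in [g(0)], which is minimal
   there; [deform_centralizer] carries this bound back to every [z] in [g_e]. *)
have reg1 z : (z <= Q1)%MS ->
    (\rank (centralizer_in br Q1 x) <= \rank (centralizer_in br Q1 z))%N.
  move=> /sub_kermxP zE; apply: (deform_centralizer char0 lie triple even_h M_gt1 EM zE) => w wH.
  have wQ0 : (w <= Q0)%MS by rewrite Q0E; apply/sub_kermxP.
  rewrite -Q0E; apply: leq_trans (reg0 w wQ0).
  rewrite -Psi_inj; last exact: capmxSl.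
  apply/mxrankS/rV_subP => _ /submxP [c ->]; rewrite mulmxA; set u := c *m _.
  have : (u <= centralizer_in br Q1 x)%MS by apply: submxMl.
  rewrite /centralizer_in !sub_capmx => /andP [uQ1 /sub_kermxP ux].
  rewrite Psi_in //=; apply/sub_kermxP; rewrite -mulmxA mulmxE -[Psi * _](Psi_comm x xk).
  by rewrite -mulmxE mulmxA ux mul0mx.
have rkQ : \rank Q0 = \rank Q1.
  apply/eqP; rewrite eqn_leq {1}Q0E (rank_ker_h char0 lie triple M_gt1 EM) /=.
  rewrite -Psi_inj //; apply/mxrankS/rV_subP => _ /submxP [c ->]; rewrite mulmxA.
  by apply: Psi_in; apply: submxMl.
have lie_in0 := br_in_lie lie sub0.
pose X0 := ad_mx (br_in br (Q:=Q0)) (coord_of Q0 x).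
pose H0 := ad_mx (br_in br (Q:=Q0)) (coord_of Q0 h').
have XH0 : X0 *m H0 - H0 *m X0 = 2%:R *: X0.
  rewrite -(ad_mx_br lie_in0) br_in_co ?kQ0 // hx.
  by rewrite /coord_of -scalemxAl (ad_mxZ lie_in0).
(* Regularity of [x] in [g(0)] compared with the element [h'] of [g(0)]; this feeds the dimension
   count behind the even weights. *)
have rk0 : (\rank H0 <= \rank X0)%N.
  have := rank_ad_br_in lie sub0 (coord_of Q0 x).
  have := rank_ad_br_in lie sub0 (coord_of Q0 h').
  rewrite !coK ?kQ0 // -/X0 -/H0 => rH rX.
  rewrite -(leq_add2r (\rank (centralizer_in br Q0 x))) rX -[X in (_ <= X)%N]rH leq_add2l.
  by apply: reg0; apply: kQ0.
have [ds [Xi [T slice0]]] := slice_data_exists char0 XH0 (ad_br_in_nilpotent lie sub0 xQ0 xN) rk0.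
(* The matrix of [Psi : g_e -> g(0)] in the two row bases. *)
pose P := row_base Q1 *m Psi *m pinvmx (row_base Q0).
have PB : P *m row_base Q0 = row_base Q1 *m Psi.
  rewrite mulmxKpV // eq_row_base; apply/row_subP => i; rewrite row_mul; apply: Psi_in.
  by rewrite (submx_trans (row_sub _ _)) // eq_row_base.
have fP : row_free P.
  rewrite /row_free eqn_leq rank_leq_row /= -[X in (X <= _)%N](Psi_inj Q1) //.
  rewrite -(mxrankMfree _ (row_base_free Q0)) PB.
  by rewrite (eqmxMr _ (eq_row_base Q1)).
have transfer z : (z <= k)%MS -> ad_mx (br_in br (Q:=Q1)) (coord_of Q1 z) *m P =
    P *m ad_mx (br_in br (Q:=Q0)) (coord_of Q0 z).
  move=> zk; apply: (row_free_inj (row_base_free Q0)).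
  rewrite -mulmxA PB mulmxA (ad_br_inK lie sub1) coK ?kQ1 //.
  rewrite -[RHS]mulmxA (ad_br_inK lie sub0) coK ?kQ0 // mulmxA PB.
  by rewrite -[LHS]mulmxA -[RHS]mulmxA; congr (_ *m _); apply: Psi_comm.
have [Xi1 [T1 slice1]] := slice_data_transport rkQ fP (transfer x xk) (transfer h' h'k) slice0.
exists ds; split.
  apply: (invariants_free char0 lie sub1 (kQ1 x xk) (kQ1 _ h'k) (kQ1 y yk) hx) slice1 => //.
  exact: xN.
apply: (invariants_free char0 lie sub0 xQ0 (kQ0 _ h'k) (kQ0 y yk) hx) slice0 => //.
exact: xN.
Qed.
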